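(* Let $(M,L)$ be a Finsler manifold which is $C$-reducible, or $P$-reducible, or $C_2$-like, or a $P^*$-Finsler manifold. Then $(M,L)$ is a Landsberg manifold if and only if it is a general Landsberg manifold.
   Context: Setting. $M$ is a smooth manifold of finite dimension $n$, $\pi:\mathcal{T}M\to M$ is the bundle of nonzero tangent vectors, $\pi^{-1}(TM)\to\mathcal{T}M$ is the pullback of $TM$ by $\pi$, and $\mathfrak{X}(\pi(M))$ is the module of its smooth sections ($\pi$-vector fields, written $\overline{X}$). Tensor fields on the bundle $\pi^{-1}(TM)$ are called $\pi$-tensor fields; a $\pi$-form of order $p$ is a $\pi$-tensor field of type $(0,p)$. $\overline{\eta}(u)=(u,u)$ is the fundamental $\pi$-vector field. $\rho:T(\mathcal{T}M)\to\pi^{-1}(TM)$ is $\rho=(\pi_{\mathcal{T}M},d\pi)$ and $\gamma:\pi^{-1}(TM)\to V(\mathcal{T}M)$ is the natural isomorphism (vertical lift) onto the vertical bundle. $(M,L)$ is a Finsler manifold ($L$ positively homogeneous of degree $1$, smooth on $\mathcal{T}M$, with positive definite metric $g$ on $\pi^{-1}(TM)$ of components $g_{ij}=\frac12\partial^2L^2/\partial y^i\partial y^j$). Put $\ell(\overline{X})=L^{-1}g(\overline{X},\overline{\eta})$ and $\hbar=g-\ell\otimes\ell$; $\widehat g$ is the metric induced by $g$ on $\pi^{-1}(T^*M)$. A linear connection $\nabla$ in $\pi^{-1}(TM)$ is regular if, with $K(X)=\nabla_X\overline{\eta}$ and $H(\mathcal{T}M)=\ker K$, one has $T(\mathcal{T}M)=V(\mathcal{T}M)\oplus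 H(\mathcal{T}M)$; then $\beta=(\rho|_{H(\mathcal{T}M)})^{-1}$. Its torsion is $\mathbf{T}(X,Y)=\nabla_X\rho Y-\nabla_Y\rho X-\rho[X,Y]$; put $Q(\overline{X},\overline{Y})=\mathbf{T}(\beta\overline{X},\beta\overline{Y})$ and $T(\overline{X},\overline{Y})=\mathbf{T}(\gamma\overline{X},\beta\overline{Y})$. Throughout, $\nabla$ is the Cartan connection: the unique regular connection with $\nabla g=0$, $Q=0$ and $g(T(\overline{X},\overline{Y}),\overline{Z})=g(T(\overline{X},\overline{Z}),\overline{Y})$. Write $T(\overline{X},\overline{Y},\overline{Z})=g(T(\overline{X},\overline{Y}),\overline{Z})$, $C(\overline{X})=\mathrm{Tr}\{\overline{Y}\mapsto T(\overline{X},\overline{Y})\}$, $g(\overline{C},\overline{X})=C(\overline{X})$, $C^2=\widehat g(C,C)=C(\overline{C})$. The classical curvature is $\mathbf{K}(X,Y)\rho Z=-\nabla_X\nabla_Y\rho Z+\nabla_Y\nabla_X\rho Z+\nabla_{[X,Y]}\rho Z$, the mixed curvature is $P(\overline{X},\overline{Y})\overline{Z}=\mathbf{K}(\beta\overline{X},\gamma\overline{Y})\overline{Z}$, and $\widehat{P}(\overline{X},\overline{Y})=P(\overline{X},\overline{Y})\overline{\eta}$. Definitions. $(M,L)$ is: - Landsberg if $\widehat{P}=0$, equivalently $\nabla_{\beta\overline{\eta}}T=0$; - general Landsberg if $\mathrm{Tr}\{\overline{Y}\mapsto\widehat{P}(\overline{X},\overline{Y})\}=0$ for all $\overline{X}$,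 equivalently $\nabla_{\beta\overline{\eta}}C=0$; - $C$-reducible if $\dim M\ge3$ and $T(\overline{X},\overline{Y},\overline{Z})=\frac{1}{n+1}\{\hbar(\overline{X},\overline{Y})C(\overline{Z})+\hbar(\overline{Y},\overline{Z})C(\overline{X})+\hbar(\overline{Z},\overline{X})C(\overline{Y})\}$; - $P$-reducible if $\dim M\ge3$ and $g(P(\overline{X},\overline{Y})\overline{\eta},\overline{Z})=\delta(\overline{X})\hbar(\overline{Y},\overline{Z})+\delta(\overline{Y})\hbar(\overline{Z},\overline{X})+\delta(\overline{Z})\hbar(\overline{X},\overline{Y})$ for some $\pi$-form $\delta$ of order one with $\delta(\overline{\eta})=0$; - $C_2$-like if $\dim M\ge2$, $C^2\ne0$ and $T(\overline{X},\overline{Y},\overline{Z})=\frac{1}{C^2}C(\overline{X})C(\overline{Y})C(\overline{Z})$; - $P^*$-Finsler if $C^2\neq0$ and $\nabla_{\beta\overline{\eta}}T=\lambda T$ with $\lambda=\widehat g(\nabla_{\beta\overline{\eta}}C,C)/C^2$. *)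

(* Defs.v *)
From HB Require Import structures.
From mathcomp Require Import all_boot all_order all_algebra.
From mathcomp Require Import all_classical all_reals all_analysis.
Set Implicit Arguments.
Unset Strict Implicit.
Unset Printing Implicit Defensive.
Import Order.TTheory GRing.Theory Num.Theory.
Import numFieldNormedType.Exports.
Local Open Scope classical_set_scope.
Local Open Scope ring_scope.

(** * C^infinity functions of k real variables *)

Section Smooth.
Variables (R : realType) (k : nat).

Fixpoint iter_partial (s : seq 'I_k) (f : 'rV[R]_k -> R^o) : 'rV[R]_k -> R^o :=
  if s is i :: s' then
    fun x => 'D_(delta_mx 0 i : 'rV[R]_k) (iter_partial s' f) x
  else f.

Definition smooth_near (f : 'rV[R]_k -> R^o) (x : 'rV[R]_k) : Prop :=
  \forall y \near x, forall s, differentiable (iter_partial s f) y.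

End Smooth.

(** * Charts, smooth functions, tangent vectors

    A [chart_system] only carries data.  It is used both for a manifold and
    for its slit tangent bundle, which is why it is separated from the axioms
    of a smooth atlas. *)

Record chart_system (R : realType) (N : Type) (k : nat) := ChartSystem {
  cidx : Type;
  cdom : cidx -> set N;
  cfwd : cidx -> N -> 'rV[R]_k;
  cbwd : cidx -> 'rV[R]_k -> N }.

(** Functionals on real functions on [N]; tangent vectors of [N] are some of
    them.  The codomain is [R^o] so that they form an [R]-module. *)
Notation functional R N := ((N -> R) -> R^o).

Section Charts.
Variables (R : realType) (N : Type) (k : nat) (A : chart_system R N k).

Definition smooth_at (u : N) (f : N -> R) : Prop :=
  forall a : cidx A, cdom a u -> smooth_near (f \o cbwd a) (cfwd a u).

Definition chart_open (W : set N) : Prop :=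
  forall u, W u -> forall a : cidx A, cdom a u ->
    \forall z \near cfwd a u, W (cbwd a z).

(** The derivation of germs at [u] with components [v] in the chart [a].  It
    is set to 0 on functions that are not smooth near [u], so that equality of
    tangent vectors is equality of functionals. *)
Definition tangent_vec (a : cidx A) (u : N) (v : 'rV[R]_k) : functional R N :=
  fun f => if `[< smooth_at u f >] then 'D_v (f \o cbwd a : _ -> R^o) (cfwd a u)
           else 0.

Definition tangent (u : N) : set (functional R N) :=
  [set xi | exists a v, cdom a u /\ xi = tangent_vec a u v].

Definition coord (a : cidx A) (i : 'I_k) : N -> R := fun u => cfwd a u 0 i.

End Charts.

(** * Smooth manifolds *)

Record smooth_atlas (R : realType) (M : topologicalType) (n : nat)
    (A : chart_system R M n) : Prop := {
  dom_open : forall a : cidx A, open (cdom a);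
  img_open : forall a : cidx A, open (cfwd a @` cdom a);
  cfwdK : forall (a : cidx A) x, cdom a x -> cbwd a (cfwd a x) = x;
  cfwd_continuous : forall (a : cidx A) x, cdom a x -> {for x, continuous (cfwd a)};
  cbwd_continuous : forall (a : cidx A) z, (cfwd a @` cdom a) z ->
    {for z, continuous (cbwd a)};
  charts_cover : forall x, exists a : cidx A, cdom a x;
  transition_smooth : forall (a b : cidx A) i z,
    (cfwd a @` (cdom a `&` cdom b)) z ->
    smooth_near (fun y => cfwd b (cbwd a y) 0 i) z }.

Record manifold (R : realType) (n : nat) := Manifold {
  mcarrier :> topologicalType;
  mhausdorff : hausdorff_space mcarrier;
  msecond_countable : @second_countable mcarrier;
  mcharts : chart_system R mcarrier n;
  matlas : smooth_atlas mcharts }.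

Section TangentBundle.
Variables (R : realType) (n : nat) (M : manifold R n).

Notation ChM := (mcharts M).

(** Points of the tangent bundle are pairs [(x, v)] with [v] tangent at [x];
    [slit] selects those with [v != 0]. *)
Definition TM : Type := (M * functional R M)%type.

Definition slit : set TM := [set u | tangent ChM u.1 u.2 /\ u.2 <> 0].

(** The charts (x^i, y^i) of the slit tangent bundle. *)
Definition slit_charts : chart_system R TM (n + n) := {|
  cidx := cidx ChM;
  cdom a := [set u | slit u /\ cdom a u.1];
  cfwd a u := row_mx (cfwd a u.1) (\row_i u.2 (coord a i));
  cbwd a z := (cbwd a (lsubmx z),
               tangent_vec a (cbwd a (lsubmx z)) (rsubmx z)) |}.

Definition slit_open (W : set TM) : Prop :=
  W `<=` slit /\ chart_open slit_charts W.

(** Fields are total functions, considered only on an open subset [W] of the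
    slit tangent bundle.  The fibre of the pulled back bundle at [u] is the
    tangent space of [M] at [u.1]. *)
Definition tfield : Type := TM -> functional R TM.
Definition pifield : Type := TM -> functional R M.

Definition is_vfield (W : set TM) (X : tfield) : Prop :=
  forall u, W u -> tangent slit_charts u (X u) /\
    forall F, smooth_at slit_charts u F ->
      smooth_at slit_charts u (fun v => X v F).

Definition is_pifield (W : set TM) (X : pifield) : Prop :=
  forall u, W u -> tangent ChM u.1 (X u) /\
    forall f, smooth_at ChM u.1 f -> smooth_at slit_charts u (fun v => X v f).

Definition bracket (X Y : tfield) : tfield := fun u F =>
  if `[< smooth_at slit_charts u F >]
  then X u (fun v => Y v F) - Y u (fun v => X v F) else 0.

Definition eta : pifield := fun u => u.2.

(** On the fibre at [u], [rho] is the differential of the projection. *)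
Definition rho (u : TM) (xi : functional R TM) : functional R M := fun f =>
  if `[< smooth_at ChM u.1 f >] then xi (f \o fst) else 0.

Definition gamma (u : TM) (w : functional R M) : functional R TM := fun F =>
  if `[< smooth_at slit_charts u F >]
  then derive1 (fun t : R => F (u.1, u.2 + t *: w) : R^o) 0 else 0.

Definition rhoF (X : tfield) : pifield := fun u => rho u (X u).
Definition gammaF (X : pifield) : tfield := fun u => gamma u (X u).

Definition vertical (u : TM) : set (functional R TM) :=
  [set xi | tangent slit_charts u xi /\ rho u xi = 0].

(** * Linear connections

    [nabla u xi X] is the covariant derivative at [u] of the section [X] along
    the tangent vector [xi] at [u].  A connection is taken to act on local
    sections, compatibly with restrictions ([nabla_local]). *)
Record linear_connection := LinearConnection {
  nabla :> TM -> functional R TM -> pifield -> functional R M;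
  nabla_smooth : forall W X Y, slit_open W -> is_vfield W X -> is_pifield W Y ->
    is_pifield W (fun u => nabla u (X u) Y);
  nabla_local : forall W Y Y', slit_open W -> is_pifield W Y ->
    (forall u, W u -> Y u = Y' u) ->
    forall u xi, W u -> tangent slit_charts u xi ->
    nabla u xi Y = nabla u xi Y';
  nabla_linear : forall W Y u c xi xi', slit_open W -> is_pifield W Y -> W u ->
    tangent slit_charts u xi -> tangent slit_charts u xi' ->
    nabla u (c *: xi + xi') Y = c *: nabla u xi Y + nabla u xi' Y;
  nabla_add : forall W Y Y' u xi, slit_open W ->
    is_pifield W Y -> is_pifield W Y' -> W u -> tangent slit_charts u xi ->
    nabla u xi (fun v => Y v + Y' v) = nabla u xi Y + nabla u xi Y';
  nabla_leibniz : forall W f Y u xi, slit_open W ->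
    (forall v, W v -> smooth_at slit_charts v f) -> is_pifield W Y ->
    W u -> tangent slit_charts u xi ->
    nabla u xi (fun v => f v *: Y v) = xi f *: Y u + f u *: nabla u xi Y }.

(** An arbitrary chart around a point. *)
Definition chart_at (x : M) : cidx ChM :=
  projT1 (cid (charts_cover (matlas M) x)).

Definition frame (a : cidx ChM) (i : 'I_n) : pifield :=
  fun u => tangent_vec a u.1 (delta_mx 0 i).

(** Trace at [u] of a tensorial operator on sections, computed in the
    coordinate frame d/dx^i and its dual coframe dx^i. *)
Definition trace (E : pifield -> pifield) (u : TM) : R :=
  \sum_(i < n) E (frame (chart_at u.1) i) u (coord (chart_at u.1) i).

(** pi-forms of order one *)
Definition is_piform1 (delta : TM -> functional R M -> R) : Prop :=
  (forall u c w w', slit u -> tangent ChM u.1 w -> tangent ChM u.1 w' ->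
     delta u (c *: w + w') = c * delta u w + delta u w') /\
  (forall W X u, slit_open W -> is_pifield W X -> W u ->
     smooth_at slit_charts u (fun v => delta v (X v))).

(** * Finsler structures *)

(** The bilinear form with components (1/2) d^2 L^2 / dy^i dy^j. *)
Definition fundamental_form (L : TM -> R) (u : TM) (w w' : functional R M) : R :=
  2^-1 * derive1 (fun s : R =>
    derive1 (fun t : R => L (u.1, u.2 + s *: w + t *: w') ^+ 2 : R^o) 0 : R^o) 0.

Record finsler := Finsler {
  Lfun :> TM -> R;
  L_smooth : forall u, slit u -> smooth_at slit_charts u Lfun;
  L_homogeneous : forall u t, slit u -> 0 < t ->
    Lfun (u.1, t *: u.2) = t * Lfun u;
  L_posdef : forall u w, slit u -> tangent ChM u.1 w -> w <> 0 ->
    0 < fundamental_form Lfun u w w }.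

Section Finsler.
Variable (L : finsler).

Definition g : TM -> functional R M -> functional R M -> R := fundamental_form L.

Definition ell (u : TM) (w : functional R M) : R := (L u)^-1 * g u w (eta u).

Definition hbar (u : TM) (w w' : functional R M) : R :=
  g u w w' - ell u w * ell u w'.

(** Forms of order one as operators on sections, and the metric [ghat] induced
    by [g] on them. *)
Definition sharp (theta : pifield -> TM -> R) : pifield := fun u =>
  xget 0 [set w | tangent ChM u.1 w /\
    forall W X, slit_open W -> is_pifield W X -> W u -> g u w (X u) = theta X u].

Definition ghat (theta theta' : pifield -> TM -> R) (u : TM) : R :=
  g u (sharp theta u) (sharp theta' u).

Variable (D : linear_connection).

Definition cov (X : tfield) (Y : pifield) : pifield := fun u => D u (X u) Y.

Definition Kmap (u : TM) (xi : functional R TM) : functional R M := D u xi eta.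

Definition horizontal (u : TM) : set (functional R TM) :=
  [set xi | tangent slit_charts u xi /\ Kmap u xi = 0].

Definition regular : Prop := forall u, slit u ->
  (forall xi, tangent slit_charts u xi ->
     exists v h, [/\ vertical u v, horizontal u h & xi = v + h]) /\
  (forall xi, vertical u xi -> horizontal u xi -> xi = 0).

(** The inverse of the restriction of [rho] to the horizontal space. *)
Definition beta (u : TM) (w : functional R M) : functional R TM :=
  xget 0 [set xi | horizontal u xi /\ rho u xi = w].

Definition betaF (X : pifield) : tfield := fun u => beta u (X u).

Definition torsion (X Y : tfield) : pifield := fun u =>
  cov X (rhoF Y) u - cov Y (rhoF X) u - rho u (bracket X Y u).

Definition Qtor (X Y : pifield) : pifield := torsion (betaF X) (betaF Y).
Definition Ttor (X Y : pifield) : pifield := torsion (gammaF X) (betaF Y).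

Definition T3 (X Y Z : pifield) (u : TM) : R := g u (Ttor X Y u) (Z u).

Definition metrical : Prop := forall W X Y Z u, slit_open W ->
  is_vfield W X -> is_pifield W Y -> is_pifield W Z -> W u ->
  X u (fun v => g v (Y v) (Z v)) = g u (cov X Y u) (Z u) + g u (Y u) (cov X Z u).

Definition is_cartan : Prop :=
  [/\ regular,
      metrical,
      (forall W X Y u, slit_open W -> is_pifield W X -> is_pifield W Y -> W u ->
         Qtor X Y u = 0) &
      (forall W X Y Z u, slit_open W -> is_pifield W X -> is_pifield W Y ->
         is_pifield W Z -> W u ->
         g u (Ttor X Y u) (Z u) = g u (Ttor X Z u) (Y u))].

Definition Cform (X : pifield) (u : TM) : R := trace (fun Y => Ttor X Y) u.

Definition Csq (u : TM) : R := ghat Cform Cform u.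

Definition curvature (X Y : tfield) (Z : pifield) : pifield := fun u =>
  - cov X (cov Y Z) u + cov Y (cov X Z) u + cov (bracket X Y) Z u.

Definition Pcurv (X Y Z : pifield) : pifield := curvature (betaF X) (gammaF Y) Z.

Definition Phat (X Y : pifield) : pifield := Pcurv X Y eta.

Definition cov_form (X : tfield) (theta : pifield -> TM -> R)
    (Y : pifield) (u : TM) : R :=
  X u (theta Y) - theta (cov X Y) u.

Definition cov_tensor (X : tfield) (S : pifield -> pifield -> pifield)
    (Y Z : pifield) : pifield := fun u =>
  cov X (S Y Z) u - S (cov X Y) Z u - S Y (cov X Z) u.

(** * Special Finsler spaces *)

Definition landsberg : Prop := forall W X Y u, slit_open W ->
  is_pifield W X -> is_pifield W Y -> W u -> Phat X Y u = 0.

Definition general_landsberg : Prop := forall W X u, slit_open W ->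
  is_pifield W X -> W u -> trace (fun Y => Phat X Y) u = 0.

Definition C_reducible : Prop := (3 <= n)%N /\
  forall W X Y Z u, slit_open W -> is_pifield W X -> is_pifield W Y ->
    is_pifield W Z -> W u ->
    T3 X Y Z u = (n.+1%:R)^-1 *
      (hbar u (X u) (Y u) * Cform Z u + hbar u (Y u) (Z u) * Cform X u
       + hbar u (Z u) (X u) * Cform Y u).

Definition P_reducible : Prop := (3 <= n)%N /\
  exists delta : TM -> functional R M -> R,
    [/\ is_piform1 delta,
        (forall u, slit u -> delta u (eta u) = 0) &
        forall W X Y Z u, slit_open W -> is_pifield W X -> is_pifield W Y ->
          is_pifield W Z -> W u ->
          g u (Phat X Y u) (Z u) =
            delta u (X u) * hbar u (Y u) (Z u)
            + delta u (Y u) * hbar u (Z u) (X u)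
            + delta u (Z u) * hbar u (X u) (Y u)].

Definition C2_like : Prop := [/\ (2 <= n)%N,
  (forall u, slit u -> Csq u <> 0) &
  forall W X Y Z u, slit_open W -> is_pifield W X -> is_pifield W Y ->
    is_pifield W Z -> W u ->
    T3 X Y Z u = (Csq u)^-1 * (Cform X u * Cform Y u * Cform Z u)].

Definition P_star : Prop := (forall u, slit u -> Csq u <> 0) /\
  forall W X Y u, slit_open W -> is_pifield W X -> is_pifield W Y -> W u ->
    cov_tensor (betaF eta) Ttor X Y u =
      (ghat (cov_form (betaF eta) Cform) Cform u / Csq u) *: Ttor X Y u.

End Finsler.
End TangentBundle.

(* Main.v *)
(** All four classes are handled in local coordinates (x^i, y^i) of the slit
    tangent bundle, with delta_k = d/dx^k - N^r_k d/dy^r the horizontal lift of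
    d/dx^k and F^r_kj the horizontal coefficients of the Cartan connection.

    The vertical coefficients of the connection are the torsion components
    T^k_ij; metricity and the symmetry of T give T_ijk = 1/2 dg_jk/dy^i, which
    is totally symmetric and is annihilated by y.  Hence K (gamma X) = X,
    N^r_k = y^h F^r_kh and Phat^i_jm = dN^i_j/dy^m - F^i_jm.  Differentiating
    delta_k g_jl = F_kjl + F_klj in y^m, solving for dF^r_kj/dy^m by the
    Christoffel trick and contracting with y gives Phat^l_jm = (nabla_0 T)^l_mj,
    where nabla_0 is the derivative along beta(eta).

    So in a general Landsberg space nabla_0 C = 0.  For a P-reducible space the
    trace of Phat is (n + 1) delta, so that delta = 0.  For a C-reducible space T
    is a combination of products of hbar and C, and nabla_0 hbar = 0, so that
    nabla_0 T = 0.  For C_2-like and P*-spaces nabla_0 T = mu T for some scalar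
    mu, and taking traces mu C = 0 with C <> 0. *)
From HB Require Import structures.
From mathcomp Require Import all_boot all_order all_algebra.
From mathcomp Require Import all_classical all_reals all_analysis.
From mathcomp Require Import ring lra.
Require Import Defs.
Set Implicit Arguments.
Unset Strict Implicit.
Unset Printing Implicit Defensive.
Import Order.TTheory GRing.Theory Num.Theory.
Import numFieldNormedType.Exports.
Local Open Scope classical_set_scope.
Local Open Scope ring_scope.


(** * Smooth functions of several real variables *)

(** Solving for dF^r_kj/dy^m does not isolate Phat at once. Its equation contains dN^r_k/dy^m =
    F^r_km + Phat^r_km, so after the contraction with y the term y^h Phat^r_hm T_rjl remains on the
    other side. A second contraction with y removes it: y annihilates T and every nabla_k T, hence
    y^h Phat^r_hm = 0 by nondegeneracy of the metric.

    The other obstacle is the trace. At each point v, [trace] uses the frame of [chart_at v.1], an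
    arbitrary choice that may jump with v, so [Cform] cannot be differentiated from its definition.
    For C-reducible and C_2-like spaces the defining identity of T, contracted in one fixed chart,
    forces [Cform] to be the contraction of T in that chart, at all its points; this contraction is
    smooth. For P*-spaces the scalar mu is given, nothing has to be differentiated, and the
    comparison at one point in its chosen chart is enough. For P-reducible spaces [Cform] does not
    occur. *)

Lemma nearI (T : topologicalType) (x : T) (P Q : T -> Prop) :
  (\forall y \near x, P y) -> (\forall y \near x, Q y) -> \forall y \near x, P y /\ Q y.
Proof. exact: filterI. Qed.

Lemma near_forall (T : topologicalType) (I : finType) (x : T) (P : I -> T -> Prop) :
  (forall i, \forall y \near x, P i y) -> \forall y \near x, forall i, P i y.
Proof.
by move=> h; exact: (@filter_forall _ _ (fun i => [set y | P i y]) (nbhs x) _ h).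
Qed.

Section NearDifferentiable.
Variables (R : numFieldType) (V W : normedModType R).

(** The first-order expansion of [f] at [x] is also one of [g], and [diff_unique] turns such an
    expansion with a continuous linear part into the differential. *)
Lemma near_eq_differentiable (f g : V -> W) (x : V) :
  (\near x, f x = g x) -> differentiable f x -> differentiable g x.
Proof.
move=> fg df.
have gx : g \o shift x = cst (g x) + 'd f x +o_ 0 id.
  apply/eqaddoP => e e0.
  have /eqaddoP/(_ _ e0) := diff_locally df.
  have fg0 : \forall h \near 0, f (h + x) = g (h + x).
    by move: fg; rewrite (near_shift 0) subr0.
  apply: filterS2 fg0 => h /= fgh.
  by rewrite !fctE /= fgh (nbhs_singleton fg).
have E := diff_unique (diff_continuous df) gx.
by apply/diff_locallyP; rewrite E; split=> //; exact: diff_continuous.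
Qed.

End NearDifferentiable.

Section Smoothness.
Variable R : realType.

Section Partials.
Variable k : nat.
Local Notation V := 'rV[R]_k.
Implicit Types (f g : V -> R^o) (U : set V) (m : nat).

Lemma derive_partial f (x v : V) : differentiable f x ->
  'D_v f x = \sum_i v 0 i * 'D_(delta_mx 0 i : V) f x.
Proof.
move=> df; rewrite deriveE // {1}(row_sum_delta v) linear_sum.
by apply: eq_bigr => i _; rewrite linearZ deriveE.
Qed.

(** The recursion peels off the derivative taken first, whereas [iter_partial] adds the one taken
    last; in this form the Leibniz and chain rules can be used inductively. The set [U] is the same
    at all orders, so no neighbourhood shrinks along an induction. *)
Fixpoint Ck m U f : Prop :=
  (forall x, U x -> differentiable f x) /\
  if m is m'.+1 then forall i, Ck m' U ('D_(delta_mx 0 i : V) f) else True.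

Lemma Ck_differentiable m U f x : Ck m U f -> U x -> differentiable f x.
Proof. by case: m => [|m] [df _]; exact: df. Qed.

Lemma iter_partial_rcons (s : seq 'I_k) i f :
  iter_partial (rcons s i) f = iter_partial s ('D_(delta_mx 0 i : V) f).
Proof. by elim: s => //= j s ->. Qed.

Lemma CkP m U f : Ck m U f <->
  forall s, (size s <= m)%N -> forall x, U x -> differentiable (iter_partial s f) x.
Proof.
elim: m f => [|m IH] f /=.
  split=> [[df _] s|df]; first by rewrite leqn0 => /nilP -> x /df.
  by split=> // x; exact: (df [::]).
split=> [[df dd] s|df].
  case/lastP: s => [|s i]; first by move=> _ x /df.
  rewrite size_rcons ltnS => sm x Ux; rewrite iter_partial_rcons.
  by move/IH : (dd i); exact.
split; first by move=> x; exact: (df [::]).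
move=> i; apply/IH => s sm x Ux; rewrite -iter_partial_rcons.
by apply: df => //; rewrite size_rcons.
Qed.

(** A single neighbourhood serves all orders, because [smooth_near] quantifies over the sequences of
    partials inside [near]. *)
Lemma smooth_nearP f x : smooth_near f x <->
  exists U, open_nbhs x U /\ forall m, Ck m U f.
Proof.
split=> [|[U [oU Uf]]].
  rewrite /smooth_near /prop_near1 nbhsE => -[U oU Uf]; exists U; split => // m.
  by apply/CkP => s _ y Uy; exact: Uf.
rewrite /smooth_near /prop_near1 nbhsE; exists U => // y Uy s.
by move/CkP : (Uf (size s)); exact.
Qed.

Lemma Ck_subset m U U' f : U' `<=` U -> Ck m U f -> Ck m U' f.
Proof.
by move=> UU' /CkP Uf; apply/CkP => s sm x /UU'; exact: Uf.
Qed.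

Lemma CkW m U f : Ck m.+1 U f -> Ck m U f.
Proof.
by move=> /CkP Uf; apply/CkP => s sm; apply: Uf; exact: leqW.
Qed.

Lemma open_near_eq U f g x : open U -> {in U, f =1 g} -> U x ->
  \near x, f x = g x.
Proof.
move=> oU fg Ux; have : \forall y \near x, U y by exact: open_nbhs_nbhs.
by apply: filterS => y Uy; apply: fg; rewrite inE.
Qed.

(** Openness of [U] makes [f] and [g] equal near each point of [U], so that their derivatives agree
    on [U] as well. *)
Lemma Ck_ext m U f g : open U -> {in U, f =1 g} -> Ck m U f -> Ck m U g.
Proof.
move=> oU; elim: m f g => [|m IH] f g fg /= [df dd].
  by split=> // x Ux; apply: near_eq_differentiable (open_near_eq oU fg Ux) (df _ Ux).
split=> [x Ux|i].
  exact: near_eq_differentiable (open_near_eq oU fg Ux) (df _ Ux).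
apply: IH (dd i) => x; rewrite inE => Ux.
exact: near_eq_derive (open_near_eq oU fg Ux).
Qed.

Lemma Ck_cst m U (c : R) : Ck m U (cst c : V -> R^o).
Proof.
elim: m c => [|m IH] c /=; split=> //; try by move=> x _; exact: differentiable_cst.
move=> i; rewrite (_ : 'D_(_) _ = cst 0 :> (V -> R^o)); first exact: IH.
by apply/funext => x; rewrite /= derive_cst.
Qed.

Lemma Ck_linear m U f : (forall c x y, f (c *: x + y) = c * f x + f y) ->
  continuous f -> Ck m U f.
Proof.
move=> lf cf; have df x : differentiable f x.
  pose F : {linear V -> R^o} := HB.pack f (GRing.isLinear.Build _ _ _ _ f lf).
  exact: (@linear_differentiable _ _ _ F).
case: m => [|m] /=; split=> // i.
suff -> : 'D_(delta_mx 0 i) f = cst (f (delta_mx 0 i)) :> (V -> R^o) by exact: Ck_cst.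
apply/funext => x /=; rewrite deriveE //.
pose F : {linear V -> R^o} := HB.pack f (GRing.isLinear.Build _ _ _ _ f lf).
by rewrite (@diff_lin _ _ _ F).
Qed.

Lemma Ck_coord m U i : Ck m U (fun x : V => x 0 i : R^o).
Proof.
apply: Ck_linear => [c x y|]; first by rewrite !mxE.
exact: coord_continuous.
Qed.

Lemma CkD m U f g : open U -> Ck m U f -> Ck m U g ->
  Ck m U (fun x => f x + g x : R^o).
Proof.
move=> oU; elim: m f g => [|m IH] f g [df ddf] [dg ddg]; split=> //.
- by move=> x Ux; apply: differentiableD; [exact: df|exact: dg].
- by move=> x Ux; apply: differentiableD; [exact: df|exact: dg].
move=> i; apply: Ck_ext (IH _ _ (ddf i) (ddg i)) => // x; rewrite inE => Ux.
by rewrite [RHS]deriveD //; apply: diff_derivable; [exact: df|exact: dg].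
Qed.

Lemma CkM m U f g : open U -> Ck m U f -> Ck m U g ->
  Ck m U (fun x => f x * g x : R^o).
Proof.
move=> oU; elim: m f g => [|m IH] f g Cf Cg; move: (Cf) (Cg) => [df ddf] [dg ddg]; split=> //.
- by move=> x Ux; apply: differentiableM; [exact: df|exact: dg].
- by move=> x Ux; apply: differentiableM; [exact: df|exact: dg].
(* The Leibniz rule pairs each function with a derivative of the other, hence [CkW] gives up one
   order of the undifferentiated factor. *)
move=> i; apply: Ck_ext (CkD oU (IH _ _ (CkW Cf) (ddg i)) (IH _ _ (CkW Cg) (ddf i))) => // x.
rewrite inE => Ux.
by rewrite [RHS]deriveM //; apply: diff_derivable; [exact: df|exact: dg].
Qed.

Lemma Ck_sum m U p (F : 'I_p -> V -> R^o) : open U -> (forall i, Ck m U (F i)) ->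
  Ck m U (fun x => \sum_i F i x).
Proof.
move=> oU; elim: p F => [|p IH] F CF.
  by apply: Ck_ext (Ck_cst m U 0) => // x _; rewrite big_ord0.
apply: Ck_ext (CkD oU (CF ord0) (IH (fun i => F (lift ord0 i)) (fun i => CF _))) => // x _.
by rewrite big_ord_recl.
Qed.

Lemma smooth_near_ext f g x : (\near x, f x = g x) -> smooth_near f x -> smooth_near g x.
Proof.
rewrite {1}/prop_near1 nbhsE => -[U' oU' fg] /smooth_nearP [U [oU Cf]].
apply/smooth_nearP; exists (U `&` U'); split; first exact: open_nbhsI.
move=> m; apply: Ck_ext (Ck_subset _ (Cf m)) => //; first by have [] := open_nbhsI oU oU'.
by move=> y; rewrite inE => -[_ /fg].
Qed.

Lemma smooth_near_differentiable f x : smooth_near f x -> differentiable f x.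
Proof. by move=> /nbhs_singleton /(_ [::]). Qed.

Lemma smooth_near_near f x : smooth_near f x -> \forall y \near x, smooth_near f y.
Proof. exact: near_join. Qed.

Lemma smooth_near_partial f i x : smooth_near f x ->
  smooth_near ('D_(delta_mx 0 i : V) f) x.
Proof.
by apply: filterS => y df s; rewrite -iter_partial_rcons; exact: df.
Qed.

Lemma smooth_near_cst (c : R) (x : V) : smooth_near (fun=> c : R^o) x.
Proof. by apply/smooth_nearP; exists setT; split=> [|m]; [split=> //; exact: openT|exact: Ck_cst]. Qed.

Lemma smooth_near_coord i (x : V) : smooth_near (fun x : V => x 0 i : R^o) x.
Proof. by apply/smooth_nearP; exists setT; split=> [|m]; [split=> //; exact: openT|exact: Ck_coord]. Qed.

Lemma smooth_near_add f g x : smooth_near f x -> smooth_near g x ->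
  smooth_near (fun y => f y + g y : R^o) x.
Proof.
move=> /smooth_nearP [U [oU Cf]] /smooth_nearP [U' [oU' Cg]].
have oI := open_nbhsI oU oU'.
apply/smooth_nearP; exists (U `&` U'); split=> // m; apply: CkD; first by case: oI.
  by apply: Ck_subset (Cf m) => y [].
by apply: Ck_subset (Cg m) => y [].
Qed.

Lemma smooth_near_mul f g x : smooth_near f x -> smooth_near g x ->
  smooth_near (fun y => f y * g y : R^o) x.
Proof.
move=> /smooth_nearP [U [oU Cf]] /smooth_nearP [U' [oU' Cg]].
have oI := open_nbhsI oU oU'.
apply/smooth_nearP; exists (U `&` U'); split=> // m; apply: CkM; first by case: oI.
  by apply: Ck_subset (Cf m) => y [].
by apply: Ck_subset (Cg m) => y [].
Qed.

Lemma smooth_near_opp f x : smooth_near f x -> smooth_near (fun y => - f y : R^o) x.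
Proof.
move=> /(smooth_near_mul (smooth_near_cst (-1) x)).
by apply: smooth_near_ext; near=> y; rewrite mulN1r.
Unshelve. all: by end_near. Qed.

Lemma smooth_near_sum p (F : 'I_p -> V -> R^o) x : (forall i, smooth_near (F i) x) ->
  smooth_near (fun y => \sum_i F i y) x.
Proof.
elim: p F => [|p IH] F sF.
  by apply: smooth_near_ext (smooth_near_cst 0 x); near=> y; rewrite big_ord0.
apply: smooth_near_ext (smooth_near_add (sF ord0) (IH (fun i => F (lift ord0 i)) (fun i => sF _))).
by near=> y; rewrite big_ord_recl.
Unshelve. all: by end_near. Qed.

(** Where [f] is differentiable, ['D_v f] is the combination of the partials with the constant
    coefficients [v 0 i]. *)
Lemma smooth_near_derive f v x : smooth_near f x -> smooth_near ('D_v f) x.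
Proof.
move=> sf; have := smooth_near_sum (fun i =>
  smooth_near_mul (smooth_near_cst (v 0 i) x) (smooth_near_partial i sf)).
apply: smooth_near_ext; near=> y.
rewrite derive_partial //; apply: smooth_near_differentiable.
by near: y; exact: smooth_near_near.
Unshelve. all: by end_near. Qed.

Lemma smooth_near_derivable f v x : smooth_near f x -> derivable f x v.
Proof. by move=> /smooth_near_differentiable/diff_derivable. Qed.

End Partials.

(** * Composites and the chain rule *)

Section Composition.
Variables k l : nat.
Local Notation V := 'rV[R]_k.
Local Notation W := 'rV[R]_l.
Implicit Types (f : W -> R^o) (phi : V -> W).

Lemma differentiable_components phi x :
  (forall j, differentiable (fun y => phi y 0 j : R^o) x) -> differentiable phi x.
Proof.
move=> dphi.
rewrite (_ : phi = \sum_j (fun y => (phi y 0 j : R^o) *: (delta_mx 0 j : W))); last first.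
  by apply/funext => y; rewrite fct_sumE [LHS]row_sum_delta.
by apply: differentiable_sum => j; apply: differentiableZl.
Qed.

Lemma derive_comp_partial f phi x v :
  (forall j, differentiable (fun y => phi y 0 j : R^o) x) -> differentiable f (phi x) ->
  'D_v (f \o phi) x =
  \sum_j 'D_v (fun y => phi y 0 j : R^o) x * 'D_(delta_mx 0 j : W) f (phi x).
Proof.
move=> dphi df; have dp := differentiable_components dphi.
rewrite deriveE; last exact: differentiable_comp.
rewrite diff_comp //= -deriveE // -deriveE //.
rewrite derive_partial //; apply: eq_bigr => j _; congr (_ * _).
by rewrite derive_mx ?mxE //; exact: diff_derivable.
Qed.

Lemma Ck_comp m (U : set V) (U' : set W) f phi : open U ->
  (forall x, U x -> U' (phi x)) ->
  (forall j, Ck m U (fun y => phi y 0 j : R^o)) -> Ck m U' f -> Ck m U (f \o phi).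
Proof.
move=> oU UU'; elim: m f => [|m IH] f Cphi Cf; split=> //.
- move=> x Ux; apply: differentiable_comp; last exact: Ck_differentiable Cf (UU' _ Ux).
  by apply: differentiable_components => j; exact: Ck_differentiable (Cphi j) Ux.
- move=> x Ux; apply: differentiable_comp; last exact: Ck_differentiable Cf (UU' _ Ux).
  by apply: differentiable_components => j; exact: Ck_differentiable (Cphi j) Ux.
move=> i.
(* By the chain rule the partial of the composite is the sum of the [G j]; the partials of [f] have
   order [m], so the induction hypothesis applies to their composites with [phi]. *)
pose G j x : R^o := 'D_(delta_mx 0 i : V) (fun y => phi y 0 j : R^o) x *
   ('D_(delta_mx 0 j : W) f \o phi) x.
apply: (@Ck_ext _ m U (fun x => \sum_j G j x)) => //.
  move=> x; rewrite inE => Ux; rewrite derive_comp_partial //.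
    by move=> j; exact: Ck_differentiable (Cphi j) Ux.
  exact: Ck_differentiable Cf (UU' _ Ux).
apply: Ck_sum => // j; apply: CkM => //; first by have [_] := Cphi j; exact.
by apply: IH => [j'|]; [exact: CkW|have [_] := Cf; exact].
Qed.

Lemma smooth_near_comp f phi x : smooth_near f (phi x) ->
  (forall j, smooth_near (fun y => phi y 0 j : R^o) x) -> smooth_near (f \o phi) x.
Proof.
move=> /smooth_nearP [U' [oU' Cf]] sphi.
have hex (j : 'I_l) : exists U : set V, open_nbhs x U /\ (forall m, Ck m U (fun y => phi y 0 j : R^o)).
  exact/smooth_nearP.
have [U hU] := choice hex.
have cphi : {for x, continuous phi}.
  apply/differentiable_continuous/differentiable_components => j.
  exact/smooth_near_differentiable.
have : nbhs x ([set y | U' (phi y)] `&` [set y | forall j, U j y]).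
  apply: filterI; first exact: cphi (open_nbhs_nbhs oU').
  have : \forall y \near x, forall j, U j y.
    by apply: near_forall => j; apply: open_nbhs_nbhs; have [] := hU j.
  by [].
rewrite nbhsE => -[U0 oU0 UU0]; apply/smooth_nearP; exists U0; split=> // m.
apply: (@Ck_comp m U0 U' f phi); [by case: oU0|by move=> y /UU0 []| |exact: Cf].
by move=> j; apply: Ck_subset (proj2 (hU j) m) => y /UU0 [_]; exact.
Qed.

End Composition.
End Smoothness.

(** * Symmetry of second derivatives *)

Section Schwarz.
Variables (R : realType) (k : nat).
Local Notation V := 'rV[R]_k.
Implicit Types (f : V -> R^o) (p v w x : V) (t h e : R).

Lemma line_quotient f p v t :
  (fun h => h^-1 *: ((fun s : R => f (p + s *: v)) (h *: 1 + t) - f (p + t *: v))) =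
  (fun h => h^-1 *: (f (h *: v + (p + t *: v)) - f (p + t *: v))).
Proof.
by apply/funext => h; rewrite [h *: 1]mulr1 scalerDl [_ *: v + (p + _)]addrCA.
Qed.

Lemma is_derive_line f p v t : derivable f (p + t *: v) v ->
  is_derive t (1 : R) (fun s : R => f (p + s *: v) : R^o) ('D_v f (p + t *: v)).
Proof.
move=> df; apply: DeriveDef; rewrite ?/derivable ?/derive line_quotient //.
Qed.

Lemma derive1_line f p v : derive1 (fun s : R => f (p + s *: v) : R^o) 0 = 'D_v f p.
Proof.
by rewrite derive1E /derive line_quotient scale0r addr0.
Qed.

(* By the mean value theorem and the differentiability of ['D_v f], the second
   difference is [h^2 'D_w ('D_v f) x] up to [o(h^2)]; its symmetry in [v], [w]
   then gives [derive_schwarz]. *)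
Lemma second_difference f x v w e : 0 < e ->
  (\forall y \near x, derivable f y v) -> differentiable ('D_v f) x ->
  \forall h \near 0^'+, `|f (x + h *: v + h *: w) - f (x + h *: v) - f (x + h *: w) + f x
     - h ^+ 2 * 'D_w ('D_v f) x| <= e * h ^+ 2 * (2 * `|v| + `|w|).
Proof.
move=> e0 df dg; set f' := 'D_v f in dg *.
have /eqaddoP/(_ _ e0) := diff_locally dg.
rewrite !near_simpl => g0.
have {}df : \forall u \near (0 : V), derivable f (u + x) v.
  by move: df; rewrite (near_shift 0) subr0.
have [d /= d0 hd] : exists2 d : R, 0 < d & forall u : V, `|u| < d ->
    derivable f (u + x) v /\ `|f' (u + x) - f' x - 'd f' x u| <= e * `|u|.
  have /nbhs_ballP [d d0 hd] : nbhs (0 : V) [set u | derivable f (u + x) v /\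
      `|(f' \o shift x - (cst (f' x) + 'd f' x)) u| <= e * `|id u|] by exact: filterI.
  exists d => // u ud; have := hd u.
  rewrite -ball_normE /ball_ /= sub0r normrN => /(_ ud) [d1 d2]; split=> //.
  by move: d2; rewrite !fctE /= opprD addrA.
near=> h.
have h0 : 0 < h by near: h; exact: nbhs_right_gt.
have hs : h * (`|v| + `|w|) < d.
  (* The summand 1 keeps the divisor positive when [v] and [w] are both 0. *)
  have K0 : 0 < `|v| + `|w| + 1 by rewrite ltr_wpDl.
  apply: (@le_lt_trans _ _ (h * (`|v| + `|w| + 1))).
    by apply: ler_wpM2l; [exact: ltW|rewrite lerDl].
  rewrite -ltr_pdivlMr //; near: h; apply: nbhs_right_lt; exact: divr_gt0.
have small s : 0 <= s <= h -> `|s *: v| < d /\ `|s *: v + h *: w| < d.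
  move=> /andP [s0 sh].
  have nv : `|s *: v| <= h * `|v| by rewrite normrZ ger0_norm // ler_wpM2r.
  have nw : `|h *: w| = h * `|w| by rewrite normrZ gtr0_norm.
  split; first by apply: le_lt_trans hs; rewrite mulrDr (le_trans nv) // lerDl mulr_ge0 // ltW.
  by apply: le_lt_trans hs; rewrite mulrDr -nw (le_trans (ler_normD _ _)) // lerD2r.
pose phi s : R := f ((x + h *: w) + s *: v) - f (x + s *: v).
have dphi s : 0 <= s <= h -> is_derive s (1 : R) phi
    (f' ((x + h *: w) + s *: v) - f' (x + s *: v)).
  move=> /small [s1 s2]; apply: is_deriveB; apply: is_derive_line.
    by have [+ _] := hd _ s2; rewrite addrC addrA addrAC.
  by have [+ _] := hd _ s1; rewrite addrC.
have [c chh E] : exists2 c, c \in `]0, h[%R & phi h - phi 0 =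
    (f' ((x + h *: w) + c *: v) - f' (x + c *: v)) * (h - 0).
  apply: (@MVT _ phi (fun c => f' ((x + h *: w) + c *: v) - f' (x + c *: v))) => //.
    by move=> s; rewrite in_itv /= => /andP [s0 sh]; apply: dphi; rewrite !ltW.
  apply: continuous_in_subspaceT => s; rewrite inE /= in_itv /= => sh.
  apply/differentiable_continuous/derivable1_diffP.
  by have [] := dphi s sh.
have {}chh : 0 <= c <= h by move: chh; rewrite in_itv /= => /andP [/ltW -> /ltW ->].
have [c1 c2] := small _ chh.
rewrite (_ : _ - _ - _ + _ = phi h - phi 0); last first.
  rewrite /phi scale0r !addr0 (addrAC x); lra.
rewrite E subr0.
have -> : x + h *: w + c *: v = c *: v + h *: w + x by rewrite addrC addrCA addrC.
rewrite [x + c *: v]addrC.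
have [_ b1] := hd _ c1; have [_ b2] := hd _ c2.
rewrite deriveE //.
have bc1 : `|c *: v| <= h * `|v|.
  by case/andP: chh => ? ?; rewrite normrZ ger0_norm // ler_wpM2r.
have bc2 : `|c *: v + h *: w| <= h * (`|v| + `|w|).
  by rewrite mulrDr (le_trans (ler_normD _ _)) // lerD // normrZ gtr0_norm.
have {}b1 := le_trans b1 (ler_wpM2l (ltW e0) bc1).
have {}b2 := le_trans b2 (ler_wpM2l (ltW e0) bc2).
have lin : 'd f' x (c *: v + h *: w) = 'd f' x (c *: v) + h * 'd f' x w by rewrite linearD; congr (_ + _); rewrite linearZ.
rewrite lin in b2.
set A := f' (_ + h *: w + x) in b2 *; set B := f' (c *: v + x) in b1 *.
set G := f' x in b1 b2 *; set D1 := 'd f' x (c *: v) in b1 b2.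
set D2 := 'd f' x w in b2 *.
(* Both values of [f'] are compared with its expansion at [x]; the parts ['d f' x (c *: v)] cancel,
   and only the term h 'D_w f' x and the two errors remain. *)
rewrite (_ : _ - _ = h * ((A - G - (D1 + h * D2)) - (B - G - D1))); last by ring.
rewrite normrM (gtr0_norm h0).
rewrite (_ : e * _ * _ = h * (e * (h * (`|v| + `|w|)) + e * (h * `|v|))); last by ring.
apply: ler_wpM2l; first exact: ltW.
by apply: le_trans (ler_normB _ _) _; exact: lerD b2 b1.
Unshelve. all: by end_near. Qed.

Lemma derive_schwarz f x v w : smooth_near f x ->
  'D_v ('D_w f) x = 'D_w ('D_v f) x.
Proof.
move=> sf.
have dfn u : \forall y \near x, derivable f y u.
  have := smooth_near_near sf; apply: filterS => y; exact: smooth_near_derivable.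
have dd u : differentiable ('D_u f) x.
  by apply: smooth_near_differentiable; exact: smooth_near_derive.
apply/eqP; rewrite -subr_eq0 -normr_le0; apply/ler_addgt0Pl => e e0; rewrite addr0.
(* The error bounds for the two orders of differentiation add up to 3 (|v| + |w|) times (e / K) h^2;
   the summand 1 keeps [K] positive. *)
pose K := 3 * (`|v| + `|w|) + 1.
have K0 : 0 < K by rewrite ltr_wpDl // mulr_ge0 // addr_ge0.
have eK : 0 < e / K by rewrite divr_gt0.
near (0 : R)^'+ => h.
have h0 : 0 < h by near: h; exact: nbhs_right_gt.
have H1 : `|f (x + h *: v + h *: w) - f (x + h *: v) - f (x + h *: w) + f x
     - h ^+ 2 * 'D_w ('D_v f) x| <= e / K * h ^+ 2 * (2 * `|v| + `|w|).
  by near: h; exact: second_difference.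
have H2 : `|f (x + h *: w + h *: v) - f (x + h *: w) - f (x + h *: v) + f x
     - h ^+ 2 * 'D_v ('D_w f) x| <= e / K * h ^+ 2 * (2 * `|w| + `|v|).
  by near: h; exact: second_difference.
rewrite (addrAC x (h *: w)) in H2.
set X := f _ in H1 H2; set P := 'D_v _ x in H2 *; set Q := 'D_w _ x in H1 *.
set Y := f _ in H1 H2; set Z := f _ in H1 H2; set N := f x in H1 H2.
have h2 : 0 < h ^+ 2 by rewrite exprn_gt0.
rewrite -(ler_pM2l h2) -{1}(gtr0_norm h2) -normrM.
rewrite (_ : h ^+ 2 * (P - Q) = (X - Y - Z + N - h ^+ 2 * Q) - (X - Z - Y + N - h ^+ 2 * P)); last by ring.
rewrite (le_trans (ler_normB _ _)) // (le_trans (lerD H1 H2)) //.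
rewrite (_ : _ + _ = h ^+ 2 * (e * (3 * (`|v| + `|w|) / K))); last by field; rewrite gt_eqF.
apply: ler_wpM2l; first exact: ltW.
apply: ler_piMr; first exact: ltW.
by rewrite ler_pdivrMr // mul1r lerDl.
Unshelve. all: by end_near. Qed.

Lemma derive_coord (i : 'I_k) (x v : V) :
  'D_v (fun z : V => z 0 i : R^o) x = v 0 i.
Proof.
rewrite -[RHS](congr1 (fun M : V => M 0 i) (derive_id x v)).
by rewrite derive_mx ?mxE //; exact: derivable_id.
Qed.

End Schwarz.

(* Comparing two basis vectors by conversion is very slow; this is why [partial]
   and the components below, which are indexed by basis vectors, are locked. *)
HB.lock Definition partial (R : realType) (k : nat) (i : 'I_k)
  (f : 'rV[R]_k -> R^o) : 'rV[R]_k -> R^o := 'D_(delta_mx 0 i : 'rV[R]_k) f.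

Section Partial.
Variables (R : realType) (k : nat).
Local Notation V := 'rV[R]_k.
Implicit Types (f g : V -> R^o) (x : V) (i j : 'I_k).

Lemma partialE i f x : partial i f x = 'D_(delta_mx 0 i : V) f x.
Proof. by rewrite partial.unlock. Qed.

Lemma partial_near i f g x : (\forall y \near x, f y = g y) -> partial i f x = partial i g x.
Proof. by move=> fg; rewrite !partialE; exact: near_eq_derive. Qed.

Lemma smooth_partial i f x : smooth_near f x -> smooth_near (partial i f) x.
Proof. by move=> sf; rewrite partial.unlock; exact: smooth_near_partial. Qed.

Lemma partial_comm i j f x : smooth_near f x ->
  partial i (partial j f) x = partial j (partial i f) x.
Proof. by rewrite partial.unlock; exact: derive_schwarz. Qed.

Lemma partialD i f g x : smooth_near f x -> smooth_near g x ->
  partial i (fun y => f y + g y : R^o) x = partial i f x + partial i g x.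
Proof.
move=> sf sg; rewrite !partialE; apply: (deriveD (f := f) (g := g)).
- exact: smooth_near_derivable.
- exact: smooth_near_derivable.
Qed.

Lemma partialM i f g x : smooth_near f x -> smooth_near g x ->
  partial i (fun y => f y * g y : R^o) x = partial i f x * g x + f x * partial i g x.
Proof.
move=> sf sg; rewrite !partialE addrC [X in _ + X]mulrC; apply: (deriveM (f := f) (g := g)).
- exact: smooth_near_derivable.
- exact: smooth_near_derivable.
Qed.

Lemma partial_cst i (c : R) x : partial i (fun=> c : R^o) x = 0.
Proof. by rewrite partialE; exact: derive_cst. Qed.

Lemma partialZ i (c : R) f x : smooth_near f x ->
  partial i (fun y => c * f y : R^o) x = c * partial i f x.
Proof.
move=> sf; rewrite (partialM _ (smooth_near_cst c x) sf) partial_cst.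
by rewrite mul0r add0r.
Qed.

Lemma partialN i f x : smooth_near f x -> partial i (fun y => - f y : R^o) x = - partial i f x.
Proof.
by move=> sf; rewrite !partialE; apply: (deriveN (f := f)); exact: smooth_near_derivable.
Qed.

Lemma partialB i f g x : smooth_near f x -> smooth_near g x ->
  partial i (fun y => f y - g y : R^o) x = partial i f x - partial i g x.
Proof.
by move=> sf sg; rewrite (partialD _ sf (smooth_near_opp sg)) (partialN _ sg).
Qed.

Lemma partial_sum i p (F : 'I_p -> V -> R^o) x : (forall q, smooth_near (F q) x) ->
  partial i (fun y => \sum_q F q y : R^o) x = \sum_q partial i (F q) x.
Proof.
elim: p F => [|p IH] F sF.
  rewrite big_ord0 (_ : (fun _ => _) = (fun=> 0)) ?partial_cst //.
  by apply/funext => y; rewrite big_ord0.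
rewrite big_ord_recl -(IH _ (fun q => sF (lift ord0 q))).
rewrite -(partialD _ (sF ord0) (smooth_near_sum (fun q => sF (lift ord0 q)))).
by congr (partial _ _ _); apply/funext => y; rewrite big_ord_recl.
Qed.

Lemma partial_coord i j x : partial i (fun y : V => y 0 j : R^o) x = (j == i)%:R.
Proof.
by rewrite partialE derive_coord mxE eqxx.
Qed.

End Partial.

(** * Charts *)

(* The common axioms of the charts of [M] and of [slit_charts M]: the latter
   lives on a type without topology, hence the formulation by germs at
   [cfwd a u]. *)
Record good_charts (R : realType) (N : Type) (k : nat) (A : chart_system R N k) : Prop := {
  chart_bwdK : forall (a : cidx A) u, cdom a u -> cbwd a (cfwd a u) = u;
  chart_fwdK : forall (a : cidx A) u, cdom a u ->
    \forall z \near cfwd a u, cfwd a (cbwd a z) = z;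
  chart_near_dom : forall (a b : cidx A) u, cdom a u -> cdom b u ->
    \forall z \near cfwd a u, cdom b (cbwd a z);
  chart_smooth : forall (a b : cidx A) u i, cdom a u -> cdom b u ->
    smooth_near (fun z => cfwd b (cbwd a z) 0 i : R^o) (cfwd a u) }.

Section GoodCharts.
Variables (R : realType) (N : Type) (k : nat) (A : chart_system R N k).
Hypothesis gA : good_charts A.
Implicit Types (a b : cidx A) (u : N) (F G : N -> R) (W : set N)
  (v w : 'rV[R]_k) (xi : functional R N) (X Y : N -> functional R N).

Notation hat a F := (F \o cbwd a : 'rV[R]_k -> R^o).
Notation partial i F := ('D_(delta_mx 0 i : 'rV[R]_k) F).

Lemma hat_trans a b u F : cdom a u -> cdom b u ->
  \forall z \near cfwd a u, hat a F z = (hat b F \o (cfwd b \o cbwd a)) z.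
Proof.
move=> au bu; have := chart_near_dom gA au bu; apply: filterS => z bz.
by rewrite /= (chart_bwdK gA bz).
Qed.

(** [smooth_at] quantifies over all charts around [u]; since the transition maps are smooth, one
    chart decides. *)
Lemma smooth_at_chart a u F : cdom a u -> smooth_near (hat a F) (cfwd a u) ->
  smooth_at A u F.
Proof.
move=> au sF b bu.
apply: (@smooth_near_ext _ _ (hat a F \o (cfwd a \o cbwd b))).
  by apply: filterS (hat_trans F bu au) => z ->.
apply: smooth_near_comp; last by move=> j; exact: chart_smooth.
by rewrite /= (chart_bwdK gA bu).
Qed.

Lemma chart_near_good a u : cdom a u -> \forall z \near cfwd a u,
  cdom a (cbwd a z) /\ cfwd a (cbwd a z) = z.
Proof.
by move=> au; apply: filterI; [exact: chart_near_dom|exact: chart_fwdK].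
Qed.

Lemma smooth_at_near a u F : cdom a u -> smooth_at A u F ->
  \forall z \near cfwd a u, smooth_at A (cbwd a z) F.
Proof.
move=> au /(_ _ au) sF.
have := nearI (chart_near_good au) (smooth_near_near sF).
apply: filterS => z [[az zz] sz]; apply: (smooth_at_chart az).
by rewrite zz.
Qed.

Lemma smooth_at_cst u (c : R) : smooth_at A u (fun=> c).
Proof. by move=> a _; exact: smooth_near_cst. Qed.

Lemma smooth_at_add u F G : smooth_at A u F -> smooth_at A u G ->
  smooth_at A u (fun x => F x + G x).
Proof. by move=> sF sG a au; exact: smooth_near_add (sF _ au) (sG _ au). Qed.

Lemma smooth_at_mul u F G : smooth_at A u F -> smooth_at A u G ->
  smooth_at A u (fun x => F x * G x).
Proof. by move=> sF sG a au; exact: smooth_near_mul (sF _ au) (sG _ au). Qed.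

Lemma smooth_at_opp u F : smooth_at A u F -> smooth_at A u (fun x => - F x).
Proof. by move=> sF a au; exact: smooth_near_opp (sF _ au). Qed.

Lemma smooth_at_sum u p (F : 'I_p -> N -> R) : (forall i, smooth_at A u (F i)) ->
  smooth_at A u (fun x => \sum_i F i x).
Proof.
by move=> sF a au; apply: (@smooth_near_sum _ _ p (fun i => hat a (F i))) => i; exact: sF.
Qed.

Lemma chart_open_near_eq a u W F G : chart_open A W -> W u -> cdom a u ->
  (forall x, W x -> F x = G x) -> \forall z \near cfwd a u, hat a F z = hat a G z.
Proof.
move=> oW Wu au FG; have := oW _ Wu _ au; apply: filterS => z; exact: FG.
Qed.

Lemma smooth_at_ext u W F G : chart_open A W -> W u ->
  (forall x, W x -> F x = G x) -> smooth_at A u F -> smooth_at A u G.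
Proof.
by move=> oW Wu FG sF a au; apply: smooth_near_ext (sF _ au); exact: chart_open_near_eq FG.
Qed.

Lemma smooth_at_coord a u i : cdom a u -> smooth_at A u (coord a i).
Proof. by move=> au b bu; exact: chart_smooth. Qed.

Lemma chart_open_dom a : chart_open A (cdom a).
Proof. by move=> u au b bu; exact: chart_near_dom. Qed.

Lemma chart_openI W W' : chart_open A W -> chart_open A W' -> chart_open A (W `&` W').
Proof.
by move=> oW oW' u [Wu W'u] a au; apply: filterI; [exact: oW|exact: oW'].
Qed.

Lemma smooth_at_differentiable a u F : smooth_at A u F -> cdom a u ->
  differentiable (hat a F) (cfwd a u).
Proof. by move=> sF au; apply: smooth_near_differentiable; exact: sF. Qed.

Lemma smooth_at_derivable a u v F : smooth_at A u F -> cdom a u ->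
  derivable (hat a F) (cfwd a u) v.
Proof. by move=> sF au; apply: diff_derivable; exact: smooth_at_differentiable. Qed.

Lemma tangent_vecE a u v F : smooth_at A u F ->
  tangent_vec a u v F = 'D_v (hat a F) (cfwd a u).
Proof. by move=> sF; rewrite /tangent_vec asboolT. Qed.

Lemma tangent_vec_ns a u v F : ~ smooth_at A u F -> tangent_vec a u v F = 0.
Proof. by move=> sF; rewrite /tangent_vec asboolF. Qed.

Lemma tangent_vec_partial a u v F : cdom a u -> smooth_at A u F ->
  tangent_vec a u v F = \sum_i v 0 i * partial i (hat a F) (cfwd a u).
Proof.
move=> au sF; rewrite tangent_vecE // derive_partial //.
exact: smooth_at_differentiable.
Qed.

Lemma tangent_vec_coord a u v i : cdom a u -> tangent_vec a u v (coord a i) = v 0 i.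
Proof.
move=> au; rewrite tangent_vecE; last exact: smooth_at_coord.
rewrite (@near_eq_derive _ _ _ _ (fun z : 'rV[R]_k => z 0 i : R^o)); last first.
  by apply: filterS (chart_fwdK gA au) => z; rewrite /= /coord => ->.
exact: derive_coord.
Qed.

Lemma tangent_vecP a u c v w : cdom a u ->
  tangent_vec a u (c *: v + w) = c *: tangent_vec a u v + tangent_vec a u w.
Proof.
move=> au; apply/funext => F; rewrite !fctE.
have [sF|nsF] := pselect (smooth_at A u F); last by rewrite !tangent_vec_ns // scaler0 addr0.
rewrite !tangent_vec_partial // scaler_sumr -big_split; apply: eq_bigr => i _ /=.
by rewrite !mxE mulrDl -mulrA.
Qed.

Lemma tangent_vec0 a u : cdom a u -> tangent_vec a u 0 = 0.
Proof.
move=> au; have /(congr1 (fun x => x - tangent_vec a u 0)) := tangent_vecP 1 0 0 au.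
by rewrite !scale1r addr0 subrr addrK => <-.
Qed.

Lemma tangent_vecZ a u c v : cdom a u -> tangent_vec a u (c *: v) = c *: tangent_vec a u v.
Proof. by move=> au; rewrite -[c *: v]addr0 tangent_vecP // tangent_vec0 // addr0. Qed.

Lemma tangent_vec_sum a u p (v : 'I_p -> 'rV[R]_k) : cdom a u ->
  tangent_vec a u (\sum_i v i) = \sum_i tangent_vec a u (v i).
Proof.
move=> au; elim/big_ind2: _ => [|x1 x2 y1 y2 <- <-|//]; first exact: tangent_vec0.
by rewrite -{1}[x2]scale1r tangent_vecP // scale1r.
Qed.

Lemma tangent_vec_basis a u v : cdom a u ->
  tangent_vec a u v = \sum_i v 0 i *: tangent_vec a u (delta_mx 0 i).
Proof.
move=> au; rewrite {1}(row_sum_delta v) tangent_vec_sum //.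
by apply: eq_bigr => i _; rewrite tangent_vecZ.
Qed.

Lemma tangent_vec_inj a u v w : cdom a u -> tangent_vec a u v = tangent_vec a u w -> v = w.
Proof.
by move=> au vw; apply/rowP => i; rewrite -!(tangent_vec_coord _ _ au) vw.
Qed.

Lemma tangent_vec_tangent a u v : cdom a u -> tangent A u (tangent_vec a u v).
Proof. by move=> au; exists a, v. Qed.

(** By the chain rule, the components in the chart [a] are the derivatives of the coordinates of
    [a]. *)
Lemma tangent_vec_change a b u v : cdom a u -> cdom b u ->
  tangent_vec b u v = tangent_vec a u (\row_i tangent_vec b u v (coord a i)).
Proof.
move=> au bu; apply/funext => F.
have [sF|nsF] := pselect (smooth_at A u F); last by rewrite !tangent_vec_ns.
rewrite [LHS]tangent_vecE // [RHS]tangent_vec_partial //.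
have sa j : smooth_near (fun y => (cfwd a \o cbwd b) y 0 j : R^o) (cfwd b u).
  exact: chart_smooth.
have E : (cfwd a \o cbwd b) (cfwd b u) = cfwd a u by rewrite /= (chart_bwdK gA bu).
rewrite (@near_eq_derive _ _ _ (hat b F) (hat a F \o (cfwd a \o cbwd b))); last first.
  exact: (hat_trans F bu au).
rewrite derive_comp_partial; first last.
- by rewrite E; exact: smooth_at_differentiable.
- by move=> j; exact: smooth_near_differentiable.
by apply: eq_bigr => j _; rewrite mxE tangent_vecE ?E //; exact: smooth_at_coord.
Qed.

Lemma tangent_rep a u xi : tangent A u xi -> cdom a u ->
  xi = tangent_vec a u (\row_i xi (coord a i)).
Proof. by move=> [b [v [bu ->]]] au; exact: tangent_vec_change. Qed.

Lemma tangentP u c xi xi' : tangent A u xi -> tangent A u xi' ->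
  tangent A u (c *: xi + xi').
Proof.
move=> [a [v [au ->]]] /tangent_rep /(_ au) ->.
by rewrite -tangent_vecP //; exact: tangent_vec_tangent.
Qed.

Lemma tangent0 a u : cdom a u -> tangent A u 0.
Proof. by move=> au; rewrite -(tangent_vec0 au); exact: tangent_vec_tangent. Qed.

Lemma tangentZ u c xi : tangent A u xi -> tangent A u (c *: xi).
Proof. by move=> [a [v [au ->]]]; rewrite -tangent_vecZ //; exact: tangent_vec_tangent. Qed.

Lemma tangentD u xi xi' : tangent A u xi -> tangent A u xi' -> tangent A u (xi + xi').
Proof. by rewrite -[X in X + _]scale1r; exact: tangentP. Qed.

Lemma tangentN u xi : tangent A u xi -> tangent A u (- xi).
Proof. by rewrite -scaleN1r; exact: tangentZ. Qed.

Lemma tangent_eq a u xi xi' : cdom a u -> tangent A u xi -> tangent A u xi' ->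
  (forall i, xi (coord a i) = xi' (coord a i)) -> xi = xi'.
Proof.
move=> au t t' h; rewrite (tangent_rep t au) (tangent_rep t' au).
by congr (tangent_vec _ _ _); apply/rowP => i; rewrite !mxE.
Qed.

(** The default value of [tangent_vec] is respected too: smoothness at [u] depends only on the germ,
    so either both functions are smooth there or both are sent to 0. *)
Lemma tangent_germ u xi W F G : tangent A u xi -> chart_open A W -> W u ->
  (forall x, W x -> F x = G x) -> xi F = xi G.
Proof.
move=> [a [v [au ->]]] oW Wu FG.
have GF x : W x -> G x = F x by move/FG.
have [sF|nsF] := pselect (smooth_at A u F); last first.
  rewrite !tangent_vec_ns // => sG; apply: nsF; exact: smooth_at_ext oW Wu GF sG.
rewrite !tangent_vecE //; last exact: smooth_at_ext oW Wu FG sF.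
by apply: near_eq_derive; exact: chart_open_near_eq FG.
Qed.

Lemma tangent_cst u xi (c : R) : tangent A u xi -> xi (fun=> c) = 0.
Proof.
move=> [a [v [au ->]]]; rewrite tangent_vecE; last exact: smooth_at_cst.
exact: derive_cst.
Qed.

Lemma tangent_add u xi F G : tangent A u xi -> smooth_at A u F -> smooth_at A u G ->
  xi (fun x => F x + G x) = xi F + xi G.
Proof.
move=> [a [v [au ->]]] sF sG; rewrite !tangent_vecE //; last exact: smooth_at_add.
by rewrite -deriveD //; exact: smooth_at_derivable.
Qed.

Lemma tangent_mul u xi F G : tangent A u xi -> smooth_at A u F -> smooth_at A u G ->
  xi (fun x => F x * G x) = F u * xi G + G u * xi F.
Proof.
move=> [a [v [au ->]]] sF sG; rewrite !tangent_vecE //; last exact: smooth_at_mul.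
rewrite (_ : hat a (fun x => F x * G x) = hat a F * hat a G) // deriveM.
- by rewrite /= (chart_bwdK gA au).
- exact: smooth_at_derivable.
- exact: smooth_at_derivable.
Qed.

Lemma tangent_sum u xi p (F : 'I_p -> N -> R) : tangent A u xi ->
  (forall i, smooth_at A u (F i)) -> xi (fun x => \sum_i F i x) = \sum_i xi (F i).
Proof.
move=> txi sF; elim: p F sF => [|p IH] F sF.
  rewrite big_ord0 (_ : (fun _ => _) = (fun=> 0)); first exact: (tangent_cst 0 txi).
  by apply/funext => x; rewrite big_ord0.
have sF' : smooth_at A u (fun x => \sum_i F (lift ord0 i) x).
  by apply: (@smooth_at_sum u p (fun i => F (lift ord0 i))) => i; exact: sF.
rewrite big_ord_recl -IH // -(tangent_add txi) //.
by congr (xi _); apply/funext => x; rewrite big_ord_recl.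
Qed.

(** The charts are arbitrary here: on [slit_charts] this is [is_vfield], and on [mcharts M] it is
    used for the coordinate fields d/dx^i of the base. *)
Definition is_field W X := forall u, W u -> tangent A u (X u) /\
  forall F, smooth_at A u F -> smooth_at A u (fun x => X x F).

Lemma is_field_chart a W X (v : N -> 'rV[R]_k) : chart_open A W -> W `<=` cdom a ->
  (forall u, W u -> X u = tangent_vec a u (v u)) ->
  (forall u i, W u -> smooth_at A u (fun x => v x 0 i)) -> is_field W X.
Proof.
move=> oW Wa Xv sv u Wu; have au := Wa _ Wu; split.
  by rewrite Xv //; exact: tangent_vec_tangent.
move=> F sF; apply: (smooth_at_chart au).
apply: (@smooth_near_ext _ _
  (fun z => \sum_i hat a (fun x => v x 0 i) z * partial i (hat a F) z)).
  have := nearI (nearI (chart_near_good au) (oW _ Wu _ au)) (smooth_at_near au sF).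
  apply: filterS => z [[[az zz] Wz] sz].
  by rewrite /= Xv // tangent_vec_partial // zz.
apply: smooth_near_sum => i; apply: smooth_near_mul; first exact: sv.
by apply: smooth_near_partial; exact: sF.
Qed.

Lemma field_hat a W X u F : chart_open A W -> is_field W X -> W u -> cdom a u ->
  smooth_at A u F -> \forall z \near cfwd a u, hat a (fun x => X x F) z =
    \sum_i hat a (fun x => X x (coord a i)) z * partial i (hat a F) z.
Proof.
move=> oW fX Wu au sF.
have := nearI (nearI (chart_near_good au) (oW _ Wu _ au)) (smooth_at_near au sF).
apply: filterS => z [[[az zz] Wz] sz]; have [tX _] := fX _ Wz.
rewrite /= {1}(tangent_rep tX az) tangent_vec_partial // zz.
by apply: eq_bigr => i _; rewrite mxE.
Qed.

(** The second-order part is kept apart because it is the one that cancels in a bracket. *)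
Lemma field_second_derivative a W X u xi F : chart_open A W -> is_field W X -> W u ->
  cdom a u -> tangent A u xi -> smooth_at A u F -> xi (fun x => X x F) =
  \sum_i xi (fun x => X x (coord a i)) * partial i (hat a F) (cfwd a u) +
  \sum_i \sum_j X u (coord a i) * xi (coord a j) *
     partial j (partial i (hat a F)) (cfwd a u).
Proof.
move=> oW fX Wu au txi sF; have [tX sX] := fX _ Wu.
have sXi i : smooth_at A u (fun x => X x (coord a i)).
  by apply: sX; exact: smooth_at_coord.
have dp i : smooth_near (partial i (hat a F)) (cfwd a u).
  by apply: smooth_near_partial; exact: sF.
rewrite (tangent_rep txi au) tangent_vecE; last exact: sX.
rewrite (near_eq_derive _ (field_hat oW fX Wu au sF)).
set v := \row_i _.
rewrite (_ : (fun z => \sum_i _) = \sum_i (hat a (fun x => X x (coord a i)) * partial i (hat a F)));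
  last by apply/funext => z; rewrite fct_sumE.
rewrite derive_sum; last first.
  by move=> i; apply: derivableM; [exact: smooth_at_derivable|exact: smooth_near_derivable].
rewrite -big_split; apply: eq_bigr => i _ /=; rewrite deriveM; first last.
- exact: smooth_near_derivable.
- exact: smooth_at_derivable.
rewrite (tangent_vecE _ _ (sXi i)) [RHS]addrC; congr (_ + _); last by rewrite -[LHS]/(_ * _) mulrC.
rewrite /= (chart_bwdK gA au) derive_partial; last exact: smooth_near_differentiable.
rewrite scaler_sumr; apply: eq_bigr => j _.
by rewrite tangent_vec_coord // -[LHS]/(_ * _) mulrA.
Qed.

(** The two second-order parts agree by the symmetry of second derivatives, so the commutator is of
    first order, that is a tangent vector. *)
Lemma field_bracket a W X Y u F : chart_open A W -> is_field W X -> is_field W Y ->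
  W u -> cdom a u -> smooth_at A u F ->
  X u (fun x => Y x F) - Y u (fun x => X x F) =
  tangent_vec a u (\row_i (X u (fun x => Y x (coord a i)) - Y u (fun x => X x (coord a i)))) F.
Proof.
move=> oW fX fY Wu au sF; have [tX _] := fX _ Wu; have [tY _] := fY _ Wu.
rewrite (field_second_derivative oW fY Wu au tX sF).
rewrite (field_second_derivative oW fX Wu au tY sF) tangent_vec_partial //.
rewrite [X in _ - (_ + X)](_ : _ = \sum_i \sum_j Y u (coord a i) * X u (coord a j) *
   partial j (partial i (hat a F)) (cfwd a u)); last first.
  rewrite exchange_big; apply: eq_bigr => i _; apply: eq_bigr => j _ /=.
  by rewrite derive_schwarz ?[X u _ * _]mulrC //; exact: sF.
rewrite opprD addrACA subrr addr0 -sumrB; apply: eq_bigr => i _.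
by rewrite mxE mulrBl.
Qed.

End GoodCharts.

(** * Functions of the base coordinates alone *)

Section Projections.
Variables (R : realType) (n : nat).
Implicit Types (z w : 'rV[R]_(n + n)) (f : 'rV[R]_n -> R^o).

Lemma near_lsubmx z (P : 'rV[R]_n -> Prop) : (\forall x \near lsubmx z, P x) ->
  \forall y \near z, P (lsubmx y).
Proof. by move=> h; exact: (@continuous_lsubmx R 1 n n z _ h). Qed.

Lemma near_rsubmx z (P : 'rV[R]_n -> Prop) : (\forall x \near rsubmx z, P x) ->
  \forall y \near z, P (rsubmx y).
Proof. by move=> h; exact: (@continuous_rsubmx R 1 n n z _ h). Qed.

Lemma lsubmxE z i : (fun y : 'rV[R]_(n + n) => lsubmx y 0 i) = (fun y => y 0 (lshift n i)).
Proof. by apply/funext => y; rewrite mxE. Qed.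

Lemma smooth_near_lsubmx f z : smooth_near f (lsubmx z) ->
  smooth_near (fun y => f (lsubmx y)) z.
Proof.
move=> sf; apply: (@smooth_near_comp _ _ _ f lsubmx) => // j.
by rewrite (lsubmxE z); exact: smooth_near_coord.
Qed.

Lemma derive_lsubmx f z w : differentiable f (lsubmx z) ->
  'D_w (fun y => f (lsubmx y)) z = 'D_(lsubmx w) f (lsubmx z).
Proof.
move=> df; rewrite (_ : (fun y => f (lsubmx y)) = f \o lsubmx) //.
rewrite derive_comp_partial //; last first.
  move=> j; rewrite (lsubmxE z); apply: smooth_near_differentiable.
  exact: smooth_near_coord.
rewrite [RHS]derive_partial //; apply: eq_bigr => j _.
by rewrite (lsubmxE z) derive_coord mxE.
Qed.

Lemma near_row_neq0 (k : nat) (z : 'rV[R]_k) : z != 0 -> \forall y \near z, y != 0.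
Proof.
move=> z0; have [i zi] : exists i, z 0 i != 0.
  apply/existsP; apply: contraNT z0; rewrite negb_exists => /forallP h.
  by apply/eqP/rowP => i; rewrite mxE; apply/eqP; rewrite -[_ == _]negbK.
have := @coord_continuous R 1 k 0 i z.
move=> /cvgr_neq0 /(_ zi); apply: filterS => y.
by apply: contra_neq => ->; rewrite mxE.
Qed.

End Projections.

(** * The slit tangent bundle *)

Section Manifold.
Variables (R : realType) (n : nat) (M : manifold R n).
Notation ChM := (mcharts M).
Notation ChT := (slit_charts M).
Implicit Types (a b : cidx ChM) (u : TM M).

Lemma good_manifold : good_charts ChM.
Proof.
split.
- by move=> a x; exact: (cfwdK (matlas M)).
- move=> a x ax; have oa := @img_open _ _ _ _ (matlas M) a.
  have zx : (cfwd a @` cdom a) (cfwd a x) by exists x.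
  have := open_nbhs_nbhs (conj oa zx); apply: filterS => z [y ay <-].
  by rewrite (cfwdK (matlas M)).
- move=> a b x ax bx.
  have zx : (cfwd a @` cdom a) (cfwd a x) by exists x.
  apply: (@cbwd_continuous _ _ _ _ (matlas M) a _ zx).
  rewrite (cfwdK (matlas M) ax).
  by apply: open_nbhs_nbhs; split=> //; exact: (@dom_open _ _ _ _ (matlas M) b).
- move=> a b x i ax bx; apply: (transition_smooth (matlas M)).
  by exists x.
Qed.

Let gM := good_manifold.

Lemma slit_cbwd a (z : 'rV[R]_(n + n)) : cdom a (cbwd a (lsubmx z)) ->
  rsubmx z != 0 -> slit (cbwd (c := ChT) a z).
Proof.
move=> az z0; split; first exact: tangent_vec_tangent.
rewrite /= -(tangent_vec0 az) => /(tangent_vec_inj gM az).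
by move/eqP; apply/negP.
Qed.

Lemma slit_row_neq0 a u : cdom (c := ChT) a u -> rsubmx (cfwd (c := ChT) a u) != 0.
Proof.
move=> [[tu u0] au]; rewrite /= row_mxKr; apply/eqP => r0; apply: u0.
by rewrite (tangent_rep gM tu au) r0 tangent_vec0.
Qed.

Lemma slit_cbwd_near a b u : cdom (c := ChT) a u -> cdom b u.1 ->
  \forall z \near cfwd (c := ChT) a u, cdom (c := ChT) b (cbwd (c := ChT) a z).
Proof.
move=> au bu; have [_ au1] := au.
have lu : lsubmx (cfwd (c := ChT) a u) = cfwd a u.1 by rewrite /= row_mxKl.
have h1 : \forall z \near cfwd (c := ChT) a u,
    cdom a (cbwd a (lsubmx z)) /\ cdom b (cbwd a (lsubmx z)).
  apply: (@near_lsubmx _ _ _ (fun x => cdom a (cbwd a x) /\ cdom b (cbwd a x))).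
  by rewrite lu; apply: nearI; exact: chart_near_dom.
have h2 : \forall z \near cfwd (c := ChT) a u, rsubmx z != 0.
  apply: (@near_rsubmx _ _ _ (fun y => y != 0)); apply: near_row_neq0; exact: slit_row_neq0.
have := nearI h1 h2; apply: filterS => z [[az bz] z0].
by split => //; exact: slit_cbwd.
Qed.

Lemma good_slit : good_charts ChT.
Proof.
split.
- move=> a [x xi] [[/= tx _] ax] /=.
  by rewrite row_mxKl row_mxKr (chart_bwdK gM ax) -(tangent_rep gM tx ax).
- move=> a u au.
  have lu : lsubmx (cfwd (c := ChT) a u) = cfwd (c := ChM) a u.1 by rewrite /= row_mxKl.
  have : \forall z \near cfwd (c := ChT) a u,
      cdom (c := ChM) a (cbwd (c := ChM) a (lsubmx z)) /\ cfwd (c := ChM) a (cbwd (c := ChM) a (lsubmx z)) = lsubmx z.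
    apply: (@near_lsubmx _ _ _ (fun x => cdom (c := ChM) a (cbwd (c := ChM) a x) /\ cfwd (c := ChM) a (cbwd (c := ChM) a x) = x)).
    by rewrite lu; apply: (chart_near_good gM); case: au.
  apply: filterS => z [az zz] /=; rewrite zz -[RHS]hsubmxK; congr row_mx.
  by apply/rowP => i; rewrite mxE tangent_vec_coord.
- by move=> a b u au [_ bu]; exact: slit_cbwd_near.
- move=> a b u i au bu; have [_ au1] := au; have [_ bu1] := bu.
  have lu : lsubmx (cfwd (c := ChT) a u) = cfwd (c := ChM) a u.1 by rewrite /= row_mxKl.
  case: (split_ordP i) => j ->{i}.
    apply: (@smooth_near_ext _ _ (fun z => (fun x => cfwd (c := ChM) b (cbwd (c := ChM) a x) 0 j : R^o) (lsubmx z))).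
      by near=> z; rewrite /= row_mxEl.
    apply: (@smooth_near_lsubmx _ _ (fun x => cfwd (c := ChM) b (cbwd (c := ChM) a x) 0 j : R^o)).
    by rewrite lu; exact: chart_smooth.
  have sb : smooth_at ChM u.1 (coord (A := ChM) b j) by exact: smooth_at_coord.
  (* The fibre coordinates change by the Jacobian of the base charts: y_b^j is the sum of the y_a^i
     dx_b^j/dx_a^i. *)
  apply: (@smooth_near_ext _ _ (fun z => \sum_i z 0 (rshift n i) *
     ('D_(delta_mx 0 i) (coord (A := ChM) b j \o cbwd (c := ChM) a : _ -> R^o) (lsubmx z)))).
    have : \forall z \near cfwd (c := ChT) a u, (cdom (c := ChM) a (cbwd (c := ChM) a (lsubmx z)) /\
        cfwd (c := ChM) a (cbwd (c := ChM) a (lsubmx z)) = lsubmx z) /\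
        smooth_at ChM (cbwd (c := ChM) a (lsubmx z)) (coord (A := ChM) b j).
      apply: (@near_lsubmx _ _ _ (fun x => (cdom (c := ChM) a (cbwd (c := ChM) a x) /\ cfwd (c := ChM) a (cbwd (c := ChM) a x) = x)
        /\ smooth_at ChM (cbwd (c := ChM) a x) (coord (A := ChM) b j))).
      rewrite lu; apply: nearI; first exact: (chart_near_good gM).
      exact: (smooth_at_near gM).
    apply: filterS => z [[az zz] sz].
    rewrite /= row_mxEr mxE (tangent_vec_partial _ az sz) zz.
    by apply: eq_bigr => i _; rewrite mxE.
  apply: smooth_near_sum => i; apply: smooth_near_mul; first exact: smooth_near_coord.
  apply: (@smooth_near_lsubmx _ _ ('D_(delta_mx 0 i) (coord (A := ChM) b j \o cbwd (c := ChM) a : _ -> R^o))).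
  by apply: smooth_near_partial; rewrite lu; exact: sb.
Unshelve. all: by end_near. Qed.

Let gT := good_slit.

Lemma slit_cdom u : slit u -> exists a, cdom (c := ChT) a u.
Proof. by move=> su; exists (chart_at u.1); split=> //; rewrite /chart_at; case: cid. Qed.

Lemma slit_openI W W' : slit_open W -> slit_open W' -> slit_open (W `&` W' : set (TM M)).
Proof.
by move=> [sW oW] [_ oW']; split; [move=> u [/sW]|exact: chart_openI].
Qed.

Lemma slit_open_dom a : slit_open (cdom (c := ChT) a).
Proof. by split; [move=> u []|exact: chart_open_dom]. Qed.

Lemma slit_open_slit : slit_open (@slit R n M).
Proof.
split=> // u su a au; have [_ au1] := au.
by have := slit_cbwd_near au au1; apply: filterS => z [].
Qed.

Section Chart.
Variable a : cidx ChM.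
Notation Dom := (cdom (c := ChT) a).
Notation hat F := (F \o cbwd (c := ChT) a : 'rV[R]_(n + n) -> R^o).

Lemma coord_lshift i : coord (A := ChT) a (lshift n i) = coord a i \o fst.
Proof. by apply/funext => u; rewrite /coord /= row_mxEl. Qed.

Lemma coord_rshift i : coord (A := ChT) a (rshift n i) = fun u => u.2 (coord a i).
Proof. by apply/funext => u; rewrite /coord /= row_mxEr mxE. Qed.

Lemma dom_fst u : Dom u -> cdom a u.1. Proof. by case. Qed.

Lemma lsubmx_cfwd u : lsubmx (cfwd (c := ChT) a u) = cfwd a u.1.
Proof. by rewrite /= row_mxKl. Qed.

Lemma smooth_at_fst u f : Dom u -> smooth_at ChM u.1 f -> smooth_at ChT u (f \o fst).
Proof.
move=> au sf; apply: (smooth_at_chart gT au).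
apply: (@smooth_near_lsubmx _ _ (f \o cbwd a)); rewrite lsubmx_cfwd; apply: sf.
exact: dom_fst.
Qed.

Lemma tangent_rho u w : Dom u ->
  rho u (tangent_vec (A := ChT) a u w) = tangent_vec a u.1 (lsubmx w).
Proof.
move=> au; apply/funext => f; rewrite /rho.
case: asboolP => [sf|nsf]; last by rewrite tangent_vec_ns.
rewrite !tangent_vecE //; last exact: smooth_at_fst.
rewrite -lsubmx_cfwd -derive_lsubmx // lsubmx_cfwd.
by apply: (smooth_at_differentiable sf); exact: dom_fst.
Qed.

(** Since the fibre coordinates are linear, the curve that defines [gamma] is in the chart the
    straight line with direction (0, y). *)
Lemma tangent_gamma u y : Dom u ->
  gamma u (tangent_vec a u.1 y) = tangent_vec (A := ChT) a u (row_mx 0 y).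
Proof.
move=> au; have au1 := dom_fst au; apply/funext => F; rewrite /gamma.
case: asboolP => [sF|nsF]; last by rewrite tangent_vec_ns.
rewrite tangent_vecE // -derive1_line; congr (derive1 _ 0); apply/funext => t /=.
rewrite scale_row_mx scaler0 add_row_mx addr0 row_mxKl row_mxKr (chart_bwdK gM au1).
congr (F (_, _)); have [[tu _] _] := au.
by rewrite addrC [X in _ + X](tangent_rep gM tu au1) -tangent_vecP // addrC.
Qed.

Lemma gamma_tangent u w : Dom u -> tangent ChM u.1 w -> tangent ChT u (gamma u w).
Proof.
move=> au tw; rewrite (tangent_rep gM tw (dom_fst au)) tangent_gamma //.
exact: tangent_vec_tangent.
Qed.

Lemma pifield_coord W (Y : pifield M) u i : is_pifield W Y -> W u -> Dom u ->
  smooth_at ChT u (fun v => Y v (coord a i)).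
Proof.
move=> pY Wu au; have [_] := pY _ Wu; apply; apply: smooth_at_coord => //.
exact: dom_fst.
Qed.

Lemma pifield_rep W (Y : pifield M) u : is_pifield W Y -> W u -> Dom u ->
  Y u = tangent_vec a u.1 (\row_i Y u (coord a i)).
Proof.
move=> pY Wu au; have [tY _] := pY _ Wu; apply: (tangent_rep gM) => //.
exact: dom_fst.
Qed.

Lemma is_pifield_chart W (Y : pifield M) (y : TM M -> 'rV[R]_n) : slit_open W ->
  W `<=` Dom -> (forall u, W u -> Y u = tangent_vec a u.1 (y u)) ->
  (forall u i, W u -> smooth_at ChT u (fun v => y v 0 i)) -> is_pifield W Y.
Proof.
move=> [_ oW] Wa Yy sy u Wu; have au := Wa _ Wu; have au1 := dom_fst au; split.
  by rewrite Yy //; exact: tangent_vec_tangent.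
move=> f sf; apply: (smooth_at_chart gT au).
apply: (@smooth_near_ext _ _ (fun z => \sum_i hat (fun x => y x 0 i) z *
   ('D_(delta_mx 0 i) (f \o cbwd a : _ -> R^o) (lsubmx z)))).
  have h : \forall z \near cfwd (c := ChT) a u, (cdom a (cbwd a (lsubmx z)) /\
       cfwd a (cbwd a (lsubmx z)) = lsubmx z) /\ smooth_at ChM (cbwd a (lsubmx z)) f.
    apply: (@near_lsubmx _ _ _ (fun x => (cdom a (cbwd a x) /\ cfwd a (cbwd a x) = x)
        /\ smooth_at ChM (cbwd a x) f)).
    rewrite lsubmx_cfwd; apply: nearI; first exact: (chart_near_good gM).
    exact: (smooth_at_near gM).
  have := nearI h (oW _ Wu _ au); apply: filterS => z [[[az zz] sz] Wz].
  by rewrite /= Yy // tangent_vec_partial //= zz.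
apply: smooth_near_sum => i; apply: smooth_near_mul; first exact: sy.
apply: (@smooth_near_lsubmx _ _ ('D_(delta_mx 0 i) (f \o cbwd a : _ -> R^o))).
apply: smooth_near_partial; rewrite lsubmx_cfwd.
exact: sf.
Qed.

Lemma is_pifieldS W W' (Y : pifield M) : W' `<=` W -> is_pifield W Y -> is_pifield W' Y.
Proof. by move=> WW' pY u /WW'; exact: pY. Qed.

Lemma frame_pifield i : is_pifield Dom (frame a i).
Proof.
apply: (@is_pifield_chart _ _ (fun=> delta_mx 0 i)) => //; first exact: slit_open_dom.
by move=> u j _; exact: smooth_at_cst.
Qed.

Lemma eta_pifield : is_pifield Dom (@eta R n M).
Proof.
apply: (@is_pifield_chart _ _ (fun u => \row_i u.2 (coord a i))) => //.
- exact: slit_open_dom.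
- move=> u au; have [[tu _] _] := au.
  by apply: (tangent_rep gM tu); exact: dom_fst.
- move=> u i au; rewrite (_ : (fun _ => _) = coord (A := ChT) a (rshift n i)).
    exact: smooth_at_coord.
  by rewrite coord_rshift; apply/funext => v; rewrite mxE.
Qed.

Lemma smooth_comb_pifield W (f : 'I_n -> TM M -> R) : slit_open W -> W `<=` Dom ->
  (forall u i, W u -> smooth_at ChT u (f i)) ->
  is_pifield W (fun u => \sum_i f i u *: frame a i u).
Proof.
move=> oW Wa sf; apply: (@is_pifield_chart _ _ (fun u => \row_i f i u)) => //.
  move=> u /Wa /dom_fst au; rewrite [RHS](tangent_vec_basis (A := ChM)) //.
  by apply: eq_bigr => i _; rewrite mxE.
move=> u i Wu; rewrite (_ : (fun _ => _) = f i); first exact: sf.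
by apply/funext => v; rewrite mxE.
Qed.

Lemma vfield_chart W (X : tfield M) (v : TM M -> 'rV[R]_(n + n)) : slit_open W ->
  W `<=` Dom -> (forall u, W u -> X u = tangent_vec (A := ChT) a u (v u)) ->
  (forall u i, W u -> smooth_at ChT u (fun x => v x 0 i)) -> is_vfield W X.
Proof. by move=> [_ oW]; exact: is_field_chart. Qed.

Definition cfield (w : 'rV[R]_(n + n)) : tfield M := fun u => tangent_vec (A := ChT) a u w.

Lemma cfield_vfield w : is_vfield Dom (cfield w).
Proof.
apply: (@vfield_chart _ _ (fun=> w)) => //; first exact: slit_open_dom.
by move=> u i _; exact: smooth_at_cst.
Qed.

End Chart.
End Manifold.

Lemma row_linear_expand (R : pzRingType) (m : nat) (U : lmodType R) (f : 'rV[R]_m -> U) :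
  (forall c v w, f (c *: v + w) = c *: f v + f w) ->
  forall w, f w = \sum_i w 0 i *: f (delta_mx 0 i).
Proof.
move=> lf w; pose F : {linear 'rV[R]_m -> U} := HB.pack f (GRing.isLinear.Build _ _ _ _ f lf).
rewrite -[LHS]/(F w) {1}(row_sum_delta w) linear_sum.
by apply: eq_bigr => i _; rewrite linearZ.
Qed.

(** * Sections in the coordinate frame, with rho and gamma *)

Section Fields.
Variables (R : realType) (n : nat) (M : manifold R n).
Notation ChM := (mcharts M).
Notation ChT := (slit_charts M).
Variable a : cidx ChM.
Notation Dom := (cdom (c := ChT) a).

Let gM := good_manifold M.

Lemma frame_coord i k u : Dom u -> frame a i u (coord a k) = (i == k)%:R.
Proof.
move=> /dom_fst au; rewrite /frame tangent_vec_coord // mxE eqxx /=.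
by rewrite eq_sym.
Qed.

Lemma pifield_frame W (Y : pifield M) u : is_pifield W Y -> W u -> Dom u ->
  Y u = \sum_i Y u (coord a i) *: frame a i u.
Proof.
move=> pY Wu au; rewrite {1}(pifield_rep pY Wu au) tangent_vec_basis; last exact: dom_fst.
by apply: eq_bigr => i _; rewrite mxE.
Qed.

Lemma frame_comb_coord (f : 'I_n -> R) k u : Dom u ->
  (\sum_i f i *: frame a i u) (coord a k) = f k.
Proof.
move=> au; rewrite fct_sumE (bigD1 k) //= !fctE frame_coord // eqxx.
rewrite big1 ?addr0 => [|i ik]; first by rewrite -[LHS]/(_ * _) mulr1.
by rewrite !fctE frame_coord // (negPf ik) scaler0.
Qed.

Lemma frame_tangent i u : Dom u -> tangent ChM u.1 (frame a i u).
Proof. by move=> /dom_fst au; exact: tangent_vec_tangent. Qed.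

Lemma vfield_tangent W (X : tfield M) u : is_vfield W X -> W u -> tangent ChT u (X u).
Proof. by move=> vX Wu; have [] := vX _ Wu. Qed.

Lemma pifield_tangent W (X : pifield M) u : is_pifield W X -> W u -> tangent ChM u.1 (X u).
Proof. by move=> vX Wu; have [] := vX _ Wu. Qed.

Lemma is_vfieldS W W' (X : tfield M) : W' `<=` W -> is_vfield W X -> is_vfield W' X.
Proof. by move=> WW' vX u /WW'; exact: vX. Qed.

Lemma pifield_domain W (Y : pifield M) : is_pifield W Y -> is_pifield (W `&` Dom) Y.
Proof. by apply: is_pifieldS => u []. Qed.

(** [rho] takes the default value 0 on functions that are not smooth at the base point; on this open
    set the default does not occur, which allows arguments by germs. *)
Lemma chart_open_smooth f : chart_open ChT [set u | slit u /\ smooth_at ChM u.1 f].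
Proof.
move=> u [su sf] b bu; apply: nearI.
  have [_ +] := slit_open_slit M; exact.
apply: (@near_lsubmx _ _ _ (fun x => smooth_at ChM (cbwd (c := ChM) b x) f)).
rewrite lsubmx_cfwd; apply: smooth_at_near => //; exact: dom_fst.
Qed.

Lemma rho_linear u (c : R) xi xi' : rho (M := M) u (c *: xi + xi') = c *: rho u xi + rho u xi'.
Proof.
apply/funext => f; rewrite /rho !fctE; case: ifP => // _.
by rewrite scaler0 addr0.
Qed.

Lemma rho_fst u xi f : smooth_at ChM u.1 f -> xi (f \o fst) = rho (M := M) u xi f.
Proof. by move=> sf; rewrite /rho asboolT. Qed.

Lemma rho_gamma u w : Dom u -> tangent ChM u.1 w -> rho u (gamma u w) = 0.
Proof.
move=> au tw; have au1 := dom_fst au.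
rewrite (tangent_rep gM tw au1) tangent_gamma // tangent_rho // row_mxKl.
exact: tangent_vec0.
Qed.

Lemma gammaF_vfield W X : slit_open W -> W `<=` Dom -> is_pifield W X -> is_vfield W (gammaF X).
Proof.
move=> oW WD pX.
apply: (@vfield_chart _ _ _ a W _ (fun u => row_mx 0 (\row_i X u (coord a i)))) => //.
  move=> u Wu; have au := WD _ Wu; rewrite -tangent_gamma //.
  by rewrite /gammaF -(pifield_rep pX Wu au).
move=> u i Wu; have au := WD _ Wu.
case: (split_ordP i) => j ->{i}.
  rewrite (_ : (fun _ => _) = (fun=> 0)); first exact: smooth_at_cst.
  by apply/funext => v; rewrite row_mxEl mxE.
rewrite (_ : (fun _ => _) = (fun v => X v (coord a j))); first exact: pifield_coord pX Wu au.
by apply/funext => v; rewrite row_mxEr mxE.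
Qed.

End Fields.

(** * The connection and the metric in a chart *)

HB.lock Definition conn (R : realType) (n : nat) (M : manifold R n) (D : linear_connection M)
  (a : cidx (mcharts M)) (w : 'rV[R]_(n + n)) (j k : 'I_n) (u : TM M) : R :=
  D u (cfield a w u) (frame a j) (coord a k).

Section Connection.
Variables (R : realType) (n : nat) (M : manifold R n) (D : linear_connection M).
Notation ChM := (mcharts M).
Notation ChT := (slit_charts M).
Variable a : cidx ChM.
Notation Dom := (cdom (c := ChT) a).

Let gM := good_manifold M.
Let gT := good_slit M.

Lemma zero_pifield : is_pifield Dom (fun=> 0 : functional R M).
Proof.
apply: (@is_pifield_chart _ _ _ a _ _ (fun=> 0)) => //.
- exact: slit_open_dom.
- by move=> u /dom_fst au; rewrite tangent_vec0.
- by move=> u i _; exact: smooth_at_cst.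
Qed.

Lemma pifieldD W (Y Y' : pifield M) : slit_open W -> W `<=` Dom -> is_pifield W Y ->
  is_pifield W Y' -> is_pifield W (fun u => Y u + Y' u).
Proof.
move=> oW WD pY pY' u Wu; have [tY sY] := pY _ Wu; have [tY' sY'] := pY' _ Wu; split.
  exact: (tangentD gM).
by move=> f sf; apply: smooth_at_add; [exact: sY|exact: sY'].
Qed.

Lemma pifieldZ W (f : TM M -> R) (Y : pifield M) : slit_open W ->
  (forall u, W u -> smooth_at ChT u f) -> is_pifield W Y -> is_pifield W (fun u => f u *: Y u).
Proof.
move=> oW sf pY u Wu; have [tY sY] := pY _ Wu; split; first exact: tangentZ.
by move=> h sh; apply: smooth_at_mul; [exact: sf|exact: sY].
Qed.

Lemma nabla0 u xi : Dom u -> tangent ChT u xi -> D u xi (fun=> 0) = 0.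
Proof.
move=> au txi.
have := nabla_add D (slit_open_dom a) zero_pifield zero_pifield au txi.
rewrite (_ : (fun v => 0 + 0) = (fun=> 0 : functional R M)); last by apply/funext => v; rewrite addr0.
by move/(congr1 (fun x => x - D u xi (fun=> 0))); rewrite subrr addrK => <-.
Qed.

(** The two conclusions are proved together because additivity asks each partial sum to be a
    section. *)
Lemma nabla_sum W p (Y : 'I_p -> pifield M) u xi : slit_open W -> W `<=` Dom ->
  (forall i, is_pifield W (Y i)) -> W u -> tangent ChT u xi ->
  is_pifield W (fun v => \sum_i Y i v) /\
  D u xi (fun v => \sum_i Y i v) = \sum_i D u xi (Y i).
Proof.
move=> oW WD pY Wu txi; elim: p Y pY => [|p IH] Y pY.
  rewrite big_ord0 (_ : (fun v => _) = (fun=> 0 : functional R M)).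
    split; first exact: is_pifieldS zero_pifield.
    by apply: nabla0 => //; exact: WD.
  by apply/funext => v; rewrite big_ord0.
have [pS IHS] := IH (fun i => Y (lift ord0 i)) (fun i => pY _).
rewrite big_ord_recl -IHS -(nabla_add D oW (pY ord0) pS Wu txi).
rewrite (_ : (fun v => \sum_(i < p.+1) Y i v) =
  (fun v => Y ord0 v + \sum_(i < p) Y (lift ord0 i) v)).
  by split=> //; exact: pifieldD.
by apply/funext => v; rewrite big_ord_recl.
Qed.

(** The Leibniz rule in the coordinate frame; locality of [nabla] allows [Y] to be replaced by its
    expansion, which holds over the chart only. *)
Lemma nabla_expand W (Y : pifield M) u xi : slit_open W -> is_pifield W Y -> W u ->
  Dom u -> tangent ChT u xi ->
  D u xi Y = \sum_j xi (fun v => Y v (coord a j)) *: frame a j u +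
             \sum_j Y u (coord a j) *: D u xi (frame a j).
Proof.
move=> oW0 pY0 Wu0 au txi.
pose W' := W `&` Dom : set (TM M).
have oW : slit_open W' by apply: slit_openI => //; exact: slit_open_dom.
have pY : is_pifield W' Y := pifield_domain (a := a) pY0.
have Wu : W' u by [].
have WD : W' `<=` Dom by move=> v [].
have pf i : is_pifield W' (frame a i) := is_pifieldS WD (frame_pifield (a := a) i).
have sf i v : W' v -> smooth_at ChT v (fun v => Y v (coord a i)).
  by move=> Wv; apply: (pifield_coord _ pY) => //; exact: WD.
have pG i : is_pifield W' (fun v => Y v (coord a i) *: frame a i v).
  by apply: (pifieldZ (f := fun v => Y v (coord a i))) => // v; exact: sf.
have [pS E] := nabla_sum oW WD pG Wu txi.
have EY v : W' v -> Y v = \sum_j Y v (coord a j) *: frame a j v.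
  by move=> Wv; apply: (pifield_frame pY Wv); exact: WD.
rewrite (nabla_local D oW pY EY Wu txi) E -big_split; apply: eq_bigr => i _ /=.
by rewrite (@nabla_leibniz _ _ _ D W' (fun v => Y v (coord a i))) // => v; exact: sf.
Qed.

(** Tangency of the values is part of [nabla_smooth], which takes vector fields; hence [xi] is
    extended by constant components. *)
Lemma nabla_tangent W (Y : pifield M) u xi : slit_open W -> is_pifield W Y -> W u ->
  Dom u -> tangent ChT u xi -> tangent ChM u.1 (D u xi Y).
Proof.
move=> oW pY Wu au txi.
have oW' : slit_open (W `&` Dom : set (TM M)) := slit_openI oW (slit_open_dom a).
rewrite (tangent_rep gT txi au); set w := \row_i _.
apply: (@pifield_tangent _ _ _ (W `&` Dom) (fun v => D v (cfield a w v) Y)); last by [].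
apply: (nabla_smooth D oW'); last exact: pifield_domain.
by apply: (@is_vfieldS _ _ _ Dom); [move=> v []|exact: cfield_vfield].
Qed.

Local Notation conn := (conn D a).

Lemma conn_smooth w j k u : Dom u -> smooth_at ChT u (conn w j k).
Proof.
move=> au; rewrite conn.unlock; have := @nabla_smooth _ _ _ D Dom (cfield a w) (frame a j) (slit_open_dom a)
  (@cfield_vfield _ _ _ a w) (frame_pifield (a := a) j).
move=> /(pifield_coord k); exact.
Qed.

Lemma nabla_frame u w j : Dom u ->
  D u (cfield a w u) (frame a j) = \sum_k conn w j k u *: frame a k u.
Proof.
move=> au; apply: (tangent_eq gM (dom_fst au)).
- apply: (nabla_tangent (slit_open_dom a) (frame_pifield (a := a) j)) => //.
  exact: tangent_vec_tangent.
- rewrite (eq_bigr (fun k => tangent_vec a u.1 (conn w j k u *: delta_mx 0 k))).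
    rewrite -tangent_vec_sum; last exact: dom_fst.
    by apply: tangent_vec_tangent; exact: dom_fst.
  by move=> k _; rewrite tangent_vecZ //; exact: dom_fst.
- by move=> k; rewrite frame_comb_coord // conn.unlock.
Qed.

Lemma conn_linear w j k u : Dom u -> conn w j k u =
  \sum_i w 0 i * conn (delta_mx 0 i) j k u.
Proof.
move=> au; rewrite conn.unlock.
have lin c v v' : D u (cfield a (c *: v + v') u) (frame a j) =
    c *: D u (cfield a v u) (frame a j) + D u (cfield a v' u) (frame a j).
  rewrite /cfield tangent_vecP // (@nabla_linear _ _ _ D Dom) //.
  - exact: slit_open_dom.
  - exact: frame_pifield.
  - exact: tangent_vec_tangent.
  - exact: tangent_vec_tangent.
have E := @row_linear_expand R _ (functional R M) (fun v => D u (cfield a v u) (frame a j)) lin w.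
apply: (etrans (congr1 (fun h : functional R M => h (coord a k)) E)).
by rewrite fct_sumE.
Qed.

End Connection.

(** * The metric as the vertical Hessian of L^2 *)

HB.lock Definition gcoef (R : realType) (n : nat) (M : manifold R n) (L : finsler M)
  (a : cidx (mcharts M)) (i j : 'I_n) (u : TM M) : R := g L u (frame a i u) (frame a j u).

Section Metric.
Variables (R : realType) (n : nat) (M : manifold R n) (L : finsler M).
Notation ChM := (mcharts M).
Notation ChT := (slit_charts M).
Variable a : cidx ChM.
Notation Dom := (cdom (c := ChT) a).
Notation dy i F := (partial (rshift n i) F).

Let gM := good_manifold M.
Let gT := good_slit M.

Lemma row_mx0_delta i : row_mx 0 (delta_mx 0 i) = delta_mx 0 (rshift n i) :> 'rV[R]_(n + n).
Proof.
apply/rowP => j; rewrite [RHS]mxE eqxx /=.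
case: (split_ordP j) => j' ->; first by rewrite row_mxEl mxE eq_lrshift.
by rewrite row_mxEr mxE eqxx /= (inj_eq (@rshift_inj _ _)).
Qed.

Lemma derive_vertical (f : 'rV[R]_(n + n) -> R^o) z w : differentiable f z ->
  'D_(row_mx 0 w) f z = \sum_i w 0 i * dy i f z.
Proof.
move=> df; rewrite derive_partial // big_split_ord /= big1 ?add0r => [|i _].
  by apply: eq_bigr => i _; rewrite row_mxEr partialE.
by rewrite row_mxEl mxE mul0r.
Qed.

Definition energy (u : TM M) : R := L u ^+ 2.
Definition energy_hat : 'rV[R]_(n + n) -> R^o := energy \o cbwd (c := ChT) a.
Local Notation gcoef := (gcoef L a).

Lemma energy_smooth u : Dom u -> smooth_near energy_hat (cfwd (c := ChT) a u).
Proof.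
move=> au; have [su _] := au; have sL := L_smooth L su au.
by apply: smooth_near_ext (smooth_near_mul sL sL); near=> z.
Unshelve. all: by end_near. Qed.

Lemma cbwd_translate u y : Dom u ->
  cbwd (c := ChT) a (cfwd (c := ChT) a u + row_mx 0 y) = (u.1, u.2 + tangent_vec a u.1 y).
Proof.
move=> au; have au1 := dom_fst au; have [[tu _] _] := au.
rewrite /= add_row_mx addr0 row_mxKl row_mxKr (chart_bwdK gM au1).
set v := \row_i _; rewrite [X in (_, X + _)](tangent_rep gM tu au1) -/v.
by rewrite -[v]scale1r tangent_vecP // !scale1r.
Qed.

(** Translation in a fibre is affine in the chart, so the nested one-variable derivatives of
    [fundamental_form] become directional derivatives. *)
Lemma g_tangent_vec u w w' : Dom u ->
  g L u (tangent_vec a u.1 w) (tangent_vec a u.1 w') =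
  2^-1 * 'D_(row_mx 0 w) ('D_(row_mx 0 w') energy_hat) (cfwd (c := ChT) a u).
Proof.
move=> au; have au1 := dom_fst au; rewrite /g /fundamental_form; congr (_ * _).
rewrite -derive1_line; congr (derive1 _ 0); apply/funext => s.
rewrite -derive1_line; congr (derive1 _ 0); apply/funext => t.
rewrite /energy_hat.
have E : s *: row_mx 0 w + t *: row_mx 0 w' = row_mx 0 (s *: w + t *: w') :> 'rV[R]_(n + n).
  by rewrite !scale_row_mx !scaler0 add_row_mx addr0.
transitivity (energy (cbwd (c := ChT) a
    (cfwd (c := ChT) a u + (s *: row_mx 0 w + t *: row_mx 0 w')))); last by rewrite addrA.
by rewrite E cbwd_translate // /energy tangent_vecP // tangent_vecZ // addrA.
Qed.

Lemma dy_energy_smooth i u : Dom u -> smooth_near (dy i energy_hat) (cfwd (c := ChT) a u).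
Proof. by move=> au; apply: smooth_partial; exact: energy_smooth. Qed.

Lemma gcoefE i j u : Dom u ->
  gcoef i j u = 2^-1 * dy i (dy j energy_hat) (cfwd (c := ChT) a u).
Proof.
move=> au; rewrite partial.unlock -(row_mx0_delta i) -(row_mx0_delta j) gcoef.unlock.
exact: (g_tangent_vec (delta_mx 0 i) (delta_mx 0 j) au).
Qed.

Lemma gcoef_sym i j u : Dom u -> gcoef i j u = gcoef j i u.
Proof.
move=> au; rewrite (gcoefE i j au) (gcoefE j i au).
by rewrite (partial_comm _ _ (energy_smooth au)).
Qed.

Lemma gcoef_hat i j u : Dom u -> \forall z \near cfwd (c := ChT) a u,
  (gcoef i j \o cbwd (c := ChT) a) z = 2^-1 * dy i (dy j energy_hat) z.
Proof.
move=> au; have := chart_near_good gT au; apply: filterS => z [az zz].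
by rewrite /comp (gcoefE i j az) zz.
Qed.

Lemma gcoef_smooth i j u : Dom u -> smooth_at ChT u (gcoef i j).
Proof.
move=> au; apply: (smooth_at_chart gT au).
apply: (@smooth_near_ext _ _ (fun z => 2^-1 * dy i (dy j energy_hat) z)).
  by have := gcoef_hat i j au; apply: filterS => z ->.
apply: smooth_near_mul; first exact: smooth_near_cst.
by apply: smooth_partial; exact: dy_energy_smooth.
Qed.

(** Bilinearity of [g] is not part of its definition: it comes from the linearity in the direction
    of the derivatives of the smooth function L^2. *)
Lemma g_expand u xi xi' : Dom u -> tangent ChM u.1 xi -> tangent ChM u.1 xi' ->
  g L u xi xi' = \sum_i \sum_j xi (coord a i) * xi' (coord a j) * gcoef i j u.
Proof.
move=> au txi txi'; have au1 := dom_fst au.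
rewrite {1}(tangent_rep gM txi au1) {1}(tangent_rep gM txi' au1) g_tangent_vec //.
set w := \row_i xi _; set w' := \row_i xi' _.
have E : \forall z \near cfwd (c := ChT) a u, 'D_(row_mx 0 w') energy_hat z =
    \sum_j w' 0 j * dy j energy_hat z.
  have := smooth_near_near (energy_smooth au); apply: filterS => z sz.
  by rewrite derive_vertical //; exact: smooth_near_differentiable.
rewrite (near_eq_derive _ E) derive_vertical; last first.
  apply: smooth_near_differentiable; apply: smooth_near_sum => j.
  by apply: smooth_near_mul; [exact: smooth_near_cst|exact: dy_energy_smooth].
rewrite mulr_sumr; apply: eq_bigr => i _; rewrite partial_sum; last first.
  by move=> j; apply: smooth_near_mul; [exact: smooth_near_cst|exact: dy_energy_smooth].
rewrite !mulr_sumr; apply: eq_bigr => j _; rewrite partialZ; last exact: dy_energy_smooth.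
rewrite (gcoefE i j au) !mxE; ring.
Qed.

Lemma g_posdef u xi : Dom u -> tangent ChM u.1 xi -> xi <> 0 -> 0 < g L u xi xi.
Proof. by move=> [su _]; exact: L_posdef. Qed.

Lemma g0 u : Dom u -> g L u 0 0 = 0.
Proof.
move=> au; have t0 : tangent ChM u.1 0 by apply: (tangent0 (a := a)); exact: dom_fst.
rewrite (g_expand au t0 t0) big1 // => i _; rewrite big1 // => j _.
by rewrite -[(0 : functional R M) _]/(0 : R) !mul0r.
Qed.

(** Along the ray through [u] the function L^2 equals (1 + t)^2 L(u)^2, whose derivative at t = 0 is
    2 L(u)^2. *)
Lemma energy_euler u : Dom u ->
  \sum_i u.2 (coord a i) * dy i energy_hat (cfwd (c := ChT) a u) = 2 * energy u.
Proof.
move=> au; have au1 := dom_fst au; have [[tu u0] _] := au.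
pose y : 'rV[R]_n := \row_i u.2 (coord a i).
have ty : tangent_vec a u.1 y = u.2 by rewrite -(tangent_rep gM tu au1).
transitivity ('D_(row_mx 0 y) energy_hat (cfwd (c := ChT) a u)).
  rewrite derive_vertical; last by apply: smooth_near_differentiable; exact: energy_smooth.
  by apply: eq_bigr => i _; rewrite mxE.
have E : \forall t \near (0 : R), energy_hat (cfwd (c := ChT) a u + t *: row_mx 0 y) =
    (1 + t) ^+ 2 * energy u.
  (* Homogeneity is available for positive factors only, and the factor is 1 + t. *)
  have : \forall t \near (0 : R), -1 < t by apply: lt_nbhsr; lra.
  apply: filterS => t t1; rewrite scale_row_mx scaler0 /energy_hat /=.
  rewrite -[LHS]/(energy (cbwd (c := ChT) a _)) cbwd_translate // tangent_vecZ // ty.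
  rewrite /energy -{1}[u.2]scale1r -scalerDl L_homogeneous; [|by split|by lra].
  by rewrite exprMn.
rewrite -derive1_line derive1E (near_eq_derive _ E).
have dE : is_derive (0 : R) (1 : R) (fun t : R => (1 + t) ^+ 2 * energy u : R^o) (2 * energy u).
  have d1 : is_derive (0 : R) (1 : R) (cst 1 + id : R -> R^o) (0 + 1) by apply: is_deriveD.
  have d2 : is_derive (0 : R) (1 : R) ((cst 1 + id : R -> R^o) * (cst 1 + id : R -> R^o) * cst (energy u))
     (2 * energy u).
    apply: is_derive_eq; rewrite /GRing.scale /= !fctE; ring.
  by move: d2; rewrite (_ : _ * cst _ = (fun t : R => (1 + t) ^+ 2 * energy u)).
by have [_] := dE.
Qed.

End Metric.

(** * Consequences of the homogeneity of L^2 *)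

Section Fibre.
Variables (R : realType) (n : nat).
Implicit Types (i j : 'I_n) (z : 'rV[R]_(n + n)).

Definition fibre i : 'rV[R]_(n + n) -> R^o := fun z => z 0 (rshift n i).

Lemma smooth_fibre i z : smooth_near (fibre i) z.
Proof. exact: smooth_near_coord. Qed.

Lemma partial_fibre i j z : partial (rshift n i) (fibre j) z = (j == i)%:R.
Proof. by rewrite partial_coord (inj_eq (@rshift_inj _ _)). Qed.

Lemma partial_fibre0 i j z : partial (lshift n i) (fibre j) z = 0.
Proof. by rewrite partial_coord eq_rlshift. Qed.

End Fibre.

Section Euler.
Variables (R : realType) (n : nat).
Notation V := 'rV[R]_(n + n).
Notation dy i F := (partial (rshift n i) F).
Variable E : V -> R^o.

(* [hess E] is [g_ij] and [cartan E] is [1/2 dg_jk/dy^i] when [E = L^2]. *)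
Definition hess i j : V -> R^o := fun z => 2^-1 * dy i (dy j E) z.
Definition cartan i j k : V -> R^o := fun z => 2^-1 * dy i (hess j k) z.

Variable z : V.
Hypothesis sE : smooth_near E z.
Hypothesis euler : \forall z' \near z, \sum_i fibre i z' * dy i E z' = 2 * E z'.

Lemma smooth_hess i j : smooth_near (hess i j) z.
Proof.
by apply: smooth_near_mul; [exact: smooth_near_cst|do 2!apply: smooth_partial].
Qed.

Lemma smooth_cartan i j k : smooth_near (cartan i j k) z.
Proof.
apply: smooth_near_mul; first exact: smooth_near_cst.
apply: smooth_partial; exact: smooth_hess.
Qed.

Lemma hessC i j : hess i j z = hess j i z.
Proof. by rewrite /hess (partial_comm _ _ sE). Qed.

(** Differentiating Euler's relation in y^i gives dE/dy^i + y^j d^2E/dy^i dy^j = 2 dE/dy^i. *)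
Lemma euler1 i : \sum_j fibre j z * hess i j z = 2^-1 * dy i E z.
Proof.
have sdE j := smooth_partial (rshift n j) sE.
have sy j : smooth_near (fibre j) z by exact: smooth_fibre.
have := partial_near (rshift n i) euler.
rewrite (partial_sum _ (fun j => smooth_near_mul (sy j) (sdE j))) (partialZ _ _ sE).
under eq_bigr => j _ do rewrite (partialM _ (sy j) (sdE j)) partial_fibre.
rewrite big_split /= (bigD1 i) //= eqxx mul1r big1 ?addr0 => [|j ji]; last first.
  by rewrite (negPf ji) mul0r.
move=> h; apply: (mulfI (x := 2)); first by rewrite pnatr_eq0.
rewrite mulrA divff ?pnatr_eq0 // mul1r mulr_sumr.
transitivity (\sum_j fibre j z * dy i (dy j E) z).
  by apply: eq_bigr => j _; rewrite /hess mulrCA mulVKf ?pnatr_eq0.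
by apply: (addrI (dy i E z)); rewrite h mulr_natl.
Qed.

End Euler.

Section EulerCartan.
Variables (R : realType) (n : nat).
Notation V := 'rV[R]_(n + n).
Notation dy i F := (partial (rshift n i) F).
Variables (E : V -> R^o) (z : V).
Hypothesis sE : smooth_near E z.
Hypothesis euler : \forall z' \near z, \sum_i fibre i z' * dy i E z' = 2 * E z'.

Lemma hessC_near i j : \forall z' \near z, hess E i j z' = hess E j i z'.
Proof. by have := smooth_near_near sE; apply: filterS => z' sz; exact: hessC. Qed.

Lemma cartanCr i j k : cartan E i j k z = cartan E i k j z.
Proof. by rewrite /cartan (partial_near _ (hessC_near j k)). Qed.

Lemma cartanCl i j k : cartan E i j k z = cartan E j i k z.
Proof.
rewrite /cartan /hess; congr (_ * _).
have s2 j' k' := smooth_partial (rshift n j') (smooth_partial (rshift n k') sE).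
by rewrite !(partialZ _ _ (s2 _ _)) (partial_comm _ _ (smooth_partial _ sE)).
Qed.

(** Differentiating [euler1] in y^k gives g_ik + y^j dg_ij/dy^k = g_ki, and [hess] is symmetric. *)
Lemma cartan_y k i : \sum_j fibre j z * cartan E k i j z = 0.
Proof.
have sy j : smooth_near (fibre j) z by exact: smooth_fibre.
have sh j := smooth_hess sE i j.
have e1 : \forall z' \near z, \sum_j fibre j z' * hess E i j z' = 2^-1 * dy i E z'.
  have := nearI (smooth_near_near sE) (near_join euler); apply: filterS => z' [sz ez].
  exact: euler1.
have := partial_near (rshift n k) e1.
rewrite (partial_sum _ (fun j => smooth_near_mul (sy j) (sh j))).
rewrite (partialZ _ _ (smooth_partial _ sE)).
under eq_bigr => j _ do rewrite (partialM _ (sy j) (sh j)) partial_fibre.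
rewrite big_split /= (bigD1 k) //= eqxx mul1r big1 ?addr0 => [|j ji]; last first.
  by rewrite (negPf ji) mul0r.
rewrite (hessC sE i k) -/(hess E k i z) => h.
have {h} : \sum_j fibre j z * dy k (hess E i j) z = 0.
  by apply: (addrI (hess E k i z)); rewrite h addr0.
move/(congr1 (fun x => 2^-1 * x)); rewrite mulr0 mulr_sumr => h.
by rewrite -[RHS]h; apply: eq_bigr => j _; rewrite /cartan mulrCA.
Qed.

End EulerCartan.

(** * The mixed curvature is the derivative of the torsion *)

Section LandsbergAlgebra.
Variables (R : realFieldType) (n : nat).
Implicit Types (i j k l m r : 'I_n).
(* At a point: [F k j r] is [F^r_kj], [N k r] is [N^r_k], [dT k] is the derivative
   of [T] along [delta_k], [S k j r m] is [dF^r_kj/dy^m], [P j m l] is [Phat^l_jm],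
   and [GS] is the [y^m]-derivative of [nabla_k g_jl = 0]. *)
Variables (y : 'I_n -> R) (G N : 'I_n -> 'I_n -> R) (T F P : 'I_n -> 'I_n -> 'I_n -> R).
Variables (dT S : 'I_n -> 'I_n -> 'I_n -> 'I_n -> R).
Hypothesis TC : forall m j l, T m j l = T m l j.
Hypothesis dTC : forall k m j l, dT k m j l = dT k m l j.
Hypothesis SC : forall k j r m, S k j r m = S j k r m.
Hypothesis NE : forall k r, N k r = \sum_h y h * F k h r.
Hypothesis PE : forall j m l, P j m l = \sum_h y h * S j h l m.
Hypothesis yT : forall m j, \sum_l y l * T m j l = 0.
Hypothesis ydT : forall k m j, \sum_l y l * dT k m j l = \sum_l N k l * T m j l.
Hypothesis GS : forall k j l m,
  \sum_i S k j i m * G i l + \sum_i S k l i m * G i j =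
  2 * dT k m j l - 2 * (\sum_r (F k m r + P k m r) * T r j l)
  - 2 * (\sum_i F k j i * T m i l) - 2 * (\sum_i F k l i * T m i j).
Hypothesis Gnondeg : forall c : 'I_n -> R,
  (forall l, \sum_i c i * G i l = 0) -> forall i, c i = 0.

(** Components of the horizontal derivative (nabla_k T)_mjl. [Q] is the right-hand side of [GS]
    rewritten with them, and [Sl] is [S] with its upper index lowered. *)
Let nab k m j l := dT k m j l - \sum_r F k m r * T r j l
  - \sum_r F k j r * T m r l - \sum_r F k l r * T m r j.
Let Q k j l m := 2 * nab k m j l - 2 * \sum_r P k m r * T r j l.
Let Sl k j l m := \sum_i S k j i m * G i l.

Let SlQ k j l m : Sl k j l m + Sl k l j m = Q k j l m.
Proof.
rewrite /Sl GS /Q /nab.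
under [X in _ - 2 * X - _ - _]eq_bigr => r _ do rewrite mulrDl.
rewrite big_split /=; ring.
Qed.

Let SlC k j l m : Sl k j l m = Sl j k l m.
Proof. by apply: eq_bigr => i _; rewrite SC. Qed.

Let nabC k m j l : nab k m j l = nab k m l j.
Proof.
rewrite /nab dTC (eq_bigr (fun r => F k m r * T r l j)) => [|r _]; last by rewrite TC.
ring.
Qed.

Let contract_sum (p : nat) (c : 'I_p -> R) (t : 'I_p -> 'I_n -> R) :
  \sum_h y h * (\sum_r c r * t r h) = \sum_r c r * \sum_h y h * t r h.
Proof.
under eq_bigr => h _ do rewrite mulr_sumr.
rewrite exchange_big; apply: eq_bigr => r _ /=; rewrite mulr_sumr.
by apply: eq_bigr => h _; rewrite mulrCA.
Qed.

Let yT' r j : \sum_h y h * T r h j = 0.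
Proof. by rewrite -[RHS](yT r j); apply: eq_bigr => h _; rewrite TC. Qed.

(** The tensor nabla_k T inherits this from T: the term N^r_k T_mjr of [ydT], which comes from
    delta_k y^r, cancels against y^l F^r_kl T_mrj by [NE]. *)
Let nab_y k m j : \sum_l y l * nab k m j l = 0.
Proof.
under eq_bigr => l _ do rewrite /nab !mulrBr.
rewrite !sumrB ydT !contract_sum.
rewrite [X in _ - X - _ - _]big1 => [|r _]; last by rewrite yT mulr0.
rewrite [X in _ - _ - X - _]big1 => [|r _]; last by rewrite yT mulr0.
rewrite !subr0.
rewrite (eq_bigr (fun r => N k r * T m r j)) => [|r _]; last by rewrite TC.
apply/eqP; rewrite subr_eq0; apply/eqP.
under [RHS]eq_bigr => l _ do rewrite mulr_sumr.
rewrite exchange_big; apply: eq_bigr => r _ /=.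
by rewrite NE mulr_suml; apply: eq_bigr => h _; rewrite mulrA.
Qed.

Let nab_y' k m j : \sum_l y l * nab k m l j = 0.
Proof. by rewrite -[RHS](nab_y k m j); apply: eq_bigr => l _; rewrite nabC. Qed.

(* The trick that determines the Levi-Civita connection from its metric. *)
Let christoffel k j l m : 2 * Sl k j l m = Q k j l m + Q j k l m - Q l k j m.
Proof. rewrite -!SlQ (SlC l k) (SlC l j) (SlC j k); ring. Qed.

Let PG j m l := \sum_i P j m i * G i l.

Let PGE j m l : PG j m l = \sum_h y h * Sl j h l m.
Proof.
rewrite /PG /Sl.
under eq_bigr => i _ do rewrite PE mulr_suml.
rewrite exchange_big; apply: eq_bigr => h _ /=; rewrite mulr_sumr.
by apply: eq_bigr => i _; rewrite mulrA.
Qed.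

(** [nab0] is nabla_0 T, and [p] is the contraction y^h Phat^r_hm, which [mixed_curvature_y] shows
    to vanish. *)
Let nab0 m j l := \sum_k y k * nab k m j l.
Let p m r := \sum_h y h * P h m r.

Let yQ1 j l m : \sum_h y h * Q j h l m = 0.
Proof.
under eq_bigr => h _ do rewrite /Q mulrBr ![_ * (2 * _)]mulrCA.
rewrite sumrB -!mulr_sumr nab_y' contract_sum.
by rewrite big1 ?mulr0 ?subr0 // => r _; rewrite yT' mulr0.
Qed.

Let yQ2 j l m : \sum_h y h * Q l j h m = 0.
Proof.
under eq_bigr => h _ do rewrite /Q mulrBr ![_ * (2 * _)]mulrCA.
rewrite sumrB -!mulr_sumr nab_y contract_sum.
by rewrite big1 ?mulr0 ?subr0 // => r _; rewrite yT mulr0.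
Qed.

Let yQ3 j l m : \sum_h y h * Q h j l m = 2 * nab0 m j l - 2 * \sum_r p m r * T r j l.
Proof.
under eq_bigr => h _ do rewrite /Q mulrBr ![_ * (2 * _)]mulrCA.
rewrite sumrB -!mulr_sumr; congr (_ - _ * _).
under eq_bigr => h _ do rewrite mulr_sumr.
rewrite exchange_big; apply: eq_bigr => r _ /=.
by rewrite /p mulr_suml; apply: eq_bigr => h _; rewrite mulrA.
Qed.

(** After contraction with y only the middle one of the three terms of [christoffel] survives; it
    still contains Phat, through [p]. *)
Let PGnab j m l : PG j m l = nab0 m j l - \sum_r p m r * T r j l.
Proof.
apply: (mulfI (x := 2)); first by rewrite pnatr_eq0.
rewrite PGE mulr_sumr.
under eq_bigr => h _ do rewrite mulrCA christoffel mulrBr mulrDr.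
rewrite sumrB big_split /= yQ1 yQ2 yQ3; ring.
Qed.

(** Contracting [PGnab] with y^j annihilates its right-hand side, T and nabla_k T being annihilated
    by y. The lemma then clears Phat from the right of [PGnab] itself. *)
Lemma mixed_curvature_y m r : \sum_h y h * P h m r = 0.
Proof.
rewrite -/(p m r); apply: Gnondeg => {r} l.
transitivity (\sum_j y j * PG j m l).
  rewrite /p /PG.
  under eq_bigr => i _ do rewrite mulr_suml.
  rewrite exchange_big; apply: eq_bigr => h _ /=; rewrite mulr_sumr.
  by apply: eq_bigr => i _; rewrite mulrA.
under eq_bigr => j _ do rewrite PGnab mulrBr.
rewrite sumrB [X in _ - X]contract_sum [X in _ - X]big1 ?subr0 => [|r _]; last by rewrite yT' mulr0.
rewrite /nab0 contract_sum big1 // => k _.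
by rewrite nab_y' mulr0.
Qed.

Lemma mixed_curvature_nabla j m l : \sum_i P j m i * G i l =
  \sum_k y k * (dT k m j l - \sum_r F k m r * T r j l
  - \sum_r F k j r * T m r l - \sum_r F k l r * T m r j).
Proof.
rewrite -/(PG j m l) PGnab big1 ?subr0 // => r _.
by rewrite /p mixed_curvature_y mul0r.
Qed.

End LandsbergAlgebra.

(** * Derivation of the pointwise identities from metricity *)

Section LandsbergAnalysis.
Variables (R : realType) (n : nat).
Notation V := 'rV[R]_(n + n).
Notation dx i F := (partial (lshift n i) F).
Notation dy i F := (partial (rshift n i) F).
Variables (E : V -> R^o) (N : 'I_n -> 'I_n -> V -> R^o) (F : 'I_n -> 'I_n -> 'I_n -> V -> R^o).

(* The derivative along the horizontal vector [delta_k = d/dx^k - N^r_k d/dy^r]. *)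
Definition horiz (k : 'I_n) (f : V -> R^o) : V -> R^o :=
  fun z => dx k f z - \sum_r N k r z * dy r f z.

Variable z : V.
Hypothesis sE : smooth_near E z.
Hypothesis euler : \forall z' \near z, \sum_i fibre i z' * dy i E z' = 2 * E z'.
Hypothesis sN : forall k r, smooth_near (N k r) z.
Hypothesis sF : forall k j r, smooth_near (F k j r) z.
Hypothesis FC : forall k j r, \forall z' \near z, F k j r z' = F j k r z'.
Hypothesis NE : forall k r, \forall z' \near z, N k r z' = \sum_h fibre h z' * F k h r z'.
Hypothesis metric : forall k j l, \forall z' \near z, horiz k (hess E j l) z' =
  \sum_i F k j i z' * hess E i l z' + \sum_i F k l i z' * hess E i j z'.
Hypothesis nondeg : forall c : 'I_n -> R,
  (forall l, \sum_i c i * hess E i l z = 0) -> forall i, c i = 0.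

Let sEn : \forall z' \near z, smooth_near E z' := smooth_near_near sE.
Let eulern : \forall z' \near z, \forall z'' \near z', \sum_i fibre i z'' * dy i E z'' = 2 * E z''
  := near_join euler.

Let sh j l : smooth_near (hess E j l) z := smooth_hess sE j l.
Let sc m j l : smooth_near (cartan E m j l) z := smooth_cartan sE m j l.

Lemma dy_hess r j l x : dy r (hess E j l) x = 2 * cartan E r j l x.
Proof. by rewrite /cartan mulrA divff ?pnatr_eq0 // mul1r. Qed.

Lemma horiz_near k f g : (\forall z' \near z, f z' = g z') -> horiz k f z = horiz k g z.
Proof.
move=> fg; rewrite /horiz (partial_near _ fg); congr (_ - _).
by apply: eq_bigr => r _; rewrite (partial_near _ fg).
Qed.

Lemma horizM k f g : smooth_near f z -> smooth_near g z ->
  horiz k (fun x => f x * g x : R^o) z = horiz k f z * g z + f z * horiz k g z.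
Proof.
move=> sf sg; rewrite /horiz (partialM _ sf sg).
under eq_bigr => r _ do rewrite (partialM _ sf sg) mulrDr mulrA mulrCA.
by rewrite big_split /= -mulr_suml -mulr_sumr; ring.
Qed.

Lemma horiz_cst k (c : R) : horiz k (fun=> c) z = 0.
Proof.
rewrite /horiz partial_cst big1 ?subr0 // => r _.
by rewrite partial_cst mulr0.
Qed.

Lemma horiz_sum k p (f : 'I_p -> V -> R^o) : (forall i, smooth_near (f i) z) ->
  horiz k (fun x => \sum_i f i x : R^o) z = \sum_i horiz k (f i) z.
Proof.
move=> sf; rewrite /horiz (partial_sum _ sf).
rewrite [X in _ - X](eq_bigr (fun r => \sum_i N k r z * dy r (f i) z)); last first.
  by move=> r _; rewrite (partial_sum _ sf) mulr_sumr.
by rewrite exchange_big /= -sumrB.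
Qed.

Lemma horiz_fibre k l : horiz k (fibre l) z = - N k l z.
Proof.
rewrite /horiz partial_fibre0 sub0r (bigD1 l) //= partial_fibre eqxx mulr1.
rewrite big1 ?addr0 // => r rl.
by rewrite partial_fibre eq_sym (negPf rl) mulr0.
Qed.

Let cartanCr_near m j l : \forall z' \near z, cartan E m j l z' = cartan E m l j z'.
Proof. by have := sEn; apply: filterS => z' sz; exact: cartanCr. Qed.

Let cartan_y_near m j : \forall z' \near z, \sum_l fibre l z' * cartan E m j l z' = 0.
Proof.
by have := nearI sEn eulern; apply: filterS => z' [sz ez]; exact: cartan_y.
Qed.

(** The derivative along delta_k of the relation y^l T_mjl = 0, with delta_k y^l = - N^l_k. *)
Let horiz_cartan_y k m j : \sum_l fibre l z * horiz k (cartan E m j l) z =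
  \sum_l N k l z * cartan E m j l z.
Proof.
have sf l : smooth_near (fun x => fibre l x * cartan E m j l x : R^o) z.
  by apply: smooth_near_mul; [exact: smooth_fibre|exact: sc].
have := horiz_near k (cartan_y_near m j); rewrite horiz_cst (horiz_sum _ sf).
under eq_bigr => l _ do rewrite (horizM _ (smooth_fibre l z) (sc m j l)) horiz_fibre mulNr.
by rewrite big_split /= sumrN => /eqP; rewrite addrC subr_eq0 => /eqP.
Qed.

(** Differentiating [NE]: the difference dN^l_j/dy^m - F^l_jm is y^h dF^l_jh/dy^m, as the hypothesis
    [PE] of the algebraic part asks. *)
Let dy_N j m l : dy m (N j l) z = F j m l z + \sum_h fibre h z * dy m (F j h l) z.
Proof.
have sf h : smooth_near (fun x => fibre h x * F j h l x : R^o) z.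
  by apply: smooth_near_mul; [exact: smooth_fibre|exact: sF].
rewrite (partial_near _ (NE j l)) (partial_sum _ sf).
under eq_bigr => h _ do rewrite (partialM _ (smooth_fibre h z) (sF j h l)) partial_fibre.
rewrite big_split /= (bigD1 m) //= eqxx mul1r big1 ?addr0 // => h hm.
by rewrite (negPf hm) mul0r.
Qed.

(** The fields d/dy^m and delta_k do not commute: d/dy^m also falls on the coefficients N^r_k, which
    produces the last sum. *)
Let dy_horiz k m j l : dy m (horiz k (hess E j l)) z =
  2 * horiz k (cartan E m j l) z - 2 * \sum_r dy m (N k r) z * cartan E r j l z.
Proof.
have s1 i : smooth_near (partial i (hess E j l)) z by exact: smooth_partial.
have s2 r : smooth_near (fun x => N k r x * dy r (hess E j l) x : R^o) z.
  by apply: smooth_near_mul; [exact: sN|exact: s1].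
rewrite (partialB _ (s1 _) (smooth_near_sum s2)) (partial_sum _ s2).
have e i : dy m (partial i (hess E j l)) z = 2 * partial i (cartan E m j l) z.
  rewrite (partial_comm _ _ (sh j l)) -(partialZ _ _ (sc m j l)).
  by apply: partial_near; near=> x; exact: dy_hess.
under eq_bigr => r _ do rewrite (partialM _ (sN k r) (s1 _)) e dy_hess.
rewrite e big_split /= /horiz mulrBr !mulr_sumr.
rewrite [X in _ - (X + _)](eq_bigr (fun r => 2 * (dy m (N k r) z * cartan E r j l z))); last first.
  by move=> r _; rewrite mulrCA.
rewrite [X in _ - (_ + X)](eq_bigr (fun r => 2 * (N k r z * dy r (cartan E m j l) z))); last first.
  by move=> r _; rewrite mulrCA.
by rewrite opprD addrA addrAC.
Unshelve. all: by end_near. Qed.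

Let dy_metric k j l m :
  \sum_i dy m (F k j i) z * hess E i l z + \sum_i dy m (F k l i) z * hess E i j z =
  2 * horiz k (cartan E m j l) z - 2 * (\sum_r dy m (N k r) z * cartan E r j l z)
  - 2 * (\sum_i F k j i z * cartan E m i l z) - 2 * (\sum_i F k l i z * cartan E m i j z).
Proof.
have sf k' j' l' i : smooth_near (fun x => F k' j' i x * hess E i l' x : R^o) z.
  by apply: smooth_near_mul; [exact: sF|exact: sh].
have h j' l' : dy m (fun x => \sum_i F k j' i x * hess E i l' x) z =
   \sum_i dy m (F k j' i) z * hess E i l' z + 2 * \sum_i F k j' i z * cartan E m i l' z.
  rewrite (partial_sum _ (sf k j' l')) mulr_sumr -big_split /=.
  apply: eq_bigr => i _; rewrite (partialM _ (sF k j' i) (sh i l')) dy_hess.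
  by congr (_ + _); exact: mulrCA.
have := partial_near (rshift n m) (metric k j l).
rewrite dy_horiz (partialD _ (smooth_near_sum (sf k j l)) (smooth_near_sum (sf k l j))) !h.
move=> ->; ring.
Qed.

Lemma mixed_curvature_cartan j m l :
  \sum_i (dy m (N j i) z - F j m i z) * hess E i l z =
  \sum_k fibre k z * (horiz k (cartan E m j l) z - \sum_r F k m r z * cartan E r j l z
  - \sum_r F k j r z * cartan E m r l z - \sum_r F k l r z * cartan E m r j z).
Proof.
pose P j m i := dy m (N j i) z - F j m i z.
pose dT k m j l := horiz k (cartan E m j l) z.
pose S k j r m := dy m (F k j r) z.
refine (@mixed_curvature_nabla R n (fun h => fibre h z) (fun i l => hess E i l z) (fun k r => N k r z)
  (fun m j l => cartan E m j l z) (fun k j r => F k j r z) P dT S _ _ _ _ _ _ _ _ _ j m l).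
- by move=> *; apply: cartanCr.
- by move=> k m' j' l'; apply: horiz_near; exact: cartanCr_near.
- by move=> k j' r m'; apply: partial_near; exact: FC.
- by move=> k r; exact: nbhs_singleton (NE k r).
- by move=> j' m' l'; rewrite /P dy_N addrC addKr.
- by move=> m' j'; exact: nbhs_singleton (cartan_y_near m' j').
- exact: horiz_cartan_y.
- move=> k j' l' m'; rewrite dy_metric.
  (* Here dN^r_k/dy^m is written F^r_km + Phat^r_km, the form that [GS] expects. *)
  by do 3!congr (_ - _); congr (_ * _); apply: eq_bigr => r _; rewrite /P addrC subrK.
- exact: nondeg.
Qed.

End LandsbergAnalysis.

(** * The Cartan connection in a chart *)

(** Coefficients along d/dx^i and not along its horizontal lift; the latter, which depend on N, are
    [fcoef]. *)
HB.lock Definition hcoef (R : realType) (n : nat) (M : manifold R n) (D : linear_connection M)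
  (a : cidx (mcharts M)) (i j k : 'I_n) : TM M -> R := conn D a (delta_mx 0 (lshift n i)) j k.

HB.lock Definition vcoef (R : realType) (n : nat) (M : manifold R n) (D : linear_connection M)
  (a : cidx (mcharts M)) (i j k : 'I_n) : TM M -> R := conn D a (delta_mx 0 (rshift n i)) j k.

Section Regular.
Variables (R : realType) (n : nat) (M : manifold R n) (D : linear_connection M).
Hypothesis reg : regular D.
Notation ChM := (mcharts M).
Notation ChT := (slit_charts M).
Variable a : cidx ChM.
Notation Dom := (cdom (c := ChT) a).
Local Notation A := (hcoef D a).
Local Notation B := (vcoef D a).
Implicit Types (W : set (TM M)) (X Y : pifield M).

Let gM := good_manifold M.
Let gT := good_slit M.

Lemma hcoef_smooth i j k u : Dom u -> smooth_at ChT u (A i j k).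
Proof. by rewrite hcoef.unlock; exact: conn_smooth. Qed.

Lemma vcoef_smooth i j k u : Dom u -> smooth_at ChT u (B i j k).
Proof. by rewrite vcoef.unlock; exact: conn_smooth. Qed.

Lemma conn_row_mx x y j k u : Dom u -> conn D a (row_mx x y) j k u =
  \sum_i x 0 i * A i j k u + \sum_i y 0 i * B i j k u.
Proof.
move=> au; rewrite conn_linear // big_split_ord /= hcoef.unlock vcoef.unlock.
by congr (_ + _); apply: eq_bigr => i _; rewrite ?row_mxEl ?row_mxEr.
Qed.

(** Regularity splits any lift of [w] into a vertical and a horizontal part, and the horizontal part
    still projects to [w]. So [xget] does not fall back on its default in [beta]. *)
Lemma beta_spec u w : slit u -> tangent ChM u.1 w ->
  horizontal D u (beta D u w) /\ rho u (beta D u w) = w.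
Proof.
move=> su tw.
suff [h hh] : exists h, horizontal D u h /\ rho u h = w.
  exact: (@xgetPex _ 0 [set xi | horizontal D u xi /\ rho u xi = w] (ex_intro _ h hh)).
have [b bu] := slit_cdom su; have bu1 := dom_fst bu.
pose xi := tangent_vec (A := ChT) b u (row_mx (\row_i w (coord b i)) 0).
have txi : tangent ChT u xi by exact: tangent_vec_tangent.
have [v [h [[tv rv] hh E]]] := (reg su).1 _ txi.
exists h; split=> //.
have : rho u xi = w by rewrite tangent_rho // row_mxKl -(tangent_rep gM tw bu1).
rewrite E -[v]scale1r rho_linear rv scaler0 add0r => <-.
by [].
Qed.

Lemma beta_tangent u w : slit u -> tangent ChM u.1 w -> tangent ChT u (beta D u w).
Proof. by move=> su tw; have [[]] := beta_spec su tw. Qed.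

Lemma rhoF_betaF W X v : slit_open W -> is_pifield W X -> W v -> rhoF (betaF D X) v = X v.
Proof.
move=> [sW _] pX Wv.
by have [_] := beta_spec (sW _ Wv) (pifield_tangent pX Wv).
Qed.

Lemma pifield_eval W Y f : slit_open W -> W `<=` Dom -> is_pifield W Y ->
  forall v, (W `&` [set v | slit v /\ smooth_at ChM v.1 f]) v ->
  Y v f = \sum_i Y v (coord a i) * (tangent_vec (A := ChM) a v.1 (delta_mx 0 i) f).
Proof.
move=> oW WD pY v [Wv [sv sf]]; rewrite {1}(pifield_frame pY Wv (WD _ Wv)).
by rewrite fct_sumE.
Qed.

(** A vertical vector kills functions lifted from the base, so in Y^j df/dx^j it differentiates the
    components only. *)
Lemma vertical_pifield_eval W Y u xi f : slit_open W -> W `<=` Dom -> is_pifield W Y -> W u ->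
  smooth_at ChM u.1 f -> tangent ChT u xi -> rho u xi = 0 ->
  xi (fun v => Y v f) = (\sum_j xi (fun v => Y v (coord a j)) *: frame a j u) f.
Proof.
move=> oW WD pY Wu sf txi rxi; have au := WD _ Wu.
have oW' := chart_openI (proj2 oW) (chart_open_smooth (M := M) (f := f)).
have [su _] := au.
rewrite (tangent_germ txi oW' _ (pifield_eval oW WD pY)); last by split.
have sY j : smooth_at ChT u (fun v => Y v (coord a j)) by exact: pifield_coord pY Wu au.
pose h j : M -> R := fun x => tangent_vec (A := ChM) a x (delta_mx 0 j) f.
have sh j : smooth_at ChM u.1 (h j).
  have fr : is_field ChM (cdom a) (fun x => tangent_vec (A := ChM) a x (delta_mx 0 j)).
    apply: (@is_field_chart _ _ _ _ gM a _ _ (fun=> delta_mx 0 j)) => //.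
      exact: chart_open_dom.
    by move=> x i _; exact: smooth_at_cst.
  by have [_] := fr _ (dom_fst au); exact.
have shf j : smooth_at ChT u (h j \o fst) by exact: smooth_at_fst au (sh j).
rewrite -[LHS]/(xi (fun v => \sum_i Y v (coord a i) * (h i \o fst) v)).
rewrite (tangent_sum txi (fun i => smooth_at_mul (sY i) (shf i))) fct_sumE.
apply: eq_bigr => j _; rewrite (tangent_mul gT txi (sY j) (shf j)).
rewrite (rho_fst _ (sh j)) rxi -[(0 : functional R M) _]/(0 : R) mulr0 add0r mulrC.
by [].
Qed.

(* The smoothness of [betaF D Y] is not yet known here, so that [nabla] cannot
   be applied to it; but [rho [gamma X, beta Y]] only involves
   [rho (beta Y) = Y]. *)
Lemma Ttor_chart W X Y u : slit_open W -> is_pifield W X -> is_pifield W Y -> W u -> Dom u ->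
  Ttor D X Y u = \sum_j Y u (coord a j) *: D u (gammaF X u) (frame a j).
Proof.
move=> oW0 pX0 pY0 Wu0 au; pose W' := W `&` Dom : set (TM M).
have oW : slit_open W' := slit_openI oW0 (slit_open_dom a).
have pX : is_pifield W' X := pifield_domain (a := a) pX0.
have pY : is_pifield W' Y := pifield_domain (a := a) pY0.
have Wu : W' u by [].
have WD : W' `<=` Dom by move=> v [].
have su : slit u by case: au.
have tX v : W' v -> tangent ChM v.1 (X v) by exact: pifield_tangent pX.
have tY v : W' v -> tangent ChM v.1 (Y v) by exact: pifield_tangent pY.
have tgX : tangent ChT u (gammaF X u) by apply: gamma_tangent au (tX _ Wu).
have tbY : tangent ChT u (betaF D Y u) by apply: beta_tangent su (tY _ Wu).
have r0 v : W' v -> rhoF (gammaF X) v = 0.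
  by move=> Wv; apply: (rho_gamma (a := a)); [exact: WD|exact: tX].
rewrite /Ttor /torsion /cov.
rewrite -(nabla_local D oW pY (fun v Wv => esym (rhoF_betaF oW pY Wv)) Wu tgX).
have p0 : is_pifield W' (fun=> 0 : functional R M) := is_pifieldS WD (@zero_pifield _ _ _ a).
rewrite -(nabla_local D oW p0 (fun v Wv => esym (r0 v Wv)) Wu tbY) (nabla0 D au tbY) subr0.
rewrite (nabla_expand D oW pY Wu au tgX) addrAC.
suff -> : rho u (bracket (gammaF X) (betaF D Y) u) =
    \sum_j gammaF X u (fun v => Y v (coord a j)) *: frame a j u by rewrite subrr add0r.
apply/funext => f; rewrite /rho; case: asboolP => sf; last first.
  rewrite fct_sumE big1 // => j _.
  by rewrite -[LHS]/(_ * _) /frame tangent_vec_ns // mulr0.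
rewrite /bracket asboolT; last exact: smooth_at_fst au sf.
have oW' := chart_openI (proj2 oW) (chart_open_smooth (M := M) (f := f)).
have Wu' : (W' `&` [set v | slit v /\ smooth_at ChM v.1 f]) u by split.
have e1 v : (W' `&` [set v | slit v /\ smooth_at ChM v.1 f]) v -> betaF D Y v (f \o fst) = Y v f.
  by move=> [Wv [_ sfv]]; rewrite (rho_fst _ sfv) -[RHS](congr1 (fun h => h f) (rhoF_betaF oW pY Wv)).
have e2 v : (W' `&` [set v | slit v /\ smooth_at ChM v.1 f]) v -> gammaF X v (f \o fst) = 0.
  by move=> [Wv [_ sfv]]; rewrite (rho_fst _ sfv) -[RHS](congr1 (fun h => h f) (r0 _ Wv)).
rewrite (tangent_germ tgX oW' Wu' e1) (tangent_germ tbY oW' Wu' e2) (tangent_cst _ tbY) subr0.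
by rewrite (vertical_pifield_eval oW WD pY Wu sf tgX (r0 _ Wu)).
Qed.

Lemma gammaF_frame i u : Dom u -> gammaF (frame a i) u = cfield a (delta_mx 0 (rshift n i)) u.
Proof. by move=> au; rewrite -row_mx0_delta; exact: (tangent_gamma (delta_mx 0 i) au). Qed.

Lemma Ttor_frame i j u : Dom u ->
  Ttor D (frame a i) (frame a j) u = \sum_k B i j k u *: frame a k u.
Proof.
move=> au; rewrite (Ttor_chart (slit_open_dom a) (frame_pifield i) (frame_pifield j) au au).
rewrite (bigD1 j) //= (frame_coord j j au) eqxx scale1r big1 ?addr0 => [|k kj]; last first.
  by rewrite (frame_coord j k au) eq_sym (negPf kj) scale0r.
rewrite (gammaF_frame i au) (nabla_frame D _ j au).
by apply: eq_bigr => k _; rewrite vcoef.unlock.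
Qed.

End Regular.

(** * Vertical coefficients and the horizontal lift *)

Section Cartan.
Variables (R : realType) (n : nat) (M : manifold R n) (L : finsler M) (D : linear_connection M).
Hypothesis hD : is_cartan L D.
Notation ChM := (mcharts M).
Notation ChT := (slit_charts M).
Variable a : cidx ChM.
Notation Dom := (cdom (c := ChT) a).
Notation hat F := (F \o cbwd (c := ChT) a : 'rV[R]_(n + n) -> R^o).
Notation pt u := (cfwd (c := ChT) a u).
Notation dy i F := (partial (rshift n i) F).
Local Notation A := (hcoef D a).
Local Notation B := (vcoef D a).
Local Notation G := (gcoef L a).
Local Notation Eh := (energy_hat L a).
Implicit Types (W : set (TM M)) (X Y : pifield M).

Let gM := good_manifold M.
Let gT := good_slit M.

Let reg : regular D. Proof. by have [] := hD. Qed.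

Lemma g_frame u xi m : Dom u -> tangent ChM u.1 xi ->
  g L u xi (frame a m u) = \sum_k xi (coord a k) * G k m u.
Proof.
move=> au txi; rewrite (g_expand L au txi (frame_tangent m au)).
apply: eq_bigr => k _; rewrite (bigD1 m) //= (frame_coord m m au) eqxx mulr1.
rewrite big1 ?addr0 // => j jm.
by rewrite (frame_coord m j au) eq_sym (negPf jm) mulr0 mul0r.
Qed.

Lemma g_sym u xi xi' : Dom u -> tangent ChM u.1 xi -> tangent ChM u.1 xi' ->
  g L u xi xi' = g L u xi' xi.
Proof.
move=> au t t'; rewrite (g_expand L au t t') (g_expand L au t' t) exchange_big.
apply: eq_bigr => i _; apply: eq_bigr => j _ /=.
by rewrite (gcoef_sym L i j au) [X in X * _]mulrC.
Qed.

Lemma frame_comb_tangent (c : 'I_n -> R) u : Dom u ->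
  tangent ChM u.1 (\sum_i c i *: frame a i u).
Proof.
move=> au; have au1 := dom_fst au.
rewrite (_ : \sum_i _ = tangent_vec a u.1 (\row_i c i)); first exact: tangent_vec_tangent.
by rewrite tangent_vec_basis //; apply: eq_bigr => i _; rewrite mxE.
Qed.

(** A vector orthogonal to the frame is orthogonal to itself, hence 0 by positivity. Identities
    proved below with a lowered index are raised again through this lemma. *)
Lemma g_nondeg u (c : 'I_n -> R) : Dom u -> (forall k, \sum_l c l * G l k u = 0) ->
  forall l, c l = 0.
Proof.
move=> au h; pose xi := \sum_l c l *: frame a l u.
have txi : tangent ChM u.1 xi by exact: frame_comb_tangent.
have xi0 : xi = 0.
  have [//|nz] := pselect (xi = 0).
  have := g_posdef L au txi nz; rewrite (g_expand L au txi txi) exchange_big big1 ?ltxx // => k _.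
  transitivity (c k * \sum_l c l * G l k u); last by rewrite h mulr0.
  rewrite mulr_sumr; apply: eq_bigr => l _.
  by rewrite /xi (frame_comb_coord c l au) (frame_comb_coord c k au) mulrCA mulrA.
by move=> l; rewrite -[LHS](frame_comb_coord c l au) -/xi xi0.
Qed.

Lemma cfieldE w u (F : TM M -> R) : smooth_at ChT u F ->
  cfield a w u F = 'D_w (hat F) (pt u).
Proof. by move=> sF; rewrite /cfield tangent_vecE. Qed.

Lemma cfield_dy i u (F : TM M -> R) : smooth_at ChT u F ->
  cfield a (delta_mx 0 (rshift n i)) u F = dy i (hat F) (pt u).
Proof. by move=> sF; rewrite cfieldE // partialE. Qed.

Lemma metrical_conn w j k u : Dom u -> cfield a w u (G j k) =
  \sum_l conn D a w j l u * G l k u + \sum_l conn D a w k l u * G l j u.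
Proof.
move=> au; have [_ met _ _] := hD.
have := met _ _ _ _ _ (slit_open_dom a) (@cfield_vfield _ _ _ a w) (frame_pifield j) (frame_pifield k) au.
rewrite (_ : (fun v => _) = G j k); last by rewrite gcoef.unlock.
move=> ->; rewrite /cov.
have tc j' : tangent ChM u.1 (D u (cfield a w u) (frame a j')).
  by rewrite nabla_frame //; exact: frame_comb_tangent.
rewrite (g_sym au (frame_tangent j au) (tc k)) !(g_frame _ au (tc _)).
by rewrite conn.unlock.
Qed.

Lemma gcoef_dy i j k u : Dom u -> cfield a (delta_mx 0 (rshift n i)) u (G j k) =
  2 * cartan Eh i j k (pt u).
Proof.
move=> au; rewrite (cfield_dy _ (gcoef_smooth L j k au)).
by rewrite (partial_near _ (gcoef_hat L j k au)) dy_hess.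
Qed.

(** Metricity along d/dy^i says that T_ijk + T_ikj is dg_jk/dy^i, and the symmetry of T makes the
    two summands equal. *)
Lemma vcoef_lower i j k u : Dom u -> \sum_l B i j l u * G l k u = cartan Eh i j k (pt u).
Proof.
move=> au; have [_ _ _ Tsym] := hD.
have gT3 q r : g L u (Ttor D (frame a i) (frame a q) u) (frame a r u) =
    \sum_l B i q l u * G l r u.
  rewrite (Ttor_frame reg i q au) (g_frame r au (frame_comb_tangent _ au)).
  by apply: eq_bigr => l _; rewrite (frame_comb_coord _ l au).
have sym := etrans (esym (gT3 j k)) (etrans (Tsym _ _ _ _ _ (slit_open_dom a)
  (frame_pifield i) (frame_pifield j) (frame_pifield k) au) (gT3 k j)).
have := metrical_conn (delta_mx 0 (rshift n i)) j k au.
rewrite (gcoef_dy i j k au) vcoef.unlock in sym *.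
have two : (2 : R) != 0 by rewrite pnatr_eq0.
rewrite -sym => e; apply: (mulfI two).
by rewrite e mulr_natl mulr2n.
Qed.

Lemma fibre_pt j u : fibre j (pt u) = u.2 (coord a j).
Proof. by rewrite /fibre /= row_mxEr mxE. Qed.

(** Carries a relation known at the points of the chart domain to the coordinates near [pt u], where
    it can be differentiated. *)
Lemma near_chart (P : 'rV[R]_(n + n) -> Prop) u : Dom u ->
  (forall v, Dom v -> P (pt v)) -> \forall z \near pt u, P z.
Proof.
move=> au h; have := chart_near_good gT au; apply: filterS => z [az zz].
by have := h _ az; rewrite zz.
Qed.

Lemma energy_euler_near u : Dom u ->
  \forall z \near pt u, \sum_i fibre i z * dy i Eh z = 2 * Eh z.
Proof.
move=> au; apply: (near_chart au) => v av.
rewrite /energy_hat -[RHS]/(2 * energy L (cbwd (c := ChT) a (pt v))) (chart_bwdK gT av).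
rewrite -(energy_euler L av); apply: eq_bigr => i _.
by rewrite fibre_pt.
Qed.

Lemma vcoef_y i k u : Dom u -> \sum_j u.2 (coord a j) * B i j k u = 0.
Proof.
move=> au; apply: (@g_nondeg u (fun k => \sum_j u.2 (coord a j) * B i j k u) au) => m.
under eq_bigr => l _ do rewrite mulr_suml.
rewrite exchange_big /=.
transitivity (\sum_j fibre j (pt u) * cartan Eh i m j (pt u)).
  apply: eq_bigr => j _; rewrite fibre_pt (cartanCr (energy_smooth L au)).
  rewrite -(vcoef_lower i j m au) mulr_sumr; apply: eq_bigr => l _.
  by rewrite mulrA.
exact: cartan_y (energy_smooth L au) (energy_euler_near au) _ _.
Qed.

(** Formed with the coefficients along d/dx^i, because the horizontal coefficients are themselves
    defined from N; [ncoef_fcoef] gives the contraction with the latter. *)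
Definition ncoef i k (u : TM M) : R := \sum_j u.2 (coord a j) * A i j k u.

Lemma coord_smooth j u : Dom u -> smooth_at ChT u (fun v => v.2 (coord a j)).
Proof. by move=> au; rewrite -coord_rshift; exact: smooth_at_coord. Qed.

Lemma ncoef_smooth i k u : Dom u -> smooth_at ChT u (ncoef i k).
Proof.
move=> au; apply: (@smooth_at_sum _ _ _ _ u n (fun j v => v.2 (coord a j) * A i j k v)) => j.
by apply: smooth_at_mul; [exact: coord_smooth|exact: hcoef_smooth].
Qed.

(** The vertical coefficients enter nabla eta only through y^j T^k_ij = 0, so the fibre components
    y^k come out unchanged. *)
Lemma Kmap_chart (x y : 'rV[R]_n) u : Dom u ->
  Kmap D u (cfield a (row_mx x y) u) =
  \sum_k (y 0 k + \sum_i x 0 i * ncoef i k u) *: frame a k u.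
Proof.
move=> au; have txi : tangent ChT u (cfield a (row_mx x y) u) by exact: tangent_vec_tangent.
rewrite /Kmap (nabla_expand D (slit_open_dom a) (@eta_pifield _ _ _ a) au au txi).
rewrite [X in _ + X](eq_bigr (fun j => \sum_k (u.2 (coord a j) *
   (\sum_i x 0 i * A i j k u + \sum_r y 0 r * B r j k u)) *: frame a k u)); last first.
  move=> j _; rewrite nabla_frame // scaler_sumr; apply: eq_bigr => k _.
  by rewrite scalerA conn_row_mx.
rewrite exchange_big -big_split; apply: eq_bigr => k _ /=.
rewrite -scaler_suml -scalerDl; congr (_ *: _); congr (_ + _).
  by rewrite /eta -coord_rshift /cfield (tangent_vec_coord gT _ _ au) row_mxEr.
under [LHS]eq_bigr => j _ do rewrite mulrDr.
rewrite big_split /= [X in _ + X](_ : _ = 0) ?addr0.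
  under [LHS]eq_bigr => j _ do rewrite mulr_sumr.
  rewrite exchange_big; apply: eq_bigr => i _ /=; rewrite mulr_sumr.
  by apply: eq_bigr => j _; rewrite mulrCA.
under [LHS]eq_bigr => j _ do rewrite mulr_sumr.
rewrite exchange_big big1 // => r _ /=.
transitivity (y 0 r * \sum_j u.2 (coord a j) * B r j k u).
  by rewrite mulr_sumr; apply: eq_bigr => j _; rewrite mulrCA.
by rewrite vcoef_y // mulr0.
Qed.

Definition hlift (x : 'rV[R]_n) (u : TM M) : 'rV[R]_(n + n) :=
  row_mx x (\row_k - \sum_i x 0 i * ncoef i k u).

(** [rho] forces the x-components, and the vanishing of the expression in [Kmap_chart] then
    determines the y-components. *)
Lemma beta_chart u w : Dom u -> tangent ChM u.1 w ->
  beta D u w = cfield a (hlift (\row_i w (coord a i)) u) u.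
Proof.
move=> au tw; have [su _] := au; have [[tb Kb] rb] := beta_spec reg su tw.
pose v := \row_i beta D u w (coord (A := ChT) a i).
have E : beta D u w = cfield a (row_mx (lsubmx v) (rsubmx v)) u.
  by rewrite hsubmxK; exact: (tangent_rep gT tb au).
have lv : lsubmx v = \row_i w (coord a i).
  apply: (tangent_vec_inj gM (dom_fst au)).
  rewrite -(tangent_rep gM tw (dom_fst au)) -[RHS]rb E /cfield tangent_rho // row_mxKl.
  by [].
rewrite E; congr (cfield a _ u); rewrite /hlift lv; congr row_mx.
apply/rowP => k; rewrite [RHS]mxE; apply/eqP; rewrite -addr_eq0; apply/eqP.
have := congr1 (fun h : functional R M => h (coord a k)) Kb.
by rewrite E Kmap_chart // frame_comb_coord // lv.
Qed.

End Cartan.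

(** * Horizontal coefficients of the connection *)

Section Horizontal.
Variables (R : realType) (n : nat) (M : manifold R n) (L : finsler M) (D : linear_connection M).
Hypothesis hD : is_cartan L D.
Notation ChM := (mcharts M).
Notation ChT := (slit_charts M).
Variable a : cidx ChM.
Notation Dom := (cdom (c := ChT) a).
Local Notation A := (hcoef D a).
Local Notation B := (vcoef D a).
Local Notation N := (ncoef D a).
Implicit Types (W : set (TM M)) (X Y : pifield M).

Let gT := good_slit M.

Let reg : regular D. Proof. by have [] := hD. Qed.

(* [F^r_kj], the coefficients of [nabla] along [beta (d/dx^k)]. *)
Definition fcoef k j r (u : TM M) : R := A k j r u - \sum_s N k s u * B s j r u.

Lemma fcoef_smooth k j r u : Dom u -> smooth_at ChT u (fcoef k j r).
Proof.
move=> au; apply: (@smooth_at_add _ _ _ _ u (A k j r) (fun u => - \sum_s N k s u * B s j r u)).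
  exact: hcoef_smooth.
apply: smooth_at_opp.
apply: (@smooth_at_sum _ _ _ _ u n (fun s u => N k s u * B s j r u)) => s.
by apply: smooth_at_mul; [exact: ncoef_smooth|exact: vcoef_smooth].
Qed.

(** The correction by N^s_j T^k_sh in [fcoef] disappears in the contraction with y^h. *)
Lemma ncoef_fcoef j k u : Dom u -> N j k u = \sum_h u.2 (coord a h) * fcoef j h k u.
Proof.
move=> au; rewrite /fcoef; under eq_bigr => h _ do rewrite mulrBr mulr_sumr.
rewrite sumrB exchange_big /= [X in _ - X]big1 ?subr0 // => s _.
transitivity (N j s u * \sum_h u.2 (coord a h) * B s h k u).
  by rewrite mulr_sumr; apply: eq_bigr => h _; rewrite mulrCA.
by rewrite (vcoef_y hD s k au) mulr0.
Qed.

Lemma conn_hlift x j k u : Dom u -> conn D a (hlift D a x u) j k u =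
  \sum_i x 0 i * fcoef i j k u.
Proof.
move=> au; rewrite /hlift conn_row_mx // /fcoef.
under [RHS]eq_bigr => i _ do rewrite mulrBr.
rewrite sumrB; congr (_ + _); rewrite -sumrN.
under [RHS]eq_bigr => i _ do rewrite mulr_sumr -sumrN.
rewrite exchange_big; apply: eq_bigr => r _ /=; rewrite mxE mulNr mulr_suml -sumrN.
by apply: eq_bigr => i _; rewrite mulrA.
Qed.

Definition comps X (u : TM M) : 'rV[R]_n := \row_i X u (coord a i).

Lemma betaF_chart W X u : is_pifield W X -> W u -> Dom u ->
  betaF D X u = cfield a (hlift D a (comps X u) u) u.
Proof. by move=> pX Wu au; exact: (beta_chart hD au (pifield_tangent pX Wu)). Qed.

(** Smoothness of the lift is visible in its chart formula. It allows [bracket_chart] and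
    [nabla_smooth] to be applied to [betaF D X]. *)
Lemma betaF_vfield W X : slit_open W -> W `<=` Dom -> is_pifield W X -> is_vfield W (betaF D X).
Proof.
move=> oW WD pX.
apply: (@vfield_chart _ _ _ a W _ (fun u => hlift D a (comps X u) u)) => //.
  by move=> u Wu; exact: betaF_chart pX Wu (WD _ Wu).
move=> u i Wu; have au := WD _ Wu.
case: (split_ordP i) => j ->{i}.
  rewrite (_ : (fun _ => _) = (fun v => X v (coord a j))); first exact: pifield_coord pX Wu au.
  by apply/funext => v; rewrite row_mxEl mxE.
rewrite (_ : (fun _ => _) = (fun v => - \sum_i X v (coord a i) * N i j v)).
  apply: smooth_at_opp.
  apply: (@smooth_at_sum _ _ _ _ u n (fun i v => X v (coord a i) * N i j v)) => i.
  by apply: smooth_at_mul; [exact: pifield_coord pX Wu au|exact: ncoef_smooth].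
by apply/funext => v; rewrite row_mxEr mxE; congr (- _); apply: eq_bigr => k _; rewrite mxE.
Qed.

Lemma nabla_beta_frame W X j u : is_pifield W X -> W u -> Dom u ->
  D u (betaF D X u) (frame a j) =
  \sum_k (\sum_i X u (coord a i) * fcoef i j k u) *: frame a k u.
Proof.
move=> pX Wu au; rewrite (betaF_chart pX Wu au) (nabla_frame D _ j au).
apply: eq_bigr => k _; rewrite conn_hlift //; congr (_ *: _).
by apply: eq_bigr => i _; rewrite mxE.
Qed.

Lemma nabla_beta W X Y k u : slit_open W -> is_pifield W X -> is_pifield W Y -> W u -> Dom u ->
  D u (betaF D X u) Y (coord a k) = betaF D X u (fun v => Y v (coord a k)) +
  \sum_j Y u (coord a j) * \sum_i X u (coord a i) * fcoef i j k u.
Proof.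
move=> oW pX pY Wu au.
have tb : tangent ChT u (betaF D X u).
  by rewrite (betaF_chart pX Wu au); exact: tangent_vec_tangent.
rewrite (nabla_expand D oW pY Wu au tb) -[LHS]/(_ + _); congr (_ + _).
  exact: frame_comb_coord.
rewrite fct_sumE; apply: eq_bigr => j _.
by rewrite (nabla_beta_frame j pX Wu au) -[LHS]/(_ * _) (frame_comb_coord _ k au).
Qed.

Lemma beta_lshift W X k u : slit_open W -> is_pifield W X -> W u -> Dom u ->
  betaF D X u (coord (A := ChT) a (lshift n k)) = X u (coord a k).
Proof.
move=> oW pX Wu au; rewrite (betaF_chart pX Wu au) /cfield (tangent_vec_coord gT _ _ au).
by rewrite row_mxEl mxE.
Qed.

Lemma beta_rshift W X k u : slit_open W -> is_pifield W X -> W u -> Dom u ->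
  betaF D X u (coord (A := ChT) a (rshift n k)) = - \sum_i X u (coord a i) * N i k u.
Proof.
move=> oW pX Wu au; rewrite (betaF_chart pX Wu au) /cfield (tangent_vec_coord gT _ _ au).
by rewrite row_mxEr mxE; congr (- _); apply: eq_bigr => i _; rewrite mxE.
Qed.

(** This is Q = 0 on the frame: the lifts of d/dx^i and d/dx^j have constant x-components, so their
    bracket is vertical and [rho] kills it. *)
Lemma fcoef_sym i j k u : Dom u -> fcoef i j k u = fcoef j i k u.
Proof.
move=> au; have [_ _ Q0 _] := hD.
have oD := slit_open_dom a; have pf q := frame_pifield (a := a) q.
have := congr1 (fun h : functional R M => h (coord a k))
  (Q0 _ _ _ _ oD (pf i) (pf j) au).
rewrite /Qtor /torsion /cov.
have tb q : tangent ChT u (betaF D (frame a q) u).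
  by rewrite (betaF_chart (pf q) au au); exact: tangent_vec_tangent.
have nb q r : D u (betaF D (frame a q) u) (rhoF (betaF D (frame a r))) (coord a k) =
    fcoef q r k u.
  rewrite -(nabla_local D oD (pf r) (fun v Wv => esym (rhoF_betaF reg oD (pf r) Wv)) au (tb q)).
  rewrite (nabla_beta_frame r (pf q) au au) (frame_comb_coord _ k au).
  rewrite (bigD1 q) //= (frame_coord q q au) eqxx mul1r big1 ?addr0 // => s sq.
  by rewrite (frame_coord q s au) eq_sym (negPf sq) mul0r.
have sk : smooth_at ChM u.1 (coord a k) by apply: (smooth_at_coord (good_manifold M)); exact: dom_fst.
have bk q r : betaF D (frame a q) u (fun v => betaF D (frame a r) v (coord a k \o fst)) = 0.
  rewrite (@tangent_germ _ _ _ _ u _ Dom _ (fun=> (r == k)%:R) (tb q)) //.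
  - exact: tangent_cst (tb q).
  - exact: (proj2 oD).
  - by move=> v av; rewrite -coord_lshift (beta_lshift k oD (pf r) av av) frame_coord.
have br : rho u (bracket (betaF D (frame a i)) (betaF D (frame a j)) u) (coord a k) = 0.
  rewrite /rho asboolT // /bracket asboolT; last exact: smooth_at_fst au sk.
  by rewrite (bk i j) (bk j i) subrr.
rewrite -[LHS]/(D u _ _ (coord a k) - D u _ _ (coord a k) - rho u _ (coord a k)) br subr0.
by rewrite (nb i j) (nb j i) => /eqP; rewrite subr_eq0 => /eqP.
Qed.

End Horizontal.

(** * Differentiation along beta(eta), and Phat = nabla_0 T *)

Section CovariantDerivative.
Variables (R : realType) (n : nat) (M : manifold R n) (L : finsler M) (D : linear_connection M).
Hypothesis hD : is_cartan L D.
Notation ChM := (mcharts M).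
Notation ChT := (slit_charts M).
Variable a : cidx ChM.
Notation Dom := (cdom (c := ChT) a).
Notation hat F := (F \o cbwd (c := ChT) a : 'rV[R]_(n + n) -> R^o).
Notation pt u := (cfwd (c := ChT) a u).
Notation dy i F := (partial (rshift n i) F).
Local Notation B := (vcoef D a).
Local Notation G := (gcoef L a).
Local Notation N := (ncoef D a).
Local Notation F := (fcoef D a).
Local Notation Eh := (energy_hat L a).
Local Notation C m j l u := (cartan Eh m j l (pt u)).
Local Notation yc u j := (u.2 (coord a j)).
Implicit Types (W : set (TM M)) (X Y : pifield M) (f : TM M -> R).

Let gT := good_slit M.

Let hN k r : 'rV[R]_(n + n) -> R^o := hat (N k r).

Lemma hatK u f : Dom u -> hat f (pt u) = f u.
Proof. by move=> au; rewrite /comp (chart_bwdK gT au). Qed.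

Lemma beta_horiz W X u f : is_pifield W X -> W u -> Dom u -> smooth_at ChT u f ->
  betaF D X u f = \sum_i X u (coord a i) * horiz hN i (hat f) (pt u).
Proof.
move=> pX Wu au sf; rewrite (betaF_chart hD pX Wu au) cfieldE //.
rewrite derive_partial; last exact: smooth_at_differentiable.
under [RHS]eq_bigr => i _ do rewrite mulrBr.
rewrite big_split_ord sumrB /=; congr (_ + _).
  by apply: eq_bigr => i _; rewrite row_mxEl mxE partialE.
under [in RHS]eq_bigr => i _ do rewrite mulr_sumr.
rewrite exchange_big -sumrN; apply: eq_bigr => r _ /=.
rewrite row_mxEr mxE mulNr mulr_suml; congr (- _); apply: eq_bigr => i _.
by rewrite mxE /hN (hatK _ au) partialE mulrA.
Qed.

Lemma beta_frame_horiz k u f : Dom u -> smooth_at ChT u f ->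
  betaF D (frame a k) u f = horiz hN k (hat f) (pt u).
Proof.
move=> au sf; rewrite (beta_horiz (frame_pifield k) au au sf).
rewrite (bigD1 k) //= (frame_coord k k au) eqxx mul1r big1 ?addr0 // => s sk.
by rewrite (frame_coord k s au) eq_sym (negPf sk) mul0r.
Qed.

Lemma beta_eta u f : Dom u -> smooth_at ChT u f ->
  betaF D (@eta R n M) u f = \sum_k yc u k * betaF D (frame a k) u f.
Proof.
move=> au sf; rewrite (beta_horiz (@eta_pifield _ _ _ a) au au sf).
by apply: eq_bigr => k _; rewrite (beta_frame_horiz k au sf).
Qed.

Lemma beta_frame_gcoef k j l u : Dom u -> betaF D (frame a k) u (G j l) =
  \sum_i F k j i u * G i l u + \sum_i F k l i u * G i j u.
Proof.
move=> au; rewrite (betaF_chart hD (frame_pifield k) au au) (metrical_conn hD _ j l au).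
have e q r : conn D a (hlift D a (comps a (frame a k) u) u) q r u = F k q r u.
  rewrite (conn_hlift D _ q r au) (bigD1 k) //= mxE (frame_coord k k au) eqxx mul1r.
  rewrite big1 ?addr0 // => s sk.
  by rewrite mxE (frame_coord k s au) eq_sym (negPf sk) mul0r.
by congr (_ + _); apply: eq_bigr => i _; rewrite e.
Qed.

(** [ncoef_fcoef] contracts the other lower index; the symmetry of F exchanges them. Hence the
    connection coefficients along beta(eta) are N. *)
Lemma fcoef_y m r u : Dom u -> \sum_h yc u h * F h m r u = N m r u.
Proof.
move=> au; rewrite (ncoef_fcoef hD m r au); apply: eq_bigr => h _.
by rewrite (fcoef_sym hD h m r au).
Qed.

Lemma beta_eta_gcoef l k u : Dom u -> betaF D (@eta R n M) u (G l k) =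
  \sum_r N l r u * G r k u + \sum_r N k r u * G r l u.
Proof.
move=> au; rewrite (beta_eta au (gcoef_smooth L l k au)).
under eq_bigr => h _ do rewrite (beta_frame_gcoef h l k au) mulrDr !mulr_sumr.
rewrite big_split /=; congr (_ + _); rewrite exchange_big; apply: eq_bigr => r _ /=.
  by rewrite -(fcoef_y l r au) mulr_suml; apply: eq_bigr => h _; rewrite mulrA.
by rewrite -(fcoef_y k r au) mulr_suml; apply: eq_bigr => h _; rewrite mulrA.
Qed.

Lemma gcoef_hess i j u : Dom u -> hess Eh i j (pt u) = G i j u.
Proof. by move=> au; rewrite (gcoefE L i j au). Qed.

(* [Phat^i_jm], see [Phat_frame]. *)
Definition pcoef j m i (u : TM M) : R := dy m (hN j i) (pt u) - F j m i u.

Lemma pcoef_horiz j m l u : Dom u -> \sum_i pcoef j m i u * G i l u =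
  \sum_k yc u k * (horiz hN k (cartan Eh m j l) (pt u) - \sum_r F k m r u * C r j l u
  - \sum_r F k j r u * C m r l u - \sum_r F k l r u * C m r j u).
Proof.
move=> au; have sN k r : smooth_near (hN k r) (pt u) by exact: (ncoef_smooth D k r au).
have sF k j' r : smooth_near (hat (F k j' r)) (pt u) by exact: (fcoef_smooth D k j' r au).
have := @mixed_curvature_cartan R n Eh hN (fun k j r => hat (F k j r)) (pt u)
  (energy_smooth L au) (energy_euler_near L au) sN sF _ _ _ _ j m l.
have h1 k j' r : \forall z \near pt u, hat (F k j' r) z = hat (F j' k r) z.
  by apply: (near_chart au) => v av; rewrite !(hatK _ av); exact: (fcoef_sym hD).
have h2 k r : \forall z \near pt u, hN k r z = \sum_h fibre h z * hat (F k h r) z.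
  apply: (near_chart au) => v av; rewrite /hN (hatK _ av) (ncoef_fcoef hD k r av).
  by apply: eq_bigr => h _; rewrite (hatK _ av) fibre_pt.
have h3 k j' l' : \forall z \near pt u, horiz hN k (hess Eh j' l') z =
    \sum_i hat (F k j' i) z * hess Eh i l' z + \sum_i hat (F k l' i) z * hess Eh i j' z.
  apply: (near_chart au) => v av.
  rewrite -(horiz_near hN k (gcoef_hat L j' l' av)).
  rewrite -(beta_frame_horiz k av (gcoef_smooth L j' l' av)) (beta_frame_gcoef k j' l' av).
  by congr (_ + _); apply: eq_bigr => i _; rewrite (hatK _ av) (gcoef_hess _ _ av).
have h4 (c : 'I_n -> R) : (forall l', \sum_i c i * hess Eh i l' (pt u) = 0) -> forall i, c i = 0.
  move=> h; apply: (@g_nondeg _ _ _ L a u c au) => l'; rewrite -[RHS](h l').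
  by apply: eq_bigr => i _; rewrite (gcoef_hess _ _ au).
move=> /(_ h1 h2 h3 h4) E.
transitivity (\sum_i (dy m (hN j i) (pt u) - hat (F j m i) (pt u)) * hess Eh i l (pt u)).
  by apply: eq_bigr => i _; rewrite /pcoef (hatK _ au) (gcoef_hess _ _ au).
rewrite E; apply: eq_bigr => k _; rewrite fibre_pt; congr (_ * (_ - _ - _ - _));
  by apply: eq_bigr => r _; rewrite (hatK _ au).
Qed.

(* The components of [nabla_(beta eta) T], see [cov_tensor_chart]. *)
Definition bcoef m j l (u : TM M) : R := betaF D (@eta R n M) u (B m j l)
  - \sum_r N m r u * B r j l u - \sum_r N j r u * B m r l u + \sum_r N r l u * B m j r u.

Let Tf m j l : TM M -> R := fun u => \sum_r B m j r u * G r l u.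

Lemma beta_eta_tangent u : Dom u -> tangent ChT u (betaF D (@eta R n M) u).
Proof.
move=> au; rewrite (betaF_chart hD (@eta_pifield _ _ _ a) au au).
exact: tangent_vec_tangent.
Qed.

Lemma beta_eta_cartan m j l u : Dom u ->
  \sum_k yc u k * horiz hN k (cartan Eh m j l) (pt u) =
  \sum_r (betaF D (@eta R n M) u (B m j r) * G r l u + B m j r u * betaF D (@eta R n M) u (G r l)).
Proof.
move=> au; have sB r : smooth_at ChT u (B m j r) by exact: vcoef_smooth.
have sG r : smooth_at ChT u (G r l) by exact: gcoef_smooth.
have sBG r : smooth_at ChT u (fun v => B m j r v * G r l v) by exact: smooth_at_mul.
have sT : smooth_at ChT u (Tf m j l).
  exact: (@smooth_at_sum _ _ _ _ u n (fun r v => B m j r v * G r l v)).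
have TC : \forall z \near pt u, hat (Tf m j l) z = cartan Eh m j l z.
  by apply: (near_chart au) => v av; rewrite (hatK _ av); exact: (vcoef_lower hD m j l av).
transitivity (betaF D (@eta R n M) u (Tf m j l)).
  rewrite (beta_eta au sT); apply: eq_bigr => k _.
  by rewrite (beta_frame_horiz k au sT) (horiz_near hN k TC).
have tb := beta_eta_tangent au.
rewrite -[LHS]/(betaF D (@eta R n M) u (fun v => \sum_r B m j r v * G r l v)).
rewrite (tangent_sum tb sBG); apply: eq_bigr => r _.
by rewrite (tangent_mul gT tb (sB r) (sG r)) addrC mulrC.
Qed.

(** Lowering an index commutes with nabla_0 because the metric is parallel: the N-terms of
    [beta_eta_gcoef] turn the upper-index term of [bcoef] into a lower-index one. *)
Lemma bcoef_lower m j l u : Dom u -> \sum_i bcoef m j i u * G i l u =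
  \sum_k yc u k * (horiz hN k (cartan Eh m j l) (pt u) - \sum_r F k m r u * C r j l u
  - \sum_r F k j r u * C m r l u - \sum_r F k l r u * C m r j u).
Proof.
move=> au.
have cs q (t : 'I_n -> R) : \sum_k yc u k * \sum_r F k q r u * t r = \sum_r N q r u * t r.
  under eq_bigr => k _ do rewrite mulr_sumr.
  rewrite exchange_big; apply: eq_bigr => r _ /=.
  by rewrite -(fcoef_y q r au) mulr_suml; apply: eq_bigr => k _; rewrite mulrA.
under [RHS]eq_bigr => k _ do rewrite 3!mulrBr.
rewrite 3!sumrB (cs m (fun r => C r j l u)) (cs j (fun r => C m r l u)) (cs l (fun r => C m r j u)).
rewrite (beta_eta_cartan m j l au).
under [LHS]eq_bigr => i _ do rewrite /bcoef mulrDl 2!mulrBl.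
rewrite big_split 2!sumrB /=.
have e1 q (t : 'I_n -> 'I_n -> R) (d : 'I_n -> R) :
    (forall r, \sum_i t r i * G i l u = d r) ->
    \sum_i (\sum_r N q r u * t r i) * G i l u = \sum_r N q r u * d r.
  move=> h; under eq_bigr => i _ do rewrite mulr_suml.
  rewrite exchange_big; apply: eq_bigr => r _ /=.
  by rewrite -h mulr_sumr; apply: eq_bigr => i _; rewrite mulrA.
rewrite (e1 m (fun r i => B r j i u) (fun r => C r j l u) (fun r => vcoef_lower hD r j l au)).
rewrite (e1 j (fun r i => B m r i u) (fun r => C m r l u) (fun r => vcoef_lower hD m r l au)).
rewrite big_split /=.
rewrite [X in _ + X - _ - _ - _](_ : _ = \sum_i (\sum_r N r i u * B m j r u) * G i l u +
   \sum_r N l r u * C m r j u); first by ring.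
under eq_bigr => r _ do rewrite (beta_eta_gcoef r l au) mulrDr.
rewrite big_split /=; congr (_ + _).
  under [RHS]eq_bigr => i _ do rewrite mulr_suml.
  rewrite exchange_big; apply: eq_bigr => r _ /=; rewrite mulr_sumr.
  by apply: eq_bigr => i _; rewrite mulrA [B m j r u * _]mulrC.
under [LHS]eq_bigr => r _ do rewrite mulr_sumr.
rewrite exchange_big; apply: eq_bigr => s _ /=.
rewrite (cartanCr (energy_smooth L au)) -(vcoef_lower hD m j s au) mulr_sumr.
by apply: eq_bigr => r _; rewrite mulrCA (gcoef_sym L s r au).
Qed.

Lemma pcoef_bcoef j m l u : Dom u -> pcoef j m l u = bcoef m j l u.
Proof.
move=> au; apply/eqP; rewrite -subr_eq0; apply/eqP.
apply: (@g_nondeg _ _ _ L a u (fun l => pcoef j m l u - bcoef m j l u) au) => k.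
under eq_bigr => i _ do rewrite mulrBl.
by rewrite sumrB (pcoef_horiz j m k au) (bcoef_lower m j k au) subrr.
Qed.

End CovariantDerivative.

(** * Components of Phat and of nabla_0 T *)

Section MixedCurvature.
Variables (R : realType) (n : nat) (M : manifold R n) (L : finsler M) (D : linear_connection M).
Hypothesis hD : is_cartan L D.
Notation ChM := (mcharts M).
Notation ChT := (slit_charts M).
Variable a : cidx ChM.
Notation Dom := (cdom (c := ChT) a).
Notation hat F := (F \o cbwd (c := ChT) a : 'rV[R]_(n + n) -> R^o).
Notation pt u := (cfwd (c := ChT) a u).
Notation dy i F := (partial (rshift n i) F).
Local Notation B := (vcoef D a).
Local Notation N := (ncoef D a).
Local Notation F := (fcoef D a).
Implicit Types (W : set (TM M)) (X Y : pifield M) (f : TM M -> R).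

Let gM := good_manifold M.
Let gT := good_slit M.

Let reg : regular D. Proof. by have [] := hD. Qed.

Lemma gammaF_chart W Y u : is_pifield W Y -> W u -> Dom u ->
  gammaF Y u = cfield a (row_mx 0 (comps a Y u)) u.
Proof.
move=> pY Wu au; rewrite /gammaF (pifield_rep pY Wu au); exact: tangent_gamma.
Qed.

Lemma gamma_dy W Y u f : is_pifield W Y -> W u -> Dom u -> smooth_at ChT u f ->
  gammaF Y u f = \sum_m Y u (coord a m) * dy m (hat f) (pt u).
Proof.
move=> pY Wu au sf; rewrite (gammaF_chart pY Wu au) cfieldE // derive_vertical.
  by apply: eq_bigr => m _; rewrite mxE.
exact: smooth_at_differentiable.
Qed.

Lemma nabla_eta w u : Dom u -> D u (cfield a w u) (@eta R n M) =
  \sum_k (w 0 (rshift n k) + \sum_i w 0 (lshift n i) * N i k u) *: frame a k u.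
Proof.
move=> au; have := Kmap_chart hD (lsubmx w) (rsubmx w) au.
rewrite /Kmap hsubmxK => ->; apply: eq_bigr => k _; congr (_ *: _).
by rewrite mxE; congr (_ + _); apply: eq_bigr => i _; rewrite mxE.
Qed.

Lemma bracket_chart W (X Y : tfield M) u : slit_open W -> is_vfield W X -> is_vfield W Y ->
  W u -> Dom u -> bracket X Y u =
  cfield a (\row_i (X u (fun v => Y v (coord (A := ChT) a i)) -
                    Y u (fun v => X v (coord (A := ChT) a i)))) u.
Proof.
move=> [_ oW] vX vY Wu au; apply/funext => f; rewrite /bracket /cfield.
case: asboolP => sf; last by rewrite tangent_vec_ns.
exact: (field_bracket gT oW vX vY Wu au sf).
Qed.

(** As K (gamma Y) = Y and K (beta X) = 0, the curvature applied to eta reduces to - nabla_(beta X)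
    Y + K [beta X, gamma Y]; no second covariant derivative is left. *)
Lemma Phat_chart W X Y u : slit_open W -> is_pifield W X -> is_pifield W Y -> W u -> Dom u ->
  Phat D X Y u = \sum_i (\sum_j \sum_m X u (coord a j) * Y u (coord a m) * pcoef D a j m i u)
    *: frame a i u.
Proof.
move=> oW0 pX0 pY0 Wu0 au; pose W' := W `&` Dom : set (TM M).
have oW : slit_open W' := slit_openI oW0 (slit_open_dom a).
have pX : is_pifield W' X := pifield_domain (a := a) pX0.
have pY : is_pifield W' Y := pifield_domain (a := a) pY0.
have Wu : W' u by [].
have WD : W' `<=` Dom by move=> v [].
have vX := betaF_vfield hD oW WD pX.
have vY := gammaF_vfield oW WD pY.
have tX := vfield_tangent vX Wu; have tY := vfield_tangent vY Wu.
have kY v : W' v -> Y v = cov D (gammaF Y) (@eta R n M) v.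
  move=> Wv; have av := WD _ Wv; rewrite /cov (gammaF_chart pY Wv av) (nabla_eta _ av).
  rewrite (pifield_frame pY Wv av); apply: eq_bigr => k _; congr (_ *: _).
  rewrite row_mxEr mxE big1 ?addr0 -?(pifield_frame pY Wv av) // => i _.
  by rewrite row_mxEl mxE mul0r.
have kX v : W' v -> 0 = cov D (betaF D X) (@eta R n M) v.
  move=> Wv; have [sv _] := WD _ Wv.
  by have [[_ K0] _] := beta_spec reg sv (pifield_tangent pX Wv); exact: esym K0.
have p0 : is_pifield W' (fun=> 0 : functional R M) := is_pifieldS WD (@zero_pifield _ _ _ a).
rewrite /Phat /Pcurv /curvature -[cov D (betaF D X) _ u]/(D u (betaF D X u) _).
rewrite -[cov D (gammaF Y) _ u]/(D u (gammaF Y u) _).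
rewrite -(nabla_local D oW pY kY Wu tX) -(nabla_local D oW p0 kX Wu tY) (nabla0 D au tY) addr0.
rewrite /cov (bracket_chart oW vX vY Wu au) (nabla_eta _ au).
have sY k : smooth_at ChT u (fun v => Y v (coord a k)) by exact: pifield_coord pY Wu au.
have sX k : smooth_at ChT u (fun v => X v (coord a k)) by exact: pifield_coord pX Wu au.
have sN i k : smooth_at ChT u (N i k) by exact: ncoef_smooth.
have c1 i : betaF D X u (fun v => gammaF Y v (coord (A := ChT) a (lshift n i))) = 0.
  rewrite (@tangent_germ _ _ _ _ u _ W' _ (fun=> 0) tX (proj2 oW) Wu); first exact: (tangent_cst 0 tX).
  move=> v Wv; have av := WD _ Wv.
  by rewrite (gammaF_chart pY Wv av) /cfield (tangent_vec_coord gT _ _ av) row_mxEl mxE.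
have c2 i : gammaF Y u (fun v => betaF D X v (coord (A := ChT) a (lshift n i))) =
    gammaF Y u (fun v => X v (coord a i)).
  apply: (@tangent_germ _ _ _ _ u _ W' _ _ tY (proj2 oW) Wu) => v Wv.
  exact: (beta_lshift hD i oW pX Wv (WD _ Wv)).
have c3 k : betaF D X u (fun v => gammaF Y v (coord (A := ChT) a (rshift n k))) =
    betaF D X u (fun v => Y v (coord a k)).
  apply: (@tangent_germ _ _ _ _ u _ W' _ _ tX (proj2 oW) Wu) => v Wv; have av := WD _ Wv.
  by rewrite (gammaF_chart pY Wv av) /cfield (tangent_vec_coord gT _ _ av) row_mxEr mxE.
have sXN k i : smooth_at ChT u (fun v => X v (coord a i) * N i k v) by exact: smooth_at_mul.
have c4 k : gammaF Y u (fun v => betaF D X v (coord (A := ChT) a (rshift n k))) =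
    - \sum_i (X u (coord a i) * gammaF Y u (N i k) + N i k u * gammaF Y u (fun v => X v (coord a i))).
  have s0 : smooth_at ChT u (fun v => \sum_i X v (coord a i) * N i k v).
    exact: (@smooth_at_sum _ _ _ _ u n (fun i v => X v (coord a i) * N i k v)).
  transitivity (gammaF Y u (fun v => (-1) * \sum_i X v (coord a i) * N i k v)).
    apply: (@tangent_germ _ _ _ _ u _ W' _ _ tY (proj2 oW) Wu) => v Wv.
    by rewrite (beta_rshift hD k oW pX Wv (WD _ Wv)) mulN1r.
  rewrite (tangent_mul gT tY (@smooth_at_cst _ _ _ ChT u (-1)) s0) (tangent_cst _ tY) mulr0 addr0 mulN1r.
  rewrite (tangent_sum tY (sXN k)); congr (- _); apply: eq_bigr => i _.
  by rewrite (tangent_mul gT tY (sX i) (sN i k)).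
apply: (tangent_eq gM (dom_fst au)).
- apply: (tangentD gM); last exact: frame_comb_tangent.
  by apply: tangentN; exact: (nabla_tangent D oW pY Wu au tX).
- exact: frame_comb_tangent.
move=> k; rewrite (frame_comb_coord _ k au) -[LHS]/(- D u _ Y (coord a k) + _ (coord a k)).
rewrite (frame_comb_coord _ k au) (nabla_beta hD k oW pX pY Wu au) mxE c3 c4.
under [X in _ + (_ + X)]eq_bigr => i _ do rewrite mxE c1 c2 sub0r mulNr.
rewrite sumrN opprK big_split /=.
rewrite [\sum_i N i k u * _](eq_bigr (fun i => gammaF Y u (fun v => X v (coord a i)) * N i k u));
  last by move=> i _; rewrite mulrC.
(* The derivatives of the components of [X] and [Y] cancel, as tensoriality of Phat requires. *)
have alg (p q r s : R) : - (p + q) + (p + (r + s) - s) = r - q by ring.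
rewrite alg; under eq_bigr => i _ do rewrite (gamma_dy pY Wu au (sN i k)) mulr_sumr.
rewrite [X in _ - X](_ : _ = \sum_i \sum_m X u (coord a i) * Y u (coord a m) * F i m k u).
  rewrite -sumrB; apply: eq_bigr => i _; rewrite -sumrB; apply: eq_bigr => m _.
  by rewrite /pcoef [RHS]mulrBr [X in X - _]mulrA.
rewrite [RHS]exchange_big; apply: eq_bigr => m _ /=; rewrite mulr_sumr.
by apply: eq_bigr => i _; rewrite mulrCA mulrA.
Qed.

Lemma cov_beta_eta_frame m u : Dom u ->
  cov D (betaF D (@eta R n M)) (frame a m) u = \sum_r N m r u *: frame a r u.
Proof.
move=> au; rewrite /cov (nabla_beta_frame hD m (@eta_pifield _ _ _ a) au au).
by apply: eq_bigr => r _; rewrite -(fcoef_y hD m r au).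
Qed.

(** By [cov_beta_eta_frame] the frame moves along beta(eta) with coefficients N; the three N-terms
    of [bcoef] come from the two arguments of T and from its value. *)
Lemma cov_tensor_chart m j l u : Dom u ->
  cov_tensor D (betaF D (@eta R n M)) (Ttor D) (frame a m) (frame a j) u (coord a l) =
  bcoef D a m j l u.
Proof.
move=> au; have oD := slit_open_dom a; have pf q := frame_pifield (a := a) q.
have pe := @eta_pifield _ _ _ a.
have ve := betaF_vfield hD oD (fun v => id) pe.
have tb := vfield_tangent ve au.
have pc q : is_pifield Dom (cov D (betaF D (@eta R n M)) (frame a q)).
  exact: (nabla_smooth D oD ve (pf q)).
rewrite /cov_tensor -[LHS]/(_ (coord a l) - _ (coord a l) - _ (coord a l)) /bcoef.
have pB : is_pifield Dom (fun v => \sum_k B m j k v *: frame a k v).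
  apply: (smooth_comb_pifield (f := B m j)) => // v i av; exact: vcoef_smooth.
have e1 : cov D (betaF D (@eta R n M)) (Ttor D (frame a m) (frame a j)) u (coord a l) =
    betaF D (@eta R n M) u (B m j l) + \sum_r N r l u * B m j r u.
  rewrite /cov -(nabla_local D oD pB (fun v av => esym (Ttor_frame reg m j av)) au tb).
  rewrite (nabla_beta hD l oD pe pB au au); congr (_ + _).
    by apply: (tangent_germ tb (proj2 oD) au) => v av; rewrite (frame_comb_coord _ l av).
  apply: eq_bigr => r _; rewrite (frame_comb_coord _ r au) mulrC.
  by rewrite -(fcoef_y hD r l au).
have cN q r : cov D (betaF D (@eta R n M)) (frame a q) u (coord a r) = N q r u.
  by rewrite (cov_beta_eta_frame q au) (frame_comb_coord _ r au).
have e2 : Ttor D (cov D (betaF D (@eta R n M)) (frame a m)) (frame a j) u (coord a l) =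
    \sum_r N m r u * B r j l u.
  rewrite (Ttor_chart reg oD (pc m) (pf j) au au).
  rewrite (bigD1 j) //= (frame_coord j j au) eqxx scale1r big1 ?addr0 => [|q qj]; last first.
    by rewrite (frame_coord j q au) eq_sym (negPf qj) scale0r.
  rewrite (gammaF_chart (pc m) au au) (nabla_frame D _ j au) (frame_comb_coord _ l au).
  rewrite (conn_row_mx D _ _ j l au) big1 ?add0r => [|i _]; last by rewrite mxE mul0r.
  by apply: eq_bigr => r _; rewrite mxE cN.
have e3 : Ttor D (frame a m) (cov D (betaF D (@eta R n M)) (frame a j)) u (coord a l) =
    \sum_r N j r u * B m r l u.
  rewrite (Ttor_chart reg oD (pf m) (pc j) au au) fct_sumE; apply: eq_bigr => r _.
  rewrite (gammaF_frame m au) (nabla_frame D _ r au) cN -[LHS]/(_ * _).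
  by rewrite (frame_comb_coord _ l au) vcoef.unlock.
rewrite e1 e2 e3; ring.
Qed.

End MixedCurvature.

(** * Special Finsler spaces *)

Section ReducibleTrace.
Variables (R : realFieldType) (n : nat).
Variables (G : 'I_n -> 'I_n -> R) (y : 'I_n -> R).
Hypothesis GC : forall i j, G i j = G j i.
Hypothesis Gnondeg : forall c : 'I_n -> R,
  (forall l, \sum_i c i * G i l = 0) -> forall i, c i = 0.

(** With [G] the metric at a point and [y] the components of eta: [low] is y with its index lowered,
    [e] is L^2 and [h] is the angular metric hbar. *)
Let low i := \sum_j G i j * y j.
Let e := \sum_i y i * low i.
Hypothesis e_neq0 : e != 0.

Let h i j := G i j - e^-1 * (low i * low j).

(** Nondegeneracy says that the matrix of the metric has no left kernel, hence it is invertible. *)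
Lemma inverse_metric : exists K : 'I_n -> 'I_n -> R,
  (forall i k, \sum_l G i l * K l k = (i == k)%:R) /\
  (forall i k, \sum_l K i l * G l k = (i == k)%:R).
Proof.
pose g := \matrix_(i, j) G i j.
have ug : g \in unitmx.
  rewrite -row_free_unit -kermx_eq0; apply/eqP/row_matrixP => r; rewrite row0.
  have : row r (kermx g) *m g = 0 by rewrite -row_mul mulmx_ker row0.
  set c := row r _ => cg; apply/rowP => i; rewrite [RHS]mxE.
  apply: (Gnondeg (c := fun i => c 0 i)) => l.
  have := congr1 (fun A : 'rV[R]_n => A 0 l) cg; rewrite !mxE => cg'.
  by rewrite -[RHS]cg'; apply: eq_bigr => k _; rewrite [g _ _]mxE.
exists (fun i j => invmx g i j); split=> i k.
  have := congr1 (fun A : 'M[R]_n => A i k) (mulmxV ug); rewrite !mxE => E.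
  by rewrite -[RHS]E; apply: eq_bigr => l _; rewrite [g _ _]mxE.
have := congr1 (fun A : 'M[R]_n => A i k) (mulVmx ug); rewrite !mxE => E.
by rewrite -[RHS]E; apply: eq_bigr => l _; rewrite [g _ _]mxE.
Qed.

Let low_sum i : low i = \sum_j y j * G j i.
Proof. by apply: eq_bigr => j _; rewrite GC mulrC. Qed.

Section Inverse.
Variable K : 'I_n -> 'I_n -> R.
Hypothesis GK : forall i k, \sum_l G i l * K l k = (i == k)%:R.
Hypothesis KG : forall i k, \sum_l K i l * G l k = (i == k)%:R.

Let delta_sum (t : 'I_n -> R) i : \sum_j t j * (j == i)%:R = t i.
Proof.
rewrite (bigD1 i) //= eqxx mulr1 big1 ?addr0 // => j ji.
by rewrite (negPf ji) mulr0.
Qed.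

Let lowK m : \sum_k low k * K k m = y m.
Proof.
under eq_bigr => k _ do rewrite low_sum mulr_suml.
rewrite exchange_big /= -[RHS](delta_sum y); apply: eq_bigr => j _.
by rewrite -GK mulr_sumr; apply: eq_bigr => k _; rewrite mulrA.
Qed.

Let Klow k : \sum_m K k m * low m = y k.
Proof.
under eq_bigr => m _ do rewrite /low mulr_sumr.
rewrite exchange_big /= -[RHS](delta_sum y); apply: eq_bigr => j _.
rewrite eq_sym -KG mulr_sumr; apply: eq_bigr => m _.
by rewrite mulrA mulrC.
Qed.

Let hK j m : \sum_k h j k * K k m = (j == m)%:R - e^-1 * (low j * y m).
Proof.
under eq_bigr => k _ do rewrite mulrBl.
rewrite sumrB GK -(lowK m); congr (_ - _); rewrite !mulr_sumr.
by apply: eq_bigr => k _; rewrite !mulrA.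
Qed.

Let Kh j k : \sum_m K k m * h j m = (k == j)%:R - e^-1 * (low j * y k).
Proof.
under eq_bigr => m _ do rewrite /h GC mulrBr.
rewrite sumrB KG -(Klow k); congr (_ - _); rewrite !mulr_sumr.
by apply: eq_bigr => m _; rewrite mulrCA [X in e^-1 * X]mulrCA.
Qed.

(** With an index raised, hbar is the identity minus the projection onto the line of y, which has
    trace 1. *)
Let trace_h : \sum_m \sum_k h m k * K k m = n%:R - 1.
Proof.
under eq_bigr => m _ do rewrite hK eqxx.
rewrite sumrB sumr_const card_ord -mulr_sumr; congr (_ - _).
rewrite (_ : \sum_i low i * y i = e) ?mulVf //.
by apply: eq_bigr => i _; rewrite mulrC.
Qed.

(** The trace of hbar contributes (n - 1) d_j. The other two terms contribute d_j each, because the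
    raised hbar is the identity up to a multiple of y, which [d] annihilates. *)
Let trace_reducible (d : 'I_n -> R) j : \sum_i d i * y i = 0 ->
  \sum_m \sum_k (d j * h m k + d m * h j k + d k * h j m) * K k m = n.+1%:R * d j.
Proof.
move=> dy.
transitivity (d j * (\sum_m \sum_k h m k * K k m) + \sum_m d m * (\sum_k h j k * K k m)
   + \sum_k d k * (\sum_m K k m * h j m)).
  rewrite [X in _ + X](_ : _ = \sum_m \sum_k d k * (K k m * h j m)); last first.
    by rewrite exchange_big; apply: eq_bigr => k _ /=; rewrite mulr_sumr.
  rewrite mulr_sumr -!big_split; apply: eq_bigr => m _ /=.
  rewrite !mulr_sumr -!big_split; apply: eq_bigr => k _ /=; ring.
have dd (t : 'I_n -> R) : (forall m, t m = (m == j)%:R - e^-1 * (low j * y m)) ->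
    \sum_m d m * t m = d j.
  move=> tE; under eq_bigr => m _ do rewrite tE mulrBr.
  rewrite sumrB delta_sum (_ : \sum_i _ = (e^-1 * low j) * \sum_i d i * y i).
    by rewrite dy mulr0 subr0.
  rewrite mulr_sumr; apply: eq_bigr => i _; ring.
rewrite (dd (fun m => \sum_k h j k * K k m)) => [|m]; last by rewrite hK eq_sym.
rewrite (dd (fun k => \sum_m K k m * h j m)) => [|m]; last by rewrite Kh.
rewrite trace_h -[n.+1]addn1 natrD; ring.
Qed.

Lemma trace_lower (Q r : 'I_n -> 'I_n -> R) :
  (forall m k, \sum_l Q m l * G l k = r m k) -> \sum_m Q m m = \sum_m \sum_k r m k * K k m.
Proof.
move=> QG; apply: eq_bigr => m _.
under eq_bigr => k _ do rewrite -QG mulr_suml.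
rewrite exchange_big /= -[LHS](delta_sum (Q m)); apply: eq_bigr => l _.
by rewrite -GK mulr_sumr; apply: eq_bigr => k _; rewrite mulrA.
Qed.

Lemma reducible_trace_inverse (Q : 'I_n -> 'I_n -> R) (d : 'I_n -> R) j :
  \sum_i d i * y i = 0 ->
  (forall m k, \sum_l Q m l * G l k = d j * h m k + d m * h j k + d k * h j m) ->
  \sum_m Q m m = n.+1%:R * d j.
Proof. by move=> dy /trace_lower ->; exact: trace_reducible. Qed.

Lemma angular_metric_neq0 (c : R) : (forall j k, c * h j k = 0) -> c * (n%:R - 1) = 0.
Proof.
move=> ch; rewrite -trace_h mulr_sumr big1 // => m _.
by rewrite mulr_sumr big1 // => k _; rewrite mulrA ch mul0r.
Qed.

End Inverse.

Lemma reducible_trace (Q : 'I_n -> 'I_n -> R) (d : 'I_n -> R) j :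
  \sum_i d i * y i = 0 ->
  (forall m k, \sum_l Q m l * G l k = d j * h m k + d m * h j k + d k * h j m) ->
  \sum_m Q m m = n.+1%:R * d j.
Proof. by have [K [GK KG]] := inverse_metric; exact: reducible_trace_inverse GK KG Q d j. Qed.

(** The trace of c hbar is c (n - 1), so hbar does not vanish from dimension 2 on. *)
Lemma angular_metric_eq0 (c : R) : (1 < n)%N -> (forall j k, c * h j k = 0) -> c = 0.
Proof.
have [K [GK KG]] := inverse_metric => n1 /(angular_metric_neq0 GK)/eqP.
rewrite mulf_eq0 => /orP [/eqP //|]; rewrite subr_eq0 -[1]/(1%:R) eqr_nat => /eqP n0.
by rewrite n0 in n1.
Qed.

End ReducibleTrace.

(** * Torsion, its trace and the angular metric in a chart *)

Section Reduction.
Variables (R : realType) (n : nat) (M : manifold R n) (L : finsler M) (D : linear_connection M).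
Hypothesis hD : is_cartan L D.
Notation ChM := (mcharts M).
Notation ChT := (slit_charts M).
Implicit Types (W : set (TM M)) (X Y : pifield M) (f : TM M -> R).

Let gM := good_manifold M.
Let gT := good_slit M.

Let reg : regular D. Proof. by have [] := hD. Qed.

Lemma landsberg_general : landsberg D -> general_landsberg D.
Proof.
move=> land W X u oW pX Wu; rewrite /trace big1 // => i _.
have [sW _] := oW; have su := sW _ Wu.
have au : cdom (c := ChT) (chart_at u.1) u by split=> //; rewrite /chart_at; case: cid.
have oW' := slit_openI oW (slit_open_dom (chart_at u.1)).
rewrite (land _ _ _ u oW' (pifield_domain pX)) //.
by apply: (@is_pifieldS _ _ _ (cdom (c := ChT) (chart_at u.1))); [move=> v []|exact: frame_pifield].
Qed.

Section Chart.
Variable a : cidx ChM.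
Notation Dom := (cdom (c := ChT) a).
Notation pt u := (cfwd (c := ChT) a u).
Local Notation B := (vcoef D a).
Local Notation G := (gcoef L a).
Local Notation N := (ncoef D a).
Local Notation Eh := (energy_hat L a).
Local Notation S u := (betaF D (@eta R n M) u).
Local Notation yc u j := (u.2 (coord a j)).

Lemma Phat_frame j m i u : Dom u ->
  Phat D (frame a j) (frame a m) u (coord a i) = pcoef D a j m i u.
Proof.
move=> au.
rewrite (Phat_chart hD (slit_open_dom a) (frame_pifield j) (frame_pifield m) au au).
rewrite (frame_comb_coord _ i au) (bigD1 j) //= [X in _ + X]big1 ?addr0 => [|q qj]; last first.
  rewrite big1 // => r _.
  by rewrite (frame_coord j q au) eq_sym (negPf qj) mul0r mul0r.
rewrite (frame_coord j j au) eqxx (bigD1 m) //= [X in _ + X]big1 ?addr0 => [|q qm]; last first.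
  by rewrite (frame_coord m q au) eq_sym (negPf qm) mulr0 mul0r.
by rewrite (frame_coord m m au) eqxx !mul1r.
Qed.

Lemma pcoef_landsberg W X Y u : slit_open W -> is_pifield W X -> is_pifield W Y -> W u ->
  Dom u -> (forall j m i, pcoef D a j m i u = 0) -> Phat D X Y u = 0.
Proof.
move=> oW pX pY Wu au p0; rewrite (Phat_chart hD oW pX pY Wu au) big1 // => i _.
rewrite big1 ?scale0r // => j _; rewrite big1 // => m _.
by rewrite p0 mulr0.
Qed.

Definition tcoef m j l (u : TM M) : R := \sum_r B m j r u * G r l u.

Lemma tcoefE m j l u : Dom u -> tcoef m j l u = cartan Eh m j l (pt u).
Proof. exact: vcoef_lower. Qed.

Lemma tcoefCr m j l u : Dom u -> tcoef m j l u = tcoef m l j u.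
Proof. by move=> au; rewrite (tcoefE m j l au) (tcoefE m l j au) (cartanCr (energy_smooth L au)). Qed.

Lemma tcoefCl m j l u : Dom u -> tcoef m j l u = tcoef j m l u.
Proof. by move=> au; rewrite (tcoefE m j l au) (tcoefE j m l au) (cartanCl (energy_smooth L au)). Qed.

Lemma vcoef_sym m j l u : Dom u -> B m j l u = B j m l u.
Proof.
move=> au; apply/eqP; rewrite -subr_eq0; apply/eqP.
apply: (@g_nondeg _ _ _ L a u (fun l => B m j l u - B j m l u) au) => k.
under eq_bigr => i _ do rewrite mulrBl.
by rewrite sumrB -[X in X - _]/(tcoef m j k u) (tcoefCl _ _ _ au) subrr.
Qed.

Lemma tcoef_y m j u : Dom u -> \sum_l yc u l * tcoef m j l u = 0.
Proof.
move=> au; rewrite -[RHS](cartan_y (energy_smooth L au) (energy_euler_near L au) m j).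
by apply: eq_bigr => l _; rewrite (tcoefE m j l au) fibre_pt.
Qed.

Lemma tcoef_smooth m j l u : Dom u -> smooth_at ChT u (tcoef m j l).
Proof.
move=> au; apply: (@smooth_at_sum _ _ _ _ u n (fun r v => B m j r v * G r l v)) => r.
by apply: smooth_at_mul; [exact: vcoef_smooth|exact: gcoef_smooth].
Qed.

Lemma T3_frame m j l u : Dom u -> T3 L D (frame a m) (frame a j) (frame a l) u = tcoef m j l u.
Proof.
move=> au; rewrite /T3 (Ttor_frame reg m j au) (g_frame L l au (frame_comb_tangent _ au)).
by apply: eq_bigr => r _; rewrite (frame_comb_coord _ r au).
Qed.

(** The contraction runs over the first index, which by [pcoef_bcoef] is the one traced in Phat;
    [Cform] contracts the second, and [vcoef_sym] identifies the two. *)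
Definition ctrace j (u : TM M) : R := \sum_m B m j m u.

Lemma ctrace_smooth j u : Dom u -> smooth_at ChT u (ctrace j).
Proof.
move=> au; apply: (@smooth_at_sum _ _ _ _ u n (fun m v => B m j m v)) => m.
exact: vcoef_smooth.
Qed.

(** The two N-terms that involve the contracted indices cancel after renaming, and nabla_0 C is
    left. *)
Lemma bcoef_trace j u : Dom u -> \sum_m bcoef D a m j m u =
  S u (ctrace j) - \sum_r N j r u * ctrace r u.
Proof.
move=> au; rewrite /bcoef big_split 2!sumrB /=.
have sB m : smooth_at ChT u (B m j m) by exact: vcoef_smooth.
rewrite -[X in S u X]/(fun v => \sum_m B m j m v) (tangent_sum (beta_eta_tangent hD au) sB).
rewrite [X in _ - _ - X + _](_ : _ = \sum_r N j r u * ctrace r u); last first.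
  by rewrite exchange_big; apply: eq_bigr => r _ /=; rewrite mulr_sumr.
rewrite [X in _ - _ - _ + X](_ : _ = \sum_m \sum_r N m r u * B r j m u); first by ring.
by rewrite exchange_big.
Qed.

Definition nabla_tcoef m j l (u : TM M) : R := S u (tcoef m j l)
  - \sum_r N m r u * tcoef r j l u - \sum_r N j r u * tcoef m r l u
  - \sum_r N l r u * tcoef m j r u.

(** The horizontal derivatives of [bcoef_lower] are reassembled into the derivative of T_mjl along
    beta(eta), with F contracted to N. *)
Lemma bcoef_nabla_tcoef m j l u : Dom u ->
  \sum_i bcoef D a m j i u * G i l u = nabla_tcoef m j l u.
Proof.
move=> au.
have cs q (t : 'I_n -> R) : \sum_k yc u k * \sum_r fcoef D a k q r u * t r = \sum_r N q r u * t r.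
  under eq_bigr => k _ do rewrite mulr_sumr.
  rewrite exchange_big; apply: eq_bigr => r _ /=.
  by rewrite -(fcoef_y hD q r au) mulr_suml; apply: eq_bigr => k _; rewrite mulrA.
rewrite (bcoef_lower hD m j l au).
under [LHS]eq_bigr => k _ do rewrite 3!mulrBr.
rewrite 3!sumrB (cs m (fun r => cartan Eh r j l (pt u))) (cs j (fun r => cartan Eh m r l (pt u))).
rewrite (cs l (fun r => cartan Eh m r j (pt u))) (beta_eta_cartan hD m j l au).
have tb := beta_eta_tangent hD au.
have sB r : smooth_at ChT u (B m j r) by exact: vcoef_smooth.
have sG r : smooth_at ChT u (G r l) by exact: gcoef_smooth.
have sBG r : smooth_at ChT u (fun v => B m j r v * G r l v) by exact: smooth_at_mul.
rewrite /nabla_tcoef; congr (_ - _ - _ - _).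
- rewrite -[X in S u X]/(fun v => \sum_r B m j r v * G r l v) (tangent_sum tb sBG).
  apply: eq_bigr => r _; rewrite (tangent_mul gT tb (sB r) (sG r)) [RHS]addrC.
  by congr (_ + _); exact: mulrC.
- by apply: eq_bigr => r _; rewrite (tcoefE r j l au).
- by apply: eq_bigr => r _; rewrite (tcoefE m r l au).
- by apply: eq_bigr => r _; rewrite (tcoefE m j r au) (cartanCr (energy_smooth L au)).
Qed.

Lemma nabla_tcoef_pcoef u : Dom u -> (forall m j l, nabla_tcoef m j l u = 0) ->
  forall j m i, pcoef D a j m i u = 0.
Proof.
move=> au h j m; apply: (@g_nondeg _ _ _ L a u (fun i => pcoef D a j m i u) au) => l.
under eq_bigr => i _ do rewrite (pcoef_bcoef hD j m i au).
by rewrite (bcoef_nabla_tcoef m j l au) h.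
Qed.

Lemma pcoef_trace j u : Dom u -> \sum_m pcoef D a j m m u =
  S u (ctrace j) - \sum_r N j r u * ctrace r u.
Proof.
by move=> au; rewrite -(bcoef_trace j au); apply: eq_bigr => m _; rewrite (pcoef_bcoef hD j m m au).
Qed.

(* The trace of [nabla_0 T = mu T] is [mu C], so that [mu = 0]. *)
Lemma proportional_pcoef (mu : R) u : Dom u ->
  (forall m j l, bcoef D a m j l u = mu * B m j l u) ->
  (forall j, \sum_m pcoef D a j m m u = 0) -> (exists j, ctrace j u != 0) ->
  forall j m i, pcoef D a j m i u = 0.
Proof.
move=> au h p0 [q cq] j m i; rewrite (pcoef_bcoef hD j m i au) h.
suff -> : mu = 0 by rewrite mul0r.
apply: (mulIf cq); rewrite mul0r -[RHS](p0 q) /ctrace mulr_sumr.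
by apply: eq_bigr => r _; rewrite (pcoef_bcoef hD q r r au) h.
Qed.

Definition yl m (u : TM M) : R := \sum_j G m j u * yc u j.

(** Euler's relation is used twice: y_i is half of dL^2/dy^i, and a further contraction with y^i
    gives L^2. *)
Lemma energy_yl u : Dom u -> \sum_i yc u i * yl i u = energy L u.
Proof.
move=> au.
have e i : yl i u = 2^-1 * partial (rshift n i) Eh (pt u).
  rewrite -(euler1 (energy_smooth L au) (energy_euler_near L au) i).
  by apply: eq_bigr => j _; rewrite fibre_pt mulrC (gcoef_hess L i j au).
transitivity (2^-1 * (2 * energy L u)); last by rewrite mulrA mulVf ?mul1r // pnatr_eq0.
rewrite -(energy_euler L au) mulr_sumr; apply: eq_bigr => i _.
by rewrite e mulrCA.
Qed.

Lemma g_eta u i : Dom u -> g L u (frame a i u) (@eta R n M u) = yl i u.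
Proof.
move=> au; have [[tu _] _] := au.
rewrite (g_sym L au (frame_tangent i au) tu) (g_frame L i au tu).
by apply: eq_bigr => k _; rewrite mulrC (gcoef_sym L k i au).
Qed.

(** L^2 is g(eta, eta), so positivity of [g] makes it nonzero; the inverse of L^2 in hbar relies on
    this. *)
Lemma energy_gt0 u : Dom u -> 0 < energy L u.
Proof.
move=> au; have [[tu u0] _] := au; have := g_posdef L au tu u0.
rewrite (g_expand L au tu tu) -(energy_yl au); congr (0 < _).
by apply: eq_bigr => i _; rewrite /yl mulr_sumr; apply: eq_bigr => j _; rewrite -mulrA [X in _ * X]mulrC.
Qed.

Lemma hbar_frame i j u : Dom u -> hbar L u (frame a i u) (frame a j u) =
  G i j u - (energy L u)^-1 * (yl i u * yl j u).
Proof.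
move=> au; rewrite /hbar /ell !(g_eta _ au) gcoef.unlock /energy expr2 invfM.
ring.
Qed.

Lemma beta_eta_coord j u : Dom u -> S u (fun v => yc v j) = - \sum_h yc u h * N h j u.
Proof.
move=> au; rewrite -coord_rshift.
exact: (beta_rshift hD j (slit_open_dom a) (@eta_pifield _ _ _ a) au au).
Qed.

Lemma yl_smooth m u : Dom u -> smooth_at ChT u (yl m).
Proof.
move=> au; apply: (@smooth_at_sum _ _ _ _ u n (fun j v => G m j v * yc v j)) => j.
by apply: smooth_at_mul; [exact: gcoef_smooth|exact: coord_smooth].
Qed.

(** This is nabla_0 y_m = 0: the terms coming from the derivative of y^j cancel half of those coming
    from the derivative of g_mj. *)
Lemma beta_eta_yl m u : Dom u -> S u (yl m) = \sum_r N m r u * yl r u.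
Proof.
move=> au; have tb := beta_eta_tangent hD au.
have sG j : smooth_at ChT u (G m j) by exact: gcoef_smooth.
have sy j : smooth_at ChT u (fun v => yc v j) by exact: coord_smooth.
have sGy j : smooth_at ChT u (fun v => G m j v * yc v j) by exact: smooth_at_mul.
rewrite -[X in S u X]/(fun v => \sum_j G m j v * yc v j) (tangent_sum tb sGy).
under eq_bigr => j _ do rewrite (tangent_mul gT tb (sG j) (sy j)) (beta_eta_coord j au)
  (beta_eta_gcoef hD m j au) mulrDr.
rewrite big_split big_split /= addrCA [X in _ + X](_ : _ = 0) ?addr0.
  under eq_bigr => j _ do rewrite mulr_sumr.
  rewrite exchange_big; apply: eq_bigr => r _ /=; rewrite /yl mulr_sumr.
  by apply: eq_bigr => j _; rewrite mulrCA; congr (_ * _); rewrite mulrC.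
under eq_bigr => j _ do rewrite mulrN mulr_sumr.
rewrite sumrN exchange_big /=.
apply/eqP; rewrite addrC subr_eq0; apply/eqP; apply: eq_bigr => h _.
rewrite mulr_sumr; apply: eq_bigr => r _.
by rewrite (gcoef_sym L r m au) mulrA mulrC.
Qed.

Lemma energy_smooth_at u : Dom u -> smooth_at ChT u (energy L).
Proof. by move=> au; apply: (smooth_at_chart gT au); exact: energy_smooth. Qed.

(** L^2 = y^i y_i, where both y^i and y_i are parallel along beta(eta). *)
Lemma beta_eta_energy u : Dom u -> S u (energy L) = 0.
Proof.
move=> au; have tb := beta_eta_tangent hD au.
have sy j : smooth_at ChT u (fun v => yc v j) by exact: coord_smooth.
have sl j := yl_smooth j au.
have sp j : smooth_at ChT u (fun v => yc v j * yl j v) by exact: smooth_at_mul.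
rewrite -(tangent_germ tb (proj2 (slit_open_dom a)) au (fun v av => energy_yl av)).
rewrite (tangent_sum tb sp).
under eq_bigr => j _ do rewrite (tangent_mul gT tb (sy j) (sl j)) (beta_eta_coord j au) (beta_eta_yl j au).
rewrite big_split /=.
under [X in _ + X]eq_bigr => j _ do rewrite mulrN mulr_sumr.
under eq_bigr => j _ do rewrite mulr_sumr.
rewrite sumrN exchange_big /=; apply/eqP; rewrite subr_eq0; apply/eqP.
apply: eq_bigr => r _; apply: eq_bigr => j _; by rewrite mulrA mulrC.
Qed.

End Chart.
End Reduction.

(** * The four classes of Finsler spaces *)

HB.lock Definition angular (R : realType) (n : nat) (M : manifold R n) (L : finsler M)
  (a : cidx (mcharts M)) (i j : 'I_n) (u : TM M) : R := hbar L u (frame a i u) (frame a j u).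

(** The chart [a] supplies the argument only: the trace inside [Cform] is still taken in the frame
    of [chart_at u.1]. *)
HB.lock Definition ccoef (R : realType) (n : nat) (M : manifold R n) (D : linear_connection M)
  (a : cidx (mcharts M)) (k : 'I_n) (u : TM M) : R := Cform D (frame a k) u.

Section Cases.
Variables (R : realType) (n : nat) (M : manifold R n) (L : finsler M) (D : linear_connection M).
Hypothesis hD : is_cartan L D.
Notation ChM := (mcharts M).
Notation ChT := (slit_charts M).
Implicit Types (W : set (TM M)) (X Y : pifield M) (f : TM M -> R).

Let gM := good_manifold M.
Let gT := good_slit M.

Let reg : regular D. Proof. by have [] := hD. Qed.

Section Chart.
Variable a : cidx ChM.
Notation Dom := (cdom (c := ChT) a).
Local Notation B := (vcoef D a).
Local Notation G := (gcoef L a).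
Local Notation N := (ncoef D a).
Local Notation S u := (betaF D (@eta R n M) u).
Local Notation yc u j := (u.2 (coord a j)).
Local Notation t := (tcoef L D a).
Local Notation c := (ctrace D a).
Local Notation yl := (yl L a).
Local Notation E := (energy L).
Local Notation theta k u := (ccoef D a k u).
Local Notation h u i j := (angular L a i j u).

Lemma piform_y (delta : TM M -> functional R M -> R) u : Dom u -> is_piform1 delta ->
  delta u (@eta R n M u) = \sum_i yc u i * delta u (frame a i u).
Proof.
move=> au [lin _]; have [su _] := au; have [tu _] := su; have au1 := dom_fst au.
pose f (w : 'rV[R]_n) : R^o := delta u (tangent_vec a u.1 w).
have lf s v w : f (s *: v + w) = s *: f v + f w.
  by rewrite /f tangent_vecP // lin //; exact: tangent_vec_tangent.
have := row_linear_expand lf (\row_i yc u i).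
rewrite /f -(tangent_rep gM tu au1) => ->.
by apply: eq_bigr => i _; rewrite mxE.
Qed.

Lemma angularE i j u : Dom u -> h u i j = G i j u - (E u)^-1 * (yl i u * yl j u).
Proof. by move=> au; rewrite -(hbar_frame L i j au) angular.unlock. Qed.

Lemma hbarC i j u : Dom u -> h u i j = h u j i.
Proof.
by move=> au; rewrite !(angularE _ _ au) (gcoef_sym L i j au) [yl i u * _]mulrC.
Qed.

(** The contraction y^m y_m = L^2 compensates the factor 1 / L^2 in hbar. *)
Lemma hbar_y j u : Dom u -> \sum_m yc u m * h u m j = 0.
Proof.
move=> au; under eq_bigr => m _ do rewrite (angularE m j au) mulrBr.
rewrite sumrB [X in _ - X](_ : _ = E u * (E u)^-1 * yl j u); last first.
  rewrite -[X in X * _ * _](energy_yl L au) !mulr_suml; apply: eq_bigr => m _; ring.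
rewrite divff ?mul1r; last by rewrite gt_eqF // (energy_gt0 L au).
apply/eqP; rewrite subr_eq0; apply/eqP; apply: eq_bigr => m _.
by rewrite mulrC (gcoef_sym L m j au).
Qed.

Let e_neq0 u : Dom u -> \sum_i yc u i * (\sum_j G i j u * yc u j) != 0.
Proof. by move=> au; rewrite (energy_yl L au) gt_eqF // (energy_gt0 L au). Qed.

Lemma reducible_trace_hbar u (Q : 'I_n -> 'I_n -> R) (d : 'I_n -> R) j : Dom u ->
  \sum_i d i * yc u i = 0 ->
  (forall m k, \sum_l Q m l * G l k u = d j * h u m k + d m * h u j k + d k * h u j m) ->
  \sum_m Q m m = n.+1%:R * d j.
Proof.
move=> au dy hQ.
apply: (@reducible_trace R n (fun i j => G i j u) (fun i => yc u i)
  (fun i j => gcoef_sym L i j au) (fun c => @g_nondeg _ _ _ L a u c au) (e_neq0 au) Q d j dy).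
by move=> m k; rewrite hQ !(angularE _ _ au) -(energy_yl L au).
Qed.

Lemma hbar_eq0 u (s : R) : Dom u -> (1 < n)%N -> (forall j k, s * h u j k = 0) -> s = 0.
Proof.
move=> au n1 hs.
apply: (@angular_metric_eq0 R n (fun i j => G i j u) (fun i => yc u i)
  (fun i j => gcoef_sym L i j au) (fun c => @g_nondeg _ _ _ L a u c au) (e_neq0 au) s n1).
by move=> j k; have := hs j k; rewrite (angularE _ _ au) -(energy_yl L au).
Qed.

Lemma P_reducible_pcoef u : Dom u -> P_reducible L D ->
  (forall j, \sum_m pcoef D a j m m u = 0) -> forall j m i, pcoef D a j m i u = 0.
Proof.
move=> au [_ [delta [pd d0 red]]] tr.
have oD := slit_open_dom a; have pf q := frame_pifield (a := a) q.
have [d dE] : exists d, d = fun i => delta u (frame a i u) by eexists.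
have dy : \sum_i d i * yc u i = 0.
  have [su _] := au; rewrite -[RHS](d0 u su) (piform_y au pd).
  by apply: eq_bigr => i _; rewrite dE mulrC.
have hQ j m k : \sum_l pcoef D a j m l u * G l k u = d j * h u m k + d m * h u j k + d k * h u j m.
  rewrite (hbarC j k au) dE angular.unlock.
  apply: (etrans _ (red _ _ _ _ _ oD (pf j) (pf m) (pf k) au)).
  have tP : tangent ChM u.1 (Phat D (frame a j) (frame a m) u).
    rewrite (Phat_chart hD oD (pf j) (pf m) au au); exact: frame_comb_tangent.
  rewrite (g_frame L k au tP); apply: eq_bigr => l _.
  by rewrite (Phat_frame hD j m l au).
have dj j : d j = 0.
  have := reducible_trace_hbar au dy (hQ j); rewrite tr => /esym/eqP.
  by rewrite mulf_eq0 pnatr_eq0 => /eqP.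
move=> j m; apply: (@g_nondeg _ _ _ L a u (fun i => pcoef D a j m i u) au) => k.
by apply: (etrans (hQ j m k)); rewrite !dj !mul0r !addr0.
Qed.

Lemma C_reducible_tcoef m j k v : Dom v -> C_reducible L D -> t m j k v =
  (n.+1%:R)^-1 * (h v m j * theta k v + h v j k * theta m v + h v k m * theta j v).
Proof.
move=> av [_ red]; rewrite angular.unlock ccoef.unlock -(T3_frame hD m j k av).
exact: (red _ _ _ _ _ (slit_open_dom a) (frame_pifield m) (frame_pifield j) (frame_pifield k) av).
Qed.

(** [theta] is a trace in the frame of [chart_at v.1], [c] one in the chart [a]. Tracing the
    defining identity in the chart [a] turns its right-hand side into (n + 1) theta / (n + 1),
    provided that theta(eta) = 0. *)
Lemma C_reducible_ctrace v j : Dom v -> C_reducible L D -> theta j v = c j v.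
Proof.
move=> av Cred; have n1 : (1 < n)%N by have [n3 _] := Cred; exact: ltn_trans n3.
have tE m j' k := C_reducible_tcoef m j' k av Cred.
have nn0 : n.+1%:R != 0 :> R by rewrite pnatr_eq0.
(* In the contraction of the identity with y^m the torsion and two of the three terms vanish;
   hbar_jk theta(eta) = 0 is left, and hbar is not 0. *)
have ty : \sum_i yc v i * theta i v = 0.
  apply: (hbar_eq0 av n1) => j' k.
  have ht : \sum_m yc v m * t m j' k v = 0.
    rewrite -[RHS](tcoef_y hD j' k av); apply: eq_bigr => m _.
    by rewrite (tcoefCl hD m j' k av) (tcoefCr hD j' m k av).
  apply: (mulfI (invr_neq0 nn0)); rewrite mulr0 -[RHS]ht.
  transitivity ((n.+1%:R)^-1 * ((\sum_m yc v m * h v m j') * theta k v +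
     h v j' k * (\sum_m yc v m * theta m v) + (\sum_m yc v m * h v m k) * theta j' v)).
    by rewrite !(hbar_y _ av) !mul0r add0r addr0 [X in _ = _ * X]mulrC.
  rewrite !mulr_suml !mulr_sumr -!big_split mulr_sumr; apply: eq_bigr => m _ /=.
  by rewrite tE (hbarC k m av); ring.
pose d i := (n.+1%:R)^-1 * theta i v.
have dy : \sum_i d i * yc v i = 0.
  transitivity ((n.+1%:R)^-1 * \sum_i yc v i * theta i v); last by rewrite ty mulr0.
  rewrite mulr_sumr; apply: eq_bigr => i _.
  by rewrite /d -mulrA [X in _ * X]mulrC.
have hQ m k : \sum_l B m j l v * G l k v = d j * h v m k + d m * h v j k + d k * h v j m.
  rewrite -[LHS]/(t m j k v) tE (hbarC k m av) (hbarC j m av) /d; ring.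
by have := reducible_trace_hbar av dy hQ; rewrite /d mulrA divff // mul1r => <-.
Qed.

Lemma C_reducible_pcoef u : Dom u -> C_reducible L D ->
  (forall j, \sum_m pcoef D a j m m u = 0) -> forall j m i, pcoef D a j m i u = 0.
Proof.
move=> au Cred tr; apply: (nabla_tcoef_pcoef hD au) => m j k.
have oD := slit_open_dom a; have tb := beta_eta_tangent hD au.
(* [H = L^2 hbar] is used instead of [hbar] so as to differentiate no inverse. *)
pose H i j v := E v * G i j v - yl i v * yl j v.
have Eneq0 v : Dom v -> E v != 0 by move=> av; rewrite gt_eqF // (energy_gt0 L av).
have nn0 : n.+1%:R != 0 :> R by rewrite pnatr_eq0.
have HC i j' v : Dom v -> H i j' v = H j' i v.
  by move=> av; rewrite /H (gcoef_sym L i j' av) [yl i v * _]mulrC.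
have Eh i j' v : Dom v -> E v * h v i j' = H i j' v.
  by move=> av; rewrite (angularE i j' av) mulrBr mulVKf ?Eneq0.
have tH m' j' k' v : Dom v -> E v * (n.+1%:R * t m' j' k' v) =
    H m' j' v * c k' v + H j' k' v * c m' v + H k' m' v * c j' v.
  move=> av; rewrite (C_reducible_tcoef m' j' k' av Cred) mulVKf //.
  rewrite !(C_reducible_ctrace _ av Cred) -!Eh //; ring.
have sE : smooth_at ChT u E := energy_smooth_at L au.
have sG i j' : smooth_at ChT u (G i j') := gcoef_smooth L i j' au.
have sl i : smooth_at ChT u (yl i) := yl_smooth L i au.
have sc i : smooth_at ChT u (c i) := ctrace_smooth D i au.
have st m' j' k' : smooth_at ChT u (t m' j' k') := tcoef_smooth L D m' j' k' au.
have sH i j' : smooth_at ChT u (H i j').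
  by apply: smooth_at_add; [|apply: smooth_at_opp]; exact: smooth_at_mul.
(* [b] and [A] are the N-terms of nabla_0 C and nabla_0 H: [Sc] and [SH] say that C and H are
   parallel along beta(eta). *)
pose b k' := \sum_r N k' r u * c r u.
pose A i j' := \sum_r N i r u * H r j' u.
have Sc i : S u (c i) = b i.
  by apply/eqP; rewrite -subr_eq0 -(pcoef_trace hD i au) tr.
have SH i j' : S u (H i j') = A i j' + A j' i.
  have e1 : S u (fun v => E v * G i j' v) = E u * S u (G i j').
    by rewrite (tangent_mul gT tb sE (sG i j')) (beta_eta_energy hD au) mulr0 addr0.
  have e2 : S u (fun v => - (yl i v * yl j' v)) =
      - (yl i u * \sum_r N j' r u * yl r u + yl j' u * \sum_r N i r u * yl r u).
    transitivity (S u (fun v => (-1) * (yl i v * yl j' v))).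
      by congr (S u _); apply/funext => v; rewrite mulN1r.
    rewrite (tangent_mul gT tb (@smooth_at_cst _ _ _ ChT u (-1)) (smooth_at_mul (sl i) (sl j'))).
    rewrite (tangent_cst _ tb) mulr0 addr0 mulN1r (tangent_mul gT tb (sl i) (sl j')).
    by rewrite !(beta_eta_yl hD _ au).
  rewrite (tangent_add tb (smooth_at_mul sE (sG i j')) (smooth_at_opp (smooth_at_mul (sl i) (sl j')))).
  rewrite e1 e2 (beta_eta_gcoef hD i j' au).
  have A_expand p q : A p q = E u * \sum_r N p r u * G r q u - yl q u * \sum_r N p r u * yl r u.
    rewrite /A /H !mulr_sumr -sumrB; apply: eq_bigr => r _; ring.
  rewrite !A_expand; ring.
have St : E u * (n.+1%:R * S u (t m j k)) =
    (A m j + A j m) * c k u + H m j u * b k + ((A j k + A k j) * c m u + H j k u * b m) +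
    ((A k m + A m k) * c j u + H k m u * b j).
  have sHc p q r := smooth_at_mul (sH p q) (sc r).
  have e1 : S u (fun v => E v * (n.+1%:R * t m j k v)) = E u * (n.+1%:R * S u (t m j k)).
    rewrite (tangent_mul gT tb sE (smooth_at_mul (@smooth_at_cst _ _ _ ChT u n.+1%:R) (st m j k))).
    rewrite (beta_eta_energy hD au) mulr0 addr0.
    rewrite (tangent_mul gT tb (@smooth_at_cst _ _ _ ChT u n.+1%:R) (st m j k)).
    by rewrite (tangent_cst _ tb) mulr0 addr0.
  rewrite -e1 (tangent_germ tb (proj2 oD) au (tH m j k)).
  rewrite (tangent_add tb (smooth_at_add (sHc m j k) (sHc j k m)) (sHc k m j)).
  rewrite (tangent_add tb (sHc m j k) (sHc j k m)).
  rewrite (tangent_mul gT tb (sH m j) (sc k)) (tangent_mul gT tb (sH j k) (sc m)).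
  rewrite (tangent_mul gT tb (sH k m) (sc j)) !SH !Sc; ring.
have sumN q (f p : 'I_n -> R) : (forall r, E u * (n.+1%:R * f r) = p r) ->
    E u * (n.+1%:R * \sum_r N q r u * f r) = \sum_r N q r u * p r.
  by move=> fp; rewrite !mulr_sumr; apply: eq_bigr => r _; rewrite -fp; ring.
(* The N-terms of nabla_0 T are expanded with the same identity; [s1], [s2] and [s3] add up to the
   right-hand side of [St]. *)
have s1 : E u * (n.+1%:R * \sum_r N m r u * t r j k u) =
    A m j * c k u + H j k u * b m + A m k * c j u.
  rewrite (sumN m _ _ (fun r => tH r j k u au)) /A /b !mulr_suml mulr_sumr -!big_split.
  by apply: eq_bigr => r _ /=; rewrite (HC k r u au); ring.
have s2 : E u * (n.+1%:R * \sum_r N j r u * t m r k u) =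
    A j m * c k u + A j k * c m u + H k m u * b j.
  rewrite (sumN j _ _ (fun r => tH m r k u au)) /A /b !mulr_suml mulr_sumr -!big_split.
  by apply: eq_bigr => r _ /=; rewrite (HC m r u au); ring.
have s3 : E u * (n.+1%:R * \sum_r N k r u * t m j r u) =
    H m j u * b k + A k j * c m u + A k m * c j u.
  rewrite (sumN k _ _ (fun r => tH m j r u au)) /A /b !mulr_suml mulr_sumr -!big_split.
  by apply: eq_bigr => r _ /=; rewrite (HC j r u au); ring.
apply: (mulfI nn0); apply: (mulfI (Eneq0 _ au)).
rewrite /nabla_tcoef !mulrBr St s1 s2 s3; ring.
Qed.

(** If no vector represented [Cform] at [v], then [sharp] would be its default 0 and C^2 would be
    g(0, 0) = 0. So C^2 <> 0 provides the vector Cbar, with components [w]. *)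
Lemma Csq_neq0 v : Dom v -> Csq L D v <> 0 -> exists w : 'I_n -> R,
  (forall k, \sum_l w l * G l k v = theta k v) /\ Csq L D v = \sum_l w l * theta l v.
Proof.
move=> av; rewrite /Csq /ghat; set s := sharp _ _ _ => Cs0.
have [e|ne] := pselect (exists w, tangent ChM v.1 w /\
    forall W X, slit_open W -> is_pifield W X -> W v -> g L v w (X v) = Cform D X v); last first.
  exfalso; apply: Cs0.
  rewrite /s /sharp xgetPN ?(g0 L av) // => w Pw; apply: ne; exists w; exact: Pw.
have [ts hs] : tangent ChM v.1 s /\
    forall W X, slit_open W -> is_pifield W X -> W v -> g L v s (X v) = Cform D X v.
  have [w Pw] := e; rewrite /s /sharp.
  exact: (@xgetPex _ 0 [set w | tangent ChM v.1 w /\ forall W X, slit_open W -> is_pifield W X ->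
     W v -> g L v w (X v) = Cform D X v] (ex_intro _ w Pw)).
have sG k : \sum_l s (coord a l) * G l k v = theta k v.
  rewrite -(g_frame L k av ts) ccoef.unlock; exact: hs (slit_open_dom a) (frame_pifield k) av.
exists (fun l => s (coord a l)); split=> //.
rewrite (g_expand L av ts ts) exchange_big; apply: eq_bigr => j _ /=.
by rewrite -sG mulr_sumr; apply: eq_bigr => i _; rewrite [X in X * _]mulrC mulrA.
Qed.

Lemma C2_like_tcoef m j k v : Dom v -> C2_like L D ->
  t m j k v = (Csq L D v)^-1 * (theta m v * theta j v * theta k v).
Proof.
move=> av [_ _ red]; rewrite ccoef.unlock -(T3_frame hD m j k av).
exact: (red _ _ _ _ _ (slit_open_dom a) (frame_pifield m) (frame_pifield j) (frame_pifield k) av).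
Qed.

(** Again the defining identity is traced in the chart [a]: with an index raised it reads T^l_mj =
    C_m C_j C^l / C^2, and C_m C^m = C^2. *)
Lemma C2_like_ctrace v j : Dom v -> C2_like L D -> theta j v = c j v.
Proof.
move=> av C2; have [_ Cs0 _] := C2; have [sv _] := av.
have [w [wG Cw]] := Csq_neq0 av (Cs0 _ sv).
have BE m l : B m j l v - (Csq L D v)^-1 * theta m v * theta j v * w l = 0.
  apply: (@g_nondeg _ _ _ L a v (fun l => B m j l v - (Csq L D v)^-1 * theta m v * theta j v * w l) av).
  move=> k; under eq_bigr => i _ do rewrite mulrBl -[X in _ - X]mulrA.
  rewrite sumrB -mulr_sumr wG -[X in X - _]/(t m j k v) (C2_like_tcoef m j k av C2); ring.
rewrite /ctrace (eq_bigr (fun m => ((Csq L D v)^-1 * theta j v) * (w m * theta m v))); last first.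
  move=> m _; have /eqP := BE m m; rewrite subr_eq0 => /eqP ->; ring.
rewrite -mulr_sumr -Cw mulrAC mulVf ?mul1r //; exact/eqP/(Cs0 _ sv).
Qed.

Lemma C2_like_pcoef u : Dom u -> C2_like L D ->
  (forall j, \sum_m pcoef D a j m m u = 0) -> forall j m i, pcoef D a j m i u = 0.
Proof.
move=> au C2 tr; have [_ Cs0 _] := C2; have oD := slit_open_dom a.
have tb := beta_eta_tangent hD au.
have tE m j k v : Dom v -> t m j k v = (Csq L D v)^-1 * (c m v * c j v * c k v).
  by move=> av; rewrite (C2_like_tcoef m j k av C2) !(C2_like_ctrace _ av C2).
have [p cp] : exists p, c p u != 0.
  have [su _] := au; have [w [_ Cw]] := Csq_neq0 au (Cs0 _ su).
  apply/existsP; apply: contra_notT (Cs0 _ su); rewrite negb_exists => /forallP c0.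
  rewrite Cw big1 // => l _; rewrite (C2_like_ctrace l au C2).
  by have := c0 l; rewrite negbK => /eqP ->; rewrite mulr0.
(* [mu] stands for C^2 times the derivative of 1 / C^2 along beta(eta). It is read off from T_ppp =
   c_p^3 / C^2 and the derivative N^r_p c_r of c_p, so that only [tcoef] and [ctrace] are
   differentiated. *)
apply: (proportional_pcoef hD au _ tr (ex_intro _ p cp)
  (mu := (S u (t p p p) * Csq L D u - 3 * c p u ^+ 2 * \sum_r N p r u * c r u) / c p u ^+ 3)).
set mu := _ / _ => m j l; apply/eqP; rewrite -subr_eq0; apply/eqP.
apply: (@g_nondeg _ _ _ L a u (fun l => bcoef D a m j l u - mu * B m j l u) au) => k.
under eq_bigr => i _ do rewrite mulrBl -mulrA.
rewrite sumrB -mulr_sumr -[\sum_i B _ _ _ _ * _]/(t m j k u) (bcoef_nabla_tcoef hD m j k au).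
have sc i : smooth_at ChT u (c i) := ctrace_smooth D i au.
have st m' j' k' : smooth_at ChT u (t m' j' k') := tcoef_smooth L D m' j' k' au.
pose b k' := \sum_r N k' r u * c r u.
have Sc i : S u (c i) = b i.
  by apply/eqP; rewrite -subr_eq0 -(pcoef_trace hD i au) tr.
(* The factor [1 / C^2] is eliminated between [T_mjk] and [T_ppp]. *)
have key m' j' k' v : Dom v -> c p v * c p v * c p v * t m' j' k' v =
    t p p p v * (c m' v * c j' v * c k' v).
  by move=> av; rewrite !(tE _ _ _ _ av); ring.
have scc i i' := smooth_at_mul (sc i) (sc i').
have sccc i i' i2 := smooth_at_mul (scc i i') (sc i2).
have Skey : 3 * c p u ^+ 2 * b p * t m j k u + c p u ^+ 3 * S u (t m j k) =
    S u (t p p p) * (c m u * c j u * c k u) +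
    t p p p u * (b m * c j u * c k u + c m u * b j * c k u + c m u * c j u * b k).
  have := tangent_germ tb (proj2 oD) au (key m j k).
  rewrite (tangent_mul gT tb (sccc p p p) (st m j k)).
  rewrite (tangent_mul gT tb (st p p p) (sccc m j k)).
  rewrite !(tangent_mul gT tb (scc _ _) (sc _)) !(tangent_mul gT tb (sc _) (sc _)) !Sc => e.
  rewrite (_ : 3 * c p u ^+ 2 * b p * t m j k u + c p u ^+ 3 * S u (t m j k) =
    c p u * c p u * c p u * S u (t m j k) +
    t m j k u * (c p u * c p u * b p + c p u * (c p u * b p + c p u * b p))); last by ring.
  rewrite e; ring.
have sumN q (f d : 'I_n -> R) : (forall r, c p u * c p u * c p u * f r = d r) ->
    c p u ^+ 3 * (\sum_r N q r u * f r) = \sum_r N q r u * d r.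
  by move=> fd; rewrite mulr_sumr; apply: eq_bigr => r _; rewrite -fd; ring.
have s1 : c p u ^+ 3 * (\sum_r N m r u * t r j k u) = t p p p u * (b m * c j u * c k u).
  rewrite (sumN m _ _ (fun r => key r j k u au)) /b; move: (t p p p u) => x.
  by rewrite !mulr_suml mulr_sumr; apply: eq_bigr => r _; ring.
have s2 : c p u ^+ 3 * (\sum_r N j r u * t m r k u) = t p p p u * (c m u * b j * c k u).
  rewrite (sumN j _ _ (fun r => key m r k u au)) /b; move: (t p p p u) => x.
  rewrite [c m u * _]mulrC !mulr_suml mulr_sumr.
  by apply: eq_bigr => r _; ring.
have s3 : c p u ^+ 3 * (\sum_r N k r u * t m j r u) = t p p p u * (c m u * c j u * b k).
  rewrite (sumN k _ _ (fun r => key m j r u au)) /b; move: (t p p p u) => x.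
  by rewrite !mulr_sumr; apply: eq_bigr => r _; ring.
have c3 : c p u ^+ 3 != 0 by rewrite expf_neq0.
apply: (mulfI c3); rewrite mulr0 mulrBr /nabla_tcoef !mulrBr s1 s2 s3.
have -> : c p u ^+ 3 * S u (t m j k) = S u (t p p p) * (c m u * c j u * c k u) +
    t p p p u * (b m * c j u * c k u + c m u * b j * c k u + c m u * c j u * b k) -
    3 * c p u ^+ 2 * b p * t m j k u by rewrite -Skey; ring.
have -> : c p u ^+ 3 * (mu * t m j k u) =
    (S u (t p p p) * Csq L D u - 3 * c p u ^+ 2 * b p) * t m j k u.
  by rewrite /mu mulrA [X in X * _]mulrC divfK.
have [su _] := au; have /eqP q0 := Cs0 _ su.
have -> : c m u * c j u * c k u = Csq L D u * t m j k u by rewrite (tE m j k u au) mulVKf.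
ring.
Qed.

(** The equality of [theta] and [c] is asked at the point [u] only, to see that C <> 0 there;
    [Cform_ctrace] supplies it in the chart that [trace] uses at [u]. *)
Lemma P_star_pcoef u : Dom u -> P_star L D -> (forall j, theta j u = c j u) ->
  (forall j, \sum_m pcoef D a j m m u = 0) -> forall j m i, pcoef D a j m i u = 0.
Proof.
move=> au [Cs0 red] tc tr; have [su _] := au.
have oD := slit_open_dom a; have pf q := frame_pifield (a := a) q.
have [w [_ Cw]] := Csq_neq0 au (Cs0 _ su).
have ex : exists p, c p u != 0.
  apply/existsP; apply: contra_notT (Cs0 _ su); rewrite negb_exists => /forallP c0.
  rewrite Cw big1 // => l _; rewrite tc.
  by have := c0 l; rewrite negbK => /eqP ->; rewrite mulr0.
apply: (proportional_pcoef hD au _ tr ex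
  (mu := ghat L (cov_form D (betaF D (@eta R n M)) (Cform D)) (Cform D) u / Csq L D u)) => m j l.
rewrite -(cov_tensor_chart hD m j l au) (red _ _ _ _ oD (pf m) (pf j) au).
by rewrite -[LHS]/(_ * _) (Ttor_frame reg m j au) (frame_comb_coord _ l au).
Qed.

End Chart.

(** Here the frame of the argument and the frame of the trace coincide; [vcoef_sym] exchanges the
    contracted slot. *)
Lemma Cform_ctrace u j : slit u ->
  ccoef D (chart_at u.1) j u = ctrace D (chart_at u.1) j u.
Proof.
move=> su; have au : cdom (c := ChT) (chart_at u.1) u by split=> //; rewrite /chart_at; case: cid.
rewrite ccoef.unlock; apply: eq_bigr => m _; rewrite (Ttor_frame reg j m au) (frame_comb_coord _ m au).
exact: (vcoef_sym hD j m m au).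
Qed.

Lemma general_landsberg_trace u j : general_landsberg D -> slit u ->
  \sum_m pcoef D (chart_at u.1) j m m u = 0.
Proof.
move=> gen su; have au : cdom (c := ChT) (chart_at u.1) u by split=> //; rewrite /chart_at; case: cid.
rewrite -[RHS](gen _ _ _ (slit_open_dom (chart_at u.1)) (frame_pifield j) au).
by apply: eq_bigr => m _; rewrite (Phat_frame hD j m m au).
Qed.

End Cases.

Theorem corollary3p13 (R : realType) (n : nat) (M : manifold R n)
  (L : finsler M) (D : linear_connection M) (hD : is_cartan L D) :
  C_reducible L D \/ P_reducible L D \/ C2_like L D \/ P_star L D ->
  (landsberg D <-> general_landsberg D).
Proof.
move=> special; split; first exact: landsberg_general.
move=> gen W X Y u oW pX pY Wu; have [sW _] := oW; have su := sW _ Wu.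
(* The argument at [u] takes place in the chart whose frame [trace] uses there. *)
have au : cdom (c := slit_charts M) (chart_at u.1) u by split=> //; rewrite /chart_at; case: cid.
apply: (pcoef_landsberg hD oW pX pY Wu au).
have tr j := general_landsberg_trace hD j gen su.
case: special => [Cred|[Pred|[C2|Ps]]].
- exact (C_reducible_pcoef hD au Cred tr).
- exact (P_reducible_pcoef hD au Pred tr).
- exact (C2_like_pcoef hD au C2 tr).
- have tc j := Cform_ctrace hD j su.
  exact (P_star_pcoef hD au Ps tc tr).
Qed.
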